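(* Let $(M,\Delta,g)$ be a real-analytic sub-Riemannian manifold of rank two (that is, $M$, $\Delta$ and $g$ are real-analytic), with a global orthonormal frame $X_1,X_2$. Then regular abnormal geodesics of $(M,\Delta,g)$ cannot have regular abnormal branching at any time, and regular abnormal geodesics (that are also normal) cannot have normal branching at any time.
   Context: Setting: $M$ is a smooth manifold, $\Delta\subset TM$ a smooth totally nonholonomic (bracket-generating) distribution of constant rank $2$, $g$ a Riemannian metric on $\Delta$, and $X_1,X_2$ a fixed global $g$-orthonormal frame of $\Delta$. A horizontal curve is an absolutely continuous $\gamma:[0,T]\to M$ with $\dot\gamma=u_1X_1(\gamma)+u_2X_2(\gamma)$ a.e. for some (unique) control $u\in L^2([0,T],\mathbb{R}^2)$; its length is $L(\gamma)=\int_0^T|u(t)|\,dt$, and $d(p,q)$ is the infimum of lengths of horizontal curves from $p$ to $q$. A horizontal curve is a length minimizer if its length equals the distance $d$ between its endpoints; a geodesic is a horizontal curve with constant speed such that every $t\in[0,T]$ has an $\varepsilon>0$ for which the restriction to $[t-\varepsilon,t+\varepsilon]\cap[0,T]$ is a length minimizer. Notation: $\pi:T^*M\to M$ is the projection, $h_X(\lambda)=\langle\lambda,X(\pi(\lambda))\rangle$, $X_{i_1\dots i_k}=[X_{i_1},\dots,[X_{i_{k-1}},X_{i_k}]\dots]$, $h_{i_1\dots i_k}=h_{X_{i_1\dots i_k}}$. For a smooth function $h$ on $T^*M$, $\vec h$ is its Hamiltonian vector field, $\omega(\cdot,\vec h)=dh$ with $\omega$ the canonical symplectic form (in canonical coordinates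 $\dot x=\partial_p h$, $\dot p=-\partial_x h$). A normal geodesic is a geodesic that is the projection to $M$ of an integral curve of $\vec H$, $H=\frac12(h_1^2+h_2^2)$. Let $\Delta_2^\perp=\{h_1=h_2=h_{12}=0\}$, $\Delta_3^\perp=\{h_1=h_2=h_{12}=h_{112}=h_{212}=0\}\subset T^*M$ and $\mathcal{R}=\Delta_2^\perp\setminus\Delta_3^\perp$, a submanifold of $T^*M$. On $\mathcal{R}$ the vector field (tangent to $\mathcal R$) $$\vec G=\frac{-h_{212}}{\sqrt{h_{212}^2+h_{112}^2}}\,\vec h_1+\frac{h_{112}}{\sqrt{h_{212}^2+h_{112}^2}}\,\vec h_2$$ is defined. A regular abnormal path is the projection to $M$ of an integral curve (contained in $\mathcal{R}$) of $\vec G$ or $-\vec G$. It is known that every regular abnormal path is a (unit-speed) geodesic; it is then called a regular abnormal geodesic. A normal (resp. regular abnormal) geodesic $\gamma:[0,T]\to M$ has a normal (resp. regular abnormal) branching at time $\tau\in(0,T)$ if there exist $\varepsilon_0>0$ and a normal (resp. regular abnormal) geodesic $\bar\gamma:[0,\tau+\varepsilon_0]\to M$ such that $\bar\gamma|_{[0,\tau]}=\gamma|_{[0,\tau]}$ and $\bar\gamma|_{[0,\tau+\varepsilon]}\neq\gamma|_{[0,\tau+\varepsilon]}$ for all $0<\varepsilon\le\varepsilon_0$. *)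

(* Defs.v *)
From HB Require Import structures.
From mathcomp Require Import all_boot all_order all_algebra.
From mathcomp Require Import all_classical all_reals all_analysis.
Set Implicit Arguments.
Unset Strict Implicit.
Unset Printing Implicit Defensive.
Import Order.TTheory GRing.Theory Num.Theory.
Import numFieldNormedType.Exports.
Local Open Scope classical_set_scope.
Local Open Scope ring_scope.

Section Calculus.
Context {R : realType} {n : nat}.

(* C^oo: every iterated directional derivative is Frechet differentiable. *)
Definition smooth_on (W : normedModType R) (U : set 'rV[R]_n)
    (f : 'rV[R]_n -> W) : Prop :=
  forall (vs : seq 'rV[R]_n) (x : 'rV[R]_n), U x ->
    differentiable
      (foldr (fun v (h : 'rV[R]_n -> W) y => 'D_v h y) f vs) x.

(* Sum of the terms of multidegree in {0, ..., N-1}^n of the power series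
   with coefficients [c]. *)
Definition psum (c : ('I_n -> nat) -> R) (x : 'rV[R]_n) (N : nat) : R :=
  \sum_(a : {ffun 'I_n -> 'I_N})
    c (fun i => nat_of_ord (a i)) * \prod_(i < n) x ord0 i ^+ a i.

(* Near [a], [f] is the sum of an absolutely convergent power series. *)
Definition analytic_at (f : 'rV[R]_n -> R) (a : 'rV[R]_n) : Prop :=
  exists (c : ('I_n -> nat) -> R) (r : R), 0 < r /\
    forall x : 'rV[R]_n, (forall i, `|x ord0 i - a ord0 i| < r) ->
      cvgn (psum (fun m => `|c m|) (map_mx Num.norm (x - a))) /\
      (psum c (x - a) @ \oo --> f x).

Definition analytic_on (U : set 'rV[R]_n) (f : 'rV[R]_n -> R) : Prop :=
  forall a, U a -> analytic_at f a.

Definition analytic_map_on (m : nat) (U : set 'rV[R]_n)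
    (f : 'rV[R]_n -> 'rV[R]_m) : Prop :=
  forall j, analytic_on U (fun y => f y ord0 j).

Definition dotrow (u v : 'rV[R]_n) : R := \sum_(i < n) u ord0 i * v ord0 i.

Definition gradient (f : 'rV[R]_n -> R) (x : 'rV[R]_n) : 'rV[R]_n :=
  \row_i 'D_(delta_mx ord0 i) f x.

End Calculus.

(* Derivative at [t] along [A]; one-sided at an endpoint of an interval [A]. *)
Definition deriv_within {R : realType} {V : normedModType R} (A : set R)
    (f : R -> V) (t : R) (v : V) : Prop :=
  (fun s => (s - t)^-1 *: (f s - f t)) @ within A t^' --> v.

Definition abs_continuous {R : realType} {V : normedModType R} (a b : R)
    (f : R -> V) : Prop :=
  forall e : R, 0 < e -> exists d : R, 0 < d /\
    forall (k : nat) (l r : 'I_k -> R),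
      (forall i, a <= l i /\ l i <= r i /\ r i <= b) ->
      (forall i j, i != j -> r i <= l j \/ r j <= l i) ->
      \sum_(i < k) (r i - l i) < d ->
      \sum_(i < k) `|f (r i) - f (l i)| < e.

(* The maps [chart i] and [ichart i] are total, but only their restrictions to
   [dom i] and to [chart i @` dom i] are meaningful.  The chart [chart_at x] is
   an arbitrary chart around [x]; it fixes the coordinates in which vectors and
   covectors at [x] are written. *)
Record analyticManifold (R : realType) (n : nat) := AnalyticManifold {
  mcarrier :> topologicalType ;
  m_hausdorff : hausdorff_space mcarrier ;
  m_second_countable : @second_countable mcarrier ;
  atlas : Type ;
  dom : atlas -> set mcarrier ;
  chart : atlas -> mcarrier -> 'rV[R]_n ;
  ichart : atlas -> 'rV[R]_n -> mcarrier ;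
  chart_at : mcarrier -> atlas ;
  dom_chart_at : forall x, dom (chart_at x) x ;
  dom_open : forall i, open (dom i) ;
  codom_open : forall i, open (chart i @` dom i) ;
  chartK : forall i x, dom i x -> ichart i (chart i x) = x ;
  chart_continuous : forall i x, dom i x -> {for x, continuous (chart i)} ;
  ichart_continuous : forall i y, (chart i @` dom i) y ->
    {for y, continuous (ichart i)} ;
  transition_analytic : forall i j,
    analytic_map_on (chart i @` (dom i `&` dom j)) (chart j \o ichart i) }.

Section Manifold.
Context {R : realType} {n : nat} (M : analyticManifold R n).
Implicit Types (x : M) (i j : atlas M).

(* The tangent space T_x M and the cotangent space T*_x M are both represented
   by 'rV_n: vectors and covectors at [x] are given by their coordinates in
   [chart_at x].  A point of T*M is thus a pair [x : M], [p : 'rV_n]. *)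

(* Row-vector convention: the differential of the transition map is
   [v |-> v *m transJ i j x]. *)
Definition transJ i j x : 'M[R]_n :=
  jacobian (chart j \o @ichart R n M i) (chart i x).

(* Change of coordinates, from chart [i] to chart [j], of a vector at [x]. *)
Definition tan_change i j x (v : 'rV[R]_n) : 'rV[R]_n := v *m transJ i j x.

(* The same for a covector, so that
   [dotrow (cot_change i j x q) (tan_change i j x v) = dotrow q v]. *)
Definition cot_change i j x (q : 'rV[R]_n) : 'rV[R]_n := q *m (transJ j i x)^T.

Definition vfield := M -> 'rV[R]_n.

Definition vf_loc i (X : vfield) (y : 'rV[R]_n) : 'rV[R]_n :=
  let x := ichart i y in tan_change (chart_at x) i x (X x).

Definition smooth_vf (X : vfield) : Prop :=
  forall i, smooth_on (chart i @` dom i) (vf_loc i X).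

Definition analytic_vf_on (U : set M) (X : vfield) : Prop :=
  forall i, analytic_map_on (chart i @` (U `&` dom i)) (vf_loc i X).

Definition analytic_fun_on (U : set M) (f : M -> R) : Prop :=
  forall i, analytic_on (chart i @` (U `&` dom i)) (f \o ichart i).

Definition bracket (X Y : vfield) : vfield := fun x =>
  let i := chart_at x in
  'D_(X x) (vf_loc i Y) (chart i x) - 'D_(Y x) (vf_loc i X) (chart i x).

Definition tdistribution := M -> {vspace 'rV[R]_n}.
Definition tmetric := M -> 'rV[R]_n -> 'rV[R]_n -> R.

Definition analytic_distribution (r : nat) (Delta : tdistribution) : Prop :=
  (forall x, \dim (Delta x) = r) /\
  forall x, exists (U : set M) (Y : 'I_r -> vfield),
    [/\ open U, U x, forall k, analytic_vf_on U (Y k) &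
      forall y, U y -> Delta y = <<[seq Y k y | k : 'I_r]>>%VS].

Inductive horizontal_lie (Delta : tdistribution) : vfield -> Prop :=
| HorizontalSection (X : vfield) of smooth_vf X & (forall x, X x \in Delta x) :
    horizontal_lie Delta X
| HorizontalBracket (X Y : vfield) of
    horizontal_lie Delta X & horizontal_lie Delta Y :
    horizontal_lie Delta (bracket X Y).

Definition bracket_generating (Delta : tdistribution) : Prop :=
  forall x, exists (k : nat) (Z : 'I_k -> vfield),
    (forall l, horizontal_lie Delta (Z l)) /\
    <<[seq Z l x | l : 'I_k]>>%VS = fullv.

Definition riemannian_metric_on (Delta : tdistribution) (g : tmetric) : Prop :=
  forall x,
    [/\ forall u v, u \in Delta x -> v \in Delta x -> g x u v = g x v u,
        forall (a : R) u v w, u \in Delta x -> v \in Delta x ->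
          w \in Delta x -> g x (a *: u + v) w = a * g x u w + g x v w &
        forall v, v \in Delta x -> v != 0 -> 0 < g x v v].

Definition analytic_metric (Delta : tdistribution) (g : tmetric) : Prop :=
  forall (U : set M) (Y Z : vfield), open U ->
    analytic_vf_on U Y -> analytic_vf_on U Z ->
    (forall x, U x -> Y x \in Delta x /\ Z x \in Delta x) ->
    analytic_fun_on U (fun x => g x (Y x) (Z x)).

Definition analytic_subriemannian (r : nat) (Delta : tdistribution)
    (g : tmetric) : Prop :=
  [/\ analytic_distribution r Delta, bracket_generating Delta,
      riemannian_metric_on Delta g & analytic_metric Delta g].

(* Since [Delta] has rank two, such [X1], [X2] span it. The frame is smooth,
   not necessarily analytic. *)
Definition orthonormal_frame2 (Delta : tdistribution) (g : tmetric)
    (X1 X2 : vfield) : Prop :=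
  [/\ smooth_vf X1, smooth_vf X2,
      forall x, X1 x \in Delta x /\ X2 x \in Delta x &
      forall x, [/\ g x (X1 x) (X1 x) = 1, g x (X2 x) (X2 x) = 1 &
                    g x (X1 x) (X2 x) = 0]].

(* A curve defined on an interval is a total function of which only the values
   on that interval matter. *)
Definition abs_continuous_curve (a b : R) (gam : R -> M) : Prop :=
  {within `[a, b], continuous gam} /\
  forall i (c d : R), a <= c -> c <= d -> d <= b ->
    (forall t, c <= t <= d -> dom i (gam t)) ->
    abs_continuous c d (chart i \o gam).

Definition has_velocity (A : set R) (gam : R -> M) (t : R) (v : 'rV[R]_n) :=
  deriv_within A (chart (chart_at (gam t)) \o gam) t v.

(* [u1 X1 + u2 X2], with [u = (u1, u2)] in L^2, is the velocity of [gam] on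
   [a, b]. *)
Definition is_control (X1 X2 : vfield) (a b : R) (gam : R -> M)
    (u1 u2 : R -> R) : Prop :=
  [/\ abs_continuous_curve a b gam,
      measurable_fun `[a, b] u1 /\ measurable_fun `[a, b] u2,
      (\int[@lebesgue_measure R]_(t in `[a, b])
         (u1 t ^+ 2 + u2 t ^+ 2)%:E < +oo)%E &
      {ae @lebesgue_measure R, forall t, `[a, b]%classic t ->
         has_velocity `[a, b] gam t (u1 t *: X1 (gam t) + u2 t *: X2 (gam t))}].

Definition has_length (X1 X2 : vfield) (a b : R) (gam : R -> M)
    (l : \bar R) : Prop :=
  exists u1 u2 : R -> R, is_control X1 X2 a b gam u1 u2 /\
    l = (\int[@lebesgue_measure R]_(t in `[a, b])
           (Num.sqrt (u1 t ^+ 2 + u2 t ^+ 2))%:E)%E.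

Definition sr_dist (X1 X2 : vfield) (x y : M) : \bar R :=
  ereal_inf [set l | exists (T : R) (gam : R -> M),
    [/\ 0 < T, gam 0 = x, gam T = y & has_length X1 X2 0 T gam l]].

Definition length_minimizer (X1 X2 : vfield) (a b : R) (gam : R -> M) : Prop :=
  has_length X1 X2 a b gam (sr_dist X1 X2 (gam a) (gam b)).

Definition constant_speed (X1 X2 : vfield) (a b : R) (gam : R -> M) : Prop :=
  exists (u1 u2 : R -> R) (c : R), is_control X1 X2 a b gam u1 u2 /\
    {ae @lebesgue_measure R, forall t, `[a, b]%classic t ->
       Num.sqrt (u1 t ^+ 2 + u2 t ^+ 2) = c}.

Definition geodesic (X1 X2 : vfield) (T : R) (gam : R -> M) : Prop :=
  [/\ 0 < T, constant_speed X1 X2 0 T gam &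
      forall t, 0 <= t <= T -> exists e : R, 0 < e /\
        length_minimizer X1 X2 (Num.max 0 (t - e)) (Num.min T (t + e)) gam].

Definition cotfun := M -> 'rV[R]_n -> R.
(* A tangent vector to T*M at [(x, p)] is a pair of row vectors, its
   coordinates in the chart of T*M induced by [chart_at x]. *)
Definition cotvf := M -> 'rV[R]_n -> 'rV[R]_n * 'rV[R]_n.

Definition ham_vf (h : cotfun) : cotvf := fun x p =>
  let i := chart_at x in
  (gradient (h x) p,
   - gradient (fun y => let z := ichart i y in
                        h z (cot_change i (chart_at z) z p)) (chart i x)).

Definition integral_curve (V : cotvf) (T : R) (gam : R -> M)
    (p : R -> 'rV[R]_n) : Prop :=
  {within `[0, T], continuous gam} /\
  forall t, 0 <= t <= T ->
    let i := chart_at (gam t) in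
    deriv_within `[0, T]
      (fun s => (chart i (gam s),
                 cot_change (chart_at (gam s)) i (gam s) (p s)))
      t (V (gam t) (p t)).

Definition hlin (X : vfield) : cotfun := fun x p => dotrow p (X x).

Section Frame.
Variables X1 X2 : vfield.

Definition X12 : vfield := bracket X1 X2.
Definition X112 : vfield := bracket X1 X12.
Definition X212 : vfield := bracket X2 X12.

Definition H_normal : cotfun := fun x p =>
  2%:R^-1 * (hlin X1 x p ^+ 2 + hlin X2 x p ^+ 2).

Definition Delta2_perp : set (M * 'rV[R]_n) :=
  [set l | [/\ hlin X1 l.1 l.2 = 0, hlin X2 l.1 l.2 = 0 &
               hlin X12 l.1 l.2 = 0]].

Definition Delta3_perp : set (M * 'rV[R]_n) :=
  Delta2_perp `&`
  [set l | hlin X112 l.1 l.2 = 0 /\ hlin X212 l.1 l.2 = 0].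

Definition Rset : set (M * 'rV[R]_n) := Delta2_perp `\` Delta3_perp.

Definition G_vf : cotvf := fun x p =>
  let h112 := hlin X112 x p in
  let h212 := hlin X212 x p in
  let N := Num.sqrt (h212 ^+ 2 + h112 ^+ 2) in
  (- h212 / N) *: ham_vf (hlin X1) x p + (h112 / N) *: ham_vf (hlin X2) x p.

Definition normal_geodesic (T : R) (gam : R -> M) : Prop :=
  geodesic X1 X2 T gam /\
  exists p : R -> 'rV[R]_n, integral_curve (ham_vf H_normal) T gam p.

(* Regular abnormal paths are known to be geodesics, so this is not required
   here. *)
Definition regular_abnormal_geodesic (T : R) (gam : R -> M) : Prop :=
  0 < T /\
  exists p : R -> 'rV[R]_n,
    (forall t, 0 <= t <= T -> Rset (gam t, p t)) /\
    (integral_curve G_vf T gam p \/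
     integral_curve (fun x q => - G_vf x q) T gam p).

End Frame.

(* Branching at time [tau], within the class [P] of curves, of a curve [gam]
   defined on [0, T].  The values of [gam] beyond [T] are irrelevant: the last
   condition holds for all [eps] as soon as it holds for small ones. *)
Definition branching (P : R -> (R -> M) -> Prop) (T : R) (gam : R -> M)
    (tau : R) : Prop :=
  0 < tau < T /\
  exists (eps0 : R) (gam' : R -> M),
    [/\ 0 < eps0, P (tau + eps0) gam',
        forall t, 0 <= t <= tau -> gam' t = gam t &
        forall eps, 0 < eps <= eps0 ->
          exists t, 0 <= t <= tau + eps /\ gam' t <> gam t].

End Manifold.

(* Main.v *)
Require Import Defs.
From HB Require Import structures.
From mathcomp Require Import all_boot all_order all_algebra.
From mathcomp Require Import all_classical all_reals all_analysis.
From mathcomp Require Import ring lra.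
Import Order.TTheory GRing.Theory Num.Theory.
Import numFieldNormedType.Exports.
Local Open Scope classical_set_scope.
Local Open Scope ring_scope.
Set Implicit Arguments.
Unset Strict Implicit.
Unset Printing Implicit Defensive.

(** Normal and regular abnormal geodesics do not branch because, in suitable
    coordinates, both are projections of integral curves of real-analytic
    vector fields. Two such geodesics that agree before time [tau] have analytic
    coordinates near [tau], and the identity theorem makes them agree slightly
    after [tau]. The covector lifts of the two geodesics need not agree: only
    the analyticity of each projection matters.

    Analyticity is handled through bounds on iterated partial derivatives.
    [jet k f z] is the sum of the absolute values of all derivatives of order
    [k] of [f] at [z], divided by [k!], and [f] is analytic at a point when
    the sums [jetsum s K f], that is, the truncations of the series of the
    [s ^ k jet k f], are bounded near that point, uniformly in [K], for some
    positive [s]. Leibniz' rule makes these sums submultiplicative, so that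
    sums, products, derivatives ([ana_pd]) and reciprocal square roots
    ([ana_rsqrt]) of analytic functions are analytic. Sums of power series are
    analytic in this sense, since the bounds pass from partial sums to limits
    ([limit_ana_on], [analytic_ana]); the same limit shows that their mixed
    derivatives commute ([analytic_pdC]).

    If [z' = F z] with [F] analytic, the [k]-th derivative of [f] along [z] is
    the [k]-th Lie derivative of [f] along [F], and a majorant induction bounds
    it by [A C ^ k k!] ([jet_iter_lie], [integral_curve_analytic]). Functions of
    one variable with such bounds obey the identity theorem
    ([analytic_curve_unique]), by Taylor's formula.

    It remains to put both kinds of geodesics in this form. The definitions
    write vectors and covectors at each point in a chart that depends on that
    point. Brackets and cotangent lifts do not depend on the chart, because
    second derivatives of transition maps are symmetric ([lbr_related],
    [cotangent_lift_related]), so a lifted curve can be studied in a single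
    chart ([frame_curve_in_chart]). There the orthonormal frame [X1], [X2] is
    only smooth. Gram-Schmidt, applied to a local analytic frame of the
    distribution, gives an analytic orthonormal frame [Z1], [Z2], which differs
    from [X1], [X2] by a smooth function with values in the orthogonal group
    ([analytic_frame]). Neither the normal Hamiltonian field nor, along its
    integral curves, the abnormal field sees this change of frame
    ([normal_frame_change], [abnormal_frame_change]), and with respect to [Z1],
    [Z2] both fields are analytic functions of position and momentum. *)

(** * Differentiability *)

Section Differentiability.
Context {R : realType} {V W : normedModType R}.
Implicit Types (f g : V -> W) (x : V).

Lemma diffP_le f x : differentiable f x <->
  exists2 df : {linear V -> W}, continuous df &
    forall e, 0 < e -> \forall h \near (0 : V),
      `|f (h + x) - f x - df h| <= e * `|h|.
Proof.
split=> [df|[df dfc H]].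
  exists ('d f x); first exact: diff_continuous.
  move=> e e0; have /eqaddoP /(_ e e0) := diff_locally df.
  by apply: filterS => h /=; rewrite opprD addrA.
have E : f \o shift x = cst (f x) + df +o_ (0 : V) id.
  apply/eqaddoP => e e0; apply: filterS (H e e0) => h /=.
  by rewrite [X in `|X| <= _]/= opprD addrA.
apply/diff_locallyP; rewrite (diff_unique dfc E); split=> // z; exact: dfc.
Qed.

Lemma diff_le f x (df : {linear V -> W}) : continuous df ->
  (forall e, 0 < e -> \forall h \near (0 : V),
      `|f (h + x) - f x - df h| <= e * `|h|) -> 'd f x = df :> (V -> W).
Proof.
move=> dfc H; apply: diff_unique => //.
apply/eqaddoP => e e0; apply: filterS (H e e0) => h /=.
by rewrite [X in `|X| <= _]/= opprD addrA.
Qed.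

Lemma near_eq_differentiable f g x :
  (\forall y \near x, f y = g y) -> differentiable f x -> differentiable g x.
Proof.
move=> fg /diffP_le [df dfc H]; apply/diffP_le; exists df => // e e0.
have fg' : \forall h \near (0 : V), f (h + x) = g (h + x).
  by move: fg; rewrite (near_shift 0) subr0.
have fx : f x = g x by exact: nbhs_singleton fg.
by apply: filterS2 fg' (H e e0) => h <-; rewrite fx.
Qed.

End Differentiability.

(** Locking keeps unification from unfolding limits of difference quotients. *)
HB.lock Definition pd (R : realType) (m : nat) (i : 'I_m)
  (f : 'rV[R]_m -> R) (z : 'rV[R]_m) : R := 'D_(delta_mx ord0 i) f z.

Section PartialDerivatives.
Context {R : realType} {m : nat}.
Implicit Types (f g : 'rV[R]_m -> R) (z : 'rV[R]_m) (O : set 'rV[R]_m)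
  (i : 'I_m).

Lemma pdE i f z : pd i f z = 'D_(delta_mx ord0 i) f z.
Proof. by rewrite pd.unlock. Qed.

Lemma in_near O z (P : 'rV[R]_m -> Prop) : open O -> O z ->
  (forall y, O y -> P y) -> \forall y \near z, P y.
Proof.
move=> Oo Oz H; have : nbhs z O by apply: open_nbhs_nbhs.
exact: filterS.
Qed.

Lemma pd_eq O i f g : open O -> (forall z, O z -> f z = g z) ->
  forall z, O z -> pd i f z = pd i g z.
Proof.
move=> Oo fg z zO; rewrite !pdE; apply: near_eq_derive; exact: in_near fg.
Qed.

Lemma diff_eq_on O f g : open O -> (forall z, O z -> f z = g z) ->
  forall z, O z -> differentiable f z -> differentiable g z.
Proof.
move=> Oo fg z zO; apply: near_eq_differentiable; exact: in_near fg.
Qed.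

Lemma pdD i f g z : differentiable f z -> differentiable g z ->
  pd i (f \+ g) z = pd i f z + pd i g z.
Proof.
by move=> df dg; rewrite !pdE; apply: deriveD; exact: diff_derivable.
Qed.

Lemma pdM i f g z : differentiable f z -> differentiable g z ->
  pd i (f \* g) z = pd i f z * g z + f z * pd i g z.
Proof.
move=> df dg; rewrite !pdE.
have -> := @deriveM R _ f g z (delta_mx ord0 i); try exact: diff_derivable.
by rewrite addrC [g z *: _]mulrC.
Qed.

Lemma pd_cst i (c : R) z : pd i (cst c) z = 0.
Proof. by rewrite pdE derive_cst. Qed.

Lemma derive_pd f z v : differentiable f z ->
  'D_v f z = \sum_i v ord0 i * pd i f z.
Proof.
move=> df; rewrite deriveE // {1}(row_sum_delta v) linear_sum.
by apply: eq_bigr => i _; rewrite linearZ pdE deriveE.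
Qed.

Lemma diff_coord j z : differentiable (fun y : 'rV[R]_m => y ord0 j) z.
Proof. exact: differentiable_coord. Qed.

Lemma derive_coord j z v : 'D_v (fun y : 'rV[R]_m => y ord0 j) z = v ord0 j.
Proof.
rewrite deriveE; last exact: diff_coord.
have @f : {linear 'rV[R]_m -> R}.
  by exists (fun N : 'rV[R]_m => N ord0 j); do 2![eexists]; do ?[constructor];
     rewrite ?mxE// => ? *; rewrite ?mxE//; move=> ?; rewrite !mxE.
by rewrite (_ : (fun _ => _) = f) // diff_lin //; exact/coord_continuous.
Qed.

Lemma pd_coord i j z : pd i (fun y : 'rV[R]_m => y ord0 j) z = (j == i)%:R.
Proof. by rewrite pdE derive_coord mxE eqxx /=. Qed.

Lemma diff_coordB j c z : differentiable (fun y : 'rV[R]_m => y ord0 j - c) z.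
Proof. by apply: differentiableB => //; exact: diff_coord. Qed.

Lemma pd_coordB i j c z :
  pd i (fun y : 'rV[R]_m => y ord0 j - c) z = (j == i)%:R.
Proof.
rewrite -(pd_coord i j z) -[LHS]/(pd i ((fun y => y ord0 j) \+ cst (- c)) z).
by rewrite pdD ?pd_cst ?addr0 //; exact: diff_coord.
Qed.

End PartialDerivatives.

(** * Iterated derivatives and their weighted sums *)

Section Jets.
Context {R : realType} {m : nat}.
Implicit Types (f g : 'rV[R]_m -> R) (z : 'rV[R]_m) (O : set 'rV[R]_m)
  (i : 'I_m) (k K : nat).

Fixpoint Ck k f z : Prop :=
  differentiable f z /\ if k is k'.+1 then forall i, Ck k' (pd i f) z else True.

Definition smooth_at f z := forall k, Ck k f z.

(** The derivatives of order [k] are indexed by words in the coordinates rather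
    than by multi-indices, hence [k!] in place of multinomial factors. *)
Fixpoint jet k f z : R :=
  if k is k'.+1 then k'.+1%:R^-1 * \sum_i jet k' (pd i f) z else `|f z|.

Definition jetsum (s : R) K f z : R := \sum_(k < K) s ^+ k * jet k f z.

Lemma Ck_diff k f z : Ck k f z -> differentiable f z.
Proof. by case: k => [|k] []. Qed.

Lemma Ck_pd k i f z : Ck k.+1 f z -> Ck k (pd i f) z.
Proof. by move=> [_ H]; exact: H. Qed.

Lemma smooth_diff f z : smooth_at f z -> differentiable f z.
Proof. by move=> /(_ 0) []. Qed.

Lemma smooth_pd i f z : smooth_at f z -> smooth_at (pd i f) z.
Proof. by move=> sf k; exact: Ck_pd. Qed.

Lemma jet_ge0 k f z : 0 <= jet k f z.
Proof.
elim: k f => [f|k IH f] /=; first exact: normr_ge0.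
apply: mulr_ge0; first by rewrite invr_ge0 ler0n.
by apply: sumr_ge0 => i _; exact: IH.
Qed.

Lemma jetS k f z : k.+1%:R * jet k.+1 f z = \sum_i jet k (pd i f) z.
Proof. by rewrite /= mulVKf // pnatr_eq0. Qed.

Lemma Ck_eq O k f g : open O -> (forall z, O z -> f z = g z) ->
  forall z, O z -> Ck k f z -> Ck k g z.
Proof.
move=> Oo; elim: k f g => [|k IH] f g fg z Oz /= [df H].
  by split=> //; exact: (diff_eq_on Oo fg Oz df).
split; first exact: (diff_eq_on Oo fg Oz df).
by move=> i; apply: IH (H i) => //; exact: pd_eq.
Qed.

Lemma jet_eq O k f g : open O -> (forall z, O z -> f z = g z) ->
  forall z, O z -> jet k f z = jet k g z.
Proof.
move=> Oo; elim: k f g => [|k IH] f g fg z Oz /=; first by rewrite fg.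
by congr (_ * _); apply: eq_bigr => i _; apply: IH => //; exact: pd_eq.
Qed.

Lemma CkD O k f g : open O -> (forall z, O z -> Ck k f z) ->
  (forall z, O z -> Ck k g z) -> forall z, O z -> Ck k (f \+ g) z.
Proof.
move=> Oo; elim: k f g => [|k IH] f g cf cg z Oz /=.
  by split=> //; apply: differentiableD; [case: (cf z Oz)|case: (cg z Oz)].
split; first by apply: differentiableD; [case: (cf z Oz)|case: (cg z Oz)].
move=> i; apply: (@Ck_eq O k (pd i f \+ pd i g)) => //.
  by move=> y Oy; rewrite pdD //; [case: (cf y Oy)|case: (cg y Oy)].
by apply: IH => // y Oy; apply: Ck_pd; [exact: cf|exact: cg].
Qed.

Lemma CkS k f z : Ck k.+1 f z -> Ck k f z.
Proof.
elim: k f => [|k IH] f [df H]; split=> // i; exact: IH.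
Qed.

Lemma CkM O k f g : open O -> (forall z, O z -> Ck k f z) ->
  (forall z, O z -> Ck k g z) -> forall z, O z -> Ck k (f \* g) z.
Proof.
move=> Oo; elim: k f g => [|k IH] f g cf cg z Oz.
  by split=> //; apply: differentiableM; [case: (cf z Oz)|case: (cg z Oz)].
split; first by apply: differentiableM; [case: (cf z Oz)|case: (cg z Oz)].
move=> i; apply: (@Ck_eq O k ((pd i f \* g) \+ (f \* pd i g))) => //.
  by move=> y Oy; rewrite pdM //; [case: (cf y Oy)|case: (cg y Oy)].
apply: (@CkD O) => //; apply: IH => // y Oy; try exact: CkS (cf y Oy);
  try exact: CkS (cg y Oy); by apply: Ck_pd; (exact: cf || exact: cg).
Qed.

Lemma Ck_cst k (c : R) z : Ck k (cst c) z.
Proof.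
elim: k c z => [|k IH] c z; split=> //; try exact: differentiable_cst.
move=> i; apply: (@Ck_eq setT k (cst 0)) => //; first exact: openT.
by move=> y _; rewrite pd_cst.
Qed.

Lemma Ck_coordB k j c z : Ck k (fun y => y ord0 j - c) z.
Proof.
case: k => [|k]; split=> //; try exact: diff_coordB.
move=> i; apply: (@Ck_eq setT k (cst (j == i)%:R)) => //; first exact: openT.
  by move=> y _; rewrite pd_coordB.
exact: Ck_cst.
Qed.

Lemma jetD O k f g : open O -> (forall z, O z -> Ck k f z) ->
  (forall z, O z -> Ck k g z) ->
  forall z, O z -> jet k (f \+ g) z <= jet k f z + jet k g z.
Proof.
move=> Oo; elim: k f g => [|k IH] f g cf cg z Oz /=; first exact: ler_normD.
rewrite -mulrDr ler_wpM2l ?invr_ge0 ?ler0n // -big_split /=.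
apply: ler_sum => i _.
rewrite (@jet_eq O k _ (pd i f \+ pd i g)) //; last first.
  by move=> y Oy; rewrite pdD //; [case: (cf y Oy)|case: (cg y Oy)].
by apply: IH => // y Oy; apply: Ck_pd; [exact: cf|exact: cg].
Qed.

Lemma jet_cst k (c : R) z : jet k.+1 (cst c) z = 0.
Proof.
elim: k c z => [|k IH] c z.
  by rewrite /= big1 ?mulr0 // => i _; rewrite pd_cst normr0.
rewrite -[LHS]mul1r -(mulVf (_ : k.+2%:R != 0 :> R)) ?pnatr_eq0 //.
rewrite -mulrA jetS big1 ?mulr0 // => i _.
rewrite (@jet_eq setT _ _ (cst 0)) //; first exact: openT.
by move=> y _; rewrite pd_cst.
Qed.

End Jets.

Section WeightedSums.
Context {R : realType} {m : nat}.
Implicit Types (f g : 'rV[R]_m -> R) (z : 'rV[R]_m) (O : set 'rV[R]_m)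
  (i : 'I_m) (k K : nat) (s B : R).
Local Arguments jet : simpl never.

(** Both sides sum [a j * b l] over [j + l < K]. *)
Lemma sum_conv (a b : nat -> R) K :
  \sum_(k < K) \sum_(j < k.+1) a j * b (k - j)%N =
  \sum_(j < K) a j * \sum_(l < K - j) b l.
Proof.
elim: K => [|K IH]; first by rewrite !big_ord0.
rewrite big_ord_recr /= {}IH [in RHS]big_ord_recr /= subSnn big_ord1.
rewrite [in LHS]big_ord_recr /= subnn addrA -big_split /=; congr (_ + _).
apply: eq_bigr => j _; rewrite -mulrDr subSn ?(ltnW (ltn_ord j)) //.
by rewrite [in RHS]big_ord_recr.
Qed.

Lemma ler_sum_conv (a b : nat -> R) K :
  (forall k, 0 <= a k) -> (forall k, 0 <= b k) ->
  \sum_(k < K) \sum_(j < k.+1) a j * b (k - j)%N <=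
  (\sum_(k < K) a k) * \sum_(k < K) b k.
Proof.
move=> a0 b0; rewrite sum_conv mulr_suml; apply: ler_sum => j _.
apply: ler_wpM2l => //; rewrite -[in leRHS](subnK (ltnW (ltn_ord j))).
by rewrite big_split_ord /= lerDl; apply: sumr_ge0.
Qed.

Lemma jetM O k f g : open O -> (forall z, O z -> Ck k f z) ->
  (forall z, O z -> Ck k g z) ->
  forall z, O z ->
  jet k (f \* g) z <= \sum_(j < k.+1) jet j f z * jet (k - j) g z.
Proof.
move=> Oo; elim: k f g => [|k IH] f g cf cg z Oz.
  rewrite big_ord1.
  by have -> : jet 0 (f \* g) z = jet 0 f z * jet 0 g z := normrM _ _.
rewrite -(ler_pM2l (_ : 0 < k.+1%:R :> R)) ?ltr0n // jetS.
have H1 i : jet k (pd i (f \* g)) z <=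
    \sum_(j < k.+1) jet j (pd i f) z * jet (k - j) g z +
    \sum_(j < k.+1) jet j f z * jet (k - j) (pd i g) z.
  rewrite (@jet_eq _ _ O k _ ((pd i f \* g) \+ (f \* pd i g))) //; last first.
    by move=> y Oy; rewrite pdM //; [case: (cf y Oy)|case: (cg y Oy)].
  apply: le_trans (@jetD _ _ O k _ _ _ _ _ _ _) _ => //.
  - apply: CkM => // y Oy; first by apply: Ck_pd; exact: cf.
    by apply: CkS; exact: cg.
  - apply: CkM => // y Oy; last by apply: Ck_pd; exact: cg.
    by apply: CkS; exact: cf.
  - apply: lerD; apply: IH => // y Oy.
    + by apply: Ck_pd; exact: cf.
    + by apply: CkS; exact: cg.
    + by apply: CkS; exact: cf.
    + by apply: Ck_pd; exact: cg.
apply: le_trans (ler_sum _ (fun i _ => H1 i)) _.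
rewrite big_split /= [in X in X + _]exchange_big [in X in _ + X]exchange_big /=.
have -> : \sum_(j < k.+1) \sum_i jet j (pd i f) z * jet (k - j) g z =
   \sum_(j < k.+2) j%:R * (jet j f z * jet (k.+1 - j) g z).
  rewrite [RHS]big_ord_recl mul0r add0r; apply: eq_bigr => j _.
  by rewrite -mulr_suml -jetS mulrA /=.
have -> : \sum_(j < k.+1) \sum_i jet j f z * jet (k - j) (pd i g) z =
   \sum_(j < k.+2) (k.+1 - j)%:R * (jet j f z * jet (k.+1 - j) g z).
  rewrite [RHS]big_ord_recr /= subnn mul0r addr0; apply: eq_bigr => j _.
  rewrite -mulr_sumr -jetS subSn; last by rewrite -ltnS.
  by rewrite mulrCA.
rewrite -big_split mulr_sumr /=; apply: ler_sum => j _.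
by rewrite -mulrDl -natrD subnKC // -ltnS.
Qed.

Lemma jetsum_ge0 s K f z : 0 <= s -> 0 <= jetsum s K f z.
Proof.
by move=> s0; apply: sumr_ge0 => k _; rewrite mulr_ge0 ?exprn_ge0 ?jet_ge0.
Qed.

Lemma jetsum_eq O s K f g : open O -> (forall z, O z -> f z = g z) ->
  forall z, O z -> jetsum s K f z = jetsum s K g z.
Proof.
by move=> Oo fg z Oz; apply: eq_bigr => k _; rewrite (jet_eq _ Oo fg).
Qed.

Lemma jetsumD O s K f g : open O -> 0 <= s ->
  (forall z, O z -> smooth_at f z) -> (forall z, O z -> smooth_at g z) ->
  forall z, O z -> jetsum s K (f \+ g) z <= jetsum s K f z + jetsum s K g z.
Proof.
move=> Oo s0 cf cg z Oz; rewrite -big_split; apply: ler_sum => k _ /=.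
rewrite -mulrDr; apply: ler_wpM2l; first exact: exprn_ge0.
by apply: (@jetD _ _ O) => // y Oy; [exact: cf|exact: cg].
Qed.

(** By Leibniz' rule the series of the [s ^ k jet k] of a product is bounded by
    the Cauchy product of those of the factors. *)
Lemma jetsumM O s K f g : open O -> 0 <= s ->
  (forall z, O z -> smooth_at f z) -> (forall z, O z -> smooth_at g z) ->
  forall z, O z -> jetsum s K (f \* g) z <= jetsum s K f z * jetsum s K g z.
Proof.
move=> Oo s0 cf cg z Oz.
pose a k := s ^+ k * jet k f z; pose b k := s ^+ k * jet k g z.
have a0 k : 0 <= a k by rewrite mulr_ge0 ?exprn_ge0 ?jet_ge0.
have b0 k : 0 <= b k by rewrite mulr_ge0 ?exprn_ge0 ?jet_ge0.
apply: le_trans _ (ler_sum_conv K a0 b0); apply: ler_sum => k _.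
have -> : \sum_(j < k.+1) a j * b (k - j)%N =
    s ^+ k * \sum_(j < k.+1) jet j f z * jet (k - j) g z.
  rewrite mulr_sumr; apply: eq_bigr => j _.
  have -> : s ^+ k = s ^+ j * s ^+ (k - j) by rewrite -exprD subnKC // -ltnS.
  by rewrite /a /b; ring.
apply: ler_wpM2l; first exact: exprn_ge0.
by apply: (@jetM O) => // y Oy; [exact: cf|exact: cg].
Qed.

Lemma jetsum_cst s K (c : R) z : 0 <= s -> jetsum s K (cst c) z <= `|c|.
Proof.
case: K => [|K] s0; first by rewrite /jetsum big_ord0.
rewrite /jetsum big_ord_recl /= expr0 mul1r big1 ?addr0 // => k _.
by rewrite (jet_cst k c z) mulr0.
Qed.

Lemma jetsum_mono s s' K f z : 0 <= s -> s <= s' ->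
  jetsum s K f z <= jetsum s' K f z.
Proof.
move=> s0 ss'; apply: ler_sum => k _; apply: ler_wpM2r; first exact: jet_ge0.
by apply: lerXn2r => //; rewrite nnegrE // (le_trans s0).
Qed.

Lemma jetsum_rec s K f z : 0 <= s ->
  jetsum s K.+1 f z <= `|f z| + s * \sum_i jetsum s K (pd i f) z.
Proof.
move=> s0; rewrite /jetsum big_ord_recl expr0 mul1r lerD2l.
rewrite exchange_big mulr_sumr; apply: ler_sum => k _.
rewrite exprS -mulrA; apply: ler_wpM2l => //; rewrite -mulr_sumr.
apply: ler_wpM2l; first exact: exprn_ge0.
have S0 : 0 <= \sum_i jet k (pd i f) z by apply: sumr_ge0 => i _; exact: jet_ge0.
have -> : jet (lift ord0 k) f z = k.+1%:R^-1 * \sum_i jet k (pd i f) z by [].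
rewrite -[leRHS]mul1r; apply: ler_wpM2r => //.
by rewrite invf_le1 ?ltr0n // ler1n.
Qed.

Lemma jetsum_coordB s K (j : 'I_m) c z : 0 <= s ->
  jetsum s K (fun y => y ord0 j - c) z <= `|z ord0 j - c| + s.
Proof.
case: K => [|K] s0; first by rewrite /jetsum big_ord0 addr_ge0.
apply: le_trans (jetsum_rec _ _ _ s0) _; rewrite lerD2l -[leRHS]mulr1.
apply: ler_wpM2l => //.
have H i : jetsum s K (pd i (fun y => y ord0 j - c)) z <= (j == i)%:R.
  rewrite (@jetsum_eq setT _ _ _ (cst (j == i)%:R)) //; last 2 first.
  - exact: openT.
  - by move=> y _; rewrite pd_coordB.
  by apply: le_trans (jetsum_cst _ _ _ s0) _; rewrite ger0_norm ?ler0n.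
apply: le_trans (ler_sum _ (fun i _ => H i)) _.
rewrite (bigD1 j) //= eqxx big1 ?addr0 // => i ij.
by rewrite eq_sym (negbTE ij).
Qed.

Lemma jet_pd_le k i f z : jet k (pd i f) z <= k.+1%:R * jet k.+1 f z.
Proof.
rewrite jetS (bigD1 i) //= lerDl; apply: sumr_ge0 => j _; exact: jet_ge0.
Qed.

(** A derivative costs a factor [k + 1] at order [k], which halving the radius
    absorbs since [k + 1 <= 2 ^ k]. *)
Lemma jetsum_pd s K i f z : 0 < s ->
  jetsum (s / 2) K (pd i f) z <= s^-1 * jetsum s K.+1 f z.
Proof.
move=> s0; rewrite /jetsum big_ord_recl mulrDr.
rewrite -[leLHS]add0r; apply: lerD.
  by rewrite mulr_ge0 ?invr_ge0 ?(ltW s0) // mulr_ge0 ?jet_ge0 ?exprn_ge0 ?(ltW s0).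
rewrite mulr_sumr; apply: ler_sum => k _.
apply: le_trans (ler_wpM2l _ (jet_pd_le _ _ _ _)) _.
  by rewrite exprn_ge0 // divr_ge0 // ltW.
have -> : jet (lift ord0 k) f z = jet k.+1 f z by [].
have := jet_ge0 k.+1 f z; move: (jet k.+1 f z) => j j0.
have -> : s^-1 * (s ^+ lift ord0 k * j) = s ^+ k * j.
  by rewrite exprS; field; rewrite gt_eqF.
rewrite mulrA; apply: ler_wpM2r => //.
rewrite expr_div_n -mulrA ler_piMr ?exprn_ge0 ?(ltW s0) //.
rewrite mulrC ler_pdivrMr ?exprn_gt0 // mul1r -natrX ler_nat.
exact: ltn_expl.
Qed.

End WeightedSums.

(** * Real-analytic functions, through bounds on iterated derivatives *)

Lemma near_open (T : topologicalType) (x : T) (P : T -> Prop) :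
  (\forall y \near x, P y) ->
  exists U : set T, [/\ open U, U x & forall y, U y -> P y].
Proof.
move=> h; have : nbhs x P := h.
by rewrite nbhsE => -[U [Uo Ux] UP]; exists U; split.
Qed.

Section Analytic.
Context {R : realType} {m : nat}.
Implicit Types (f g : 'rV[R]_m -> R) (z : 'rV[R]_m) (O : set 'rV[R]_m)
  (i : 'I_m) (k K : nat) (s B : R).

Definition ana_on O s B f := forall z, O z ->
  smooth_at f z /\ forall K, jetsum s K f z <= B.

(** Equivalent to real analyticity at [z0]; the neighbourhood is part of the
    definition because derivatives at a point do not control the function. *)
Definition ana z0 f := exists (O : set 'rV[R]_m) (s B : R),
  [/\ open O, O z0, 0 < s, 0 <= B & ana_on O s B f].

Lemma ana_onS O O' s s' B B' f : O' `<=` O -> 0 <= s' -> s' <= s -> B <= B' ->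
  ana_on O s B f -> ana_on O' s' B' f.
Proof.
move=> OO s0 ss BB H z /OO /H [sf b]; split=> // K.
by apply: le_trans BB; apply: le_trans (b K); exact: jetsum_mono.
Qed.

Lemma ana2 z0 f g : ana z0 f -> ana z0 g ->
  exists (O : set 'rV[R]_m) (s B : R),
  [/\ open O, O z0, 0 < s, 0 <= B & ana_on O s B f /\ ana_on O s B g].
Proof.
move=> [W [s [B [Oo Oz s0 B0 H]]]] [W' [s' [B' [Oo' Oz' s0' B0' H']]]].
have m0 : 0 < Num.min s s' by rewrite lt_min s0.
exists (W `&` W'), (Num.min s s'), (Num.max B B'); split=> //.
- exact: openI.
- by rewrite le_max B0.
- split.
  + apply: (ana_onS _ _ _ _ H); rewrite ?(ltW m0) ?ge_min ?le_max ?lexx //.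
  + apply: (ana_onS _ _ _ _ H'); rewrite ?(ltW m0) ?ge_min ?le_max ?lexx ?orbT //.
Qed.

Lemma ana_near z0 f : ana z0 f -> \forall z \near z0, ana z f.
Proof.
move=> [W [s [B [Oo Oz s0 B0 H]]]]; apply: (in_near Oo Oz) => z Oz'.
by exists W, s, B.
Qed.

Lemma ana_smooth z0 f : ana z0 f -> smooth_at f z0.
Proof. by move=> [W [s [B [Oo Oz s0 B0 H]]]]; case: (H z0 Oz). Qed.

Lemma ana_diff z0 f : ana z0 f -> differentiable f z0.
Proof. by move=> /ana_smooth /smooth_diff. Qed.

Lemma ana_eq z0 f g : (\forall z \near z0, f z = g z) -> ana z0 f -> ana z0 g.
Proof.
move=> fg [W [s [B [Oo Oz s0 B0 H]]]].
have [U [Uo Uz {}fg]] := near_open fg.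
exists (W `&` U), s, B; split=> //; first exact: openI.
have OU : open (W `&` U) by exact: openI.
have fgOU z : (W `&` U) z -> f z = g z by case=> _ /fg.
move=> z OUz; have [sf b] := H z OUz.1; split.
  by move=> k; exact: (Ck_eq OU fgOU OUz (sf k)).
by move=> K; rewrite -(jetsum_eq s K OU fgOU OUz).
Qed.

Lemma ana_ext z0 f g : f =1 g -> ana z0 f -> ana z0 g.
Proof. by move=> /funext ->. Qed.

Lemma ana_cst z0 (c : R) : ana z0 (cst c).
Proof.
exists setT, 1, `|c|; split=> //; first exact: openT.
by move=> z _; split=> [k|K]; [exact: Ck_cst|apply: jetsum_cst].
Qed.

Lemma anaD z0 f g : ana z0 f -> ana z0 g -> ana z0 (fun z => f z + g z).
Proof.
move=> af ag; have [W [s [B [Oo Oz s0 B0 [Hf Hg]]]]] := ana2 af ag.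
exists W, s, (B + B); split=> //; first exact: addr_ge0.
have sf z : W z -> smooth_at f z by move=> /Hf [].
have sg z : W z -> smooth_at g z by move=> /Hg [].
move=> z Oz'; split.
  by move=> k; apply: (@CkD _ _ W k f g) => // y Oy; [exact: sf|exact: sg].
move=> K; apply: le_trans (jetsumD _ Oo (ltW s0) sf sg Oz') _.
by apply: lerD; [have [_] := Hf z Oz'|have [_] := Hg z Oz'].
Qed.

Lemma ana_coord z0 j : ana z0 (fun y => y ord0 j).
Proof.
pose c := z0 ord0 j.
suff a : ana z0 (fun y => y ord0 j - c).
  by apply: ana_ext (anaD a (ana_cst z0 c)) => y; rewrite /= subrK.
have : \forall z \near z0, `|(z : 'rV[R]_m) ord0 j - c| < 1.
  have cc : {for z0, continuous (fun y : 'rV[R]_m => y ord0 j)}.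
    exact/differentiable_continuous/diff_coord.
  move/cvgrPdist_lt: cc => /(_ 1 ltr01); apply: filterS => z.
  by rewrite distrC.
move=> /near_open[U [Uo Uz HU]]; exists U, 1, (1 + 1); split=> //.
move=> z /HU /ltW Uz'; split=> [k|K]; first exact: Ck_coordB.
by apply: le_trans (jetsum_coordB _ _ _ _ _) _ => //; rewrite lerD2r.
Qed.

Lemma anaM z0 f g : ana z0 f -> ana z0 g -> ana z0 (fun z => f z * g z).
Proof.
move=> af ag; have [W [s [B [Oo Oz s0 B0 [Hf Hg]]]]] := ana2 af ag.
exists W, s, (B * B); split=> //; first exact: mulr_ge0.
have sf z : W z -> smooth_at f z by move=> /Hf [].
have sg z : W z -> smooth_at g z by move=> /Hg [].
move=> z Oz'; split.
  by move=> k; apply: (@CkM _ _ W k f g) => // y Oy; [exact: sf|exact: sg].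
move=> K; apply: le_trans (jetsumM _ Oo (ltW s0) sf sg Oz') _.
apply: ler_pM; rewrite ?jetsum_ge0 ?(ltW s0) //.
  by have [_ ->] := Hf z Oz'.
by have [_ ->] := Hg z Oz'.
Qed.

Lemma anaN z0 f : ana z0 f -> ana z0 (fun z => - f z).
Proof.
move=> af; apply: ana_ext (anaM (ana_cst z0 (-1)) af).
by move=> z; rewrite mulN1r.
Qed.

Lemma anaB z0 f g : ana z0 f -> ana z0 g -> ana z0 (fun z => f z - g z).
Proof. by move=> af /anaN; exact: anaD. Qed.

Lemma ana_sum z0 (I : Type) (r : seq I) (F : I -> 'rV[R]_m -> R) :
  (forall l, ana z0 (F l)) -> ana z0 (fun z => \sum_(l <- r) F l z).
Proof.
move=> aF; elim: r => [|k r IH].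
  by apply: ana_ext (ana_cst z0 0) => z; rewrite big_nil.
apply: ana_ext (anaD (aF k) IH).
by move=> z; rewrite big_cons.
Qed.

Lemma ana_pd z0 i f : ana z0 f -> ana z0 (pd i f).
Proof.
move=> [W [s [B [Oo Oz s0 B0 H]]]].
exists W, (s / 2), (s^-1 * B); split=> //; first by rewrite divr_gt0.
  by rewrite mulr_ge0 // invr_ge0 ltW.
move=> z /H [sf b]; split; first exact: smooth_pd.
move=> K; apply: le_trans (jetsum_pd _ _ _ _ s0) _.
by apply: ler_wpM2l => //; rewrite invr_ge0 ltW.
Qed.

End Analytic.

Section ReciprocalSquareRoot.
Context {R : realType} {m : nat}.
Implicit Types (f g : 'rV[R]_m -> R) (z : 'rV[R]_m) (O : set 'rV[R]_m)
  (i : 'I_m) (k K : nat) (s B : R).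

Definition rsqrt (x : R) : R := (Num.sqrt x)^-1.

Lemma rsqrt_gt0 x : 0 < x -> 0 < rsqrt x.
Proof. by move=> x0; rewrite invr_gt0 sqrtr_gt0. Qed.

Lemma rsqrt_sqr x : 0 < x -> rsqrt x ^+ 2 * x = 1.
Proof.
by move=> x0; rewrite /rsqrt exprVn sqr_sqrtr ?ltW // mulVf ?gt_eqF.
Qed.

Lemma is_derive_rsqrt (x : R) : 0 < x ->
  is_derive x 1 rsqrt (- 2^-1 * rsqrt x ^+ 3).
Proof.
move=> x0; have s0 : Num.sqrt x != 0 by rewrite gt_eqF // sqrtr_gt0.
have [ds vs] := is_derive1_sqrt x0.
apply: DeriveDef; first exact: derivableV.
by rewrite deriveV // vs /rsqrt -[_ *: _]/(_ * _); field.
Qed.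

Lemma pd_comp1 (phi : R -> R) (d : R) i f z : is_derive (f z) 1 phi d ->
  differentiable f z ->
  differentiable (phi \o f) z /\ pd i (phi \o f) z = d * pd i f z.
Proof.
move=> dphi df.
have dp : differentiable phi (f z) by apply/derivable1_diffP; exact: ex_derive.
split; first exact: differentiable_comp.
rewrite !pdE !deriveE //; last exact: differentiable_comp.
rewrite diff_comp //= -[X in 'd phi _ X = _]mulr1 linearZ /=.
by rewrite -(deriveE _ dp) derive_val mulrC.
Qed.

Lemma pd_rsqrt i f z : 0 < f z -> differentiable f z ->
  differentiable (rsqrt \o f) z /\
  pd i (rsqrt \o f) z = - 2^-1 * rsqrt (f z) ^+ 3 * pd i f z.
Proof. by move=> f0; apply: pd_comp1; exact: is_derive_rsqrt. Qed.

Lemma Ck_rsqrt O k f : open O -> (forall z, O z -> Ck k f z) ->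
  (forall z, O z -> 0 < f z) -> forall z, O z -> Ck k (rsqrt \o f) z.
Proof.
move=> Oo; elim: k f => [|k IH] f cf f0 z Oz.
  split=> //; apply: differentiable_comp; first by case: (cf z Oz).
  apply/derivable1_diffP; have := is_derive_rsqrt (f0 z Oz).
  by move=> H; exact: ex_derive.
split.
  apply: differentiable_comp; first by case: (cf z Oz).
  apply/derivable1_diffP; have := is_derive_rsqrt (f0 z Oz).
  by move=> H; exact: ex_derive.
move=> i; pose h := rsqrt \o f.
have ch y : O y -> Ck k h y by apply: IH => // x Ox; apply: CkS; exact: cf.
apply: (@Ck_eq _ _ O k (cst (- 2^-1) \* (h \* (h \* h)) \* pd i f)) => //.
  move=> y Oy; have [_ ->] := pd_rsqrt i (f0 y Oy) (Ck_diff (cf y Oy)).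
  by rewrite /= -/h !exprS expr0 mulr1.
apply: (CkM Oo) => // y Oy; last by apply: Ck_pd; exact: cf.
apply: (CkM Oo) => // x Ox; first exact: Ck_cst.
by apply: (CkM Oo) => // w Ow; apply: (CkM Oo).
Qed.

(** The reciprocal square root [h] of [f] solves [h' = - h ^ 3 f' / 2]. So the
    weighted sum of [h] to order [K.+1] is at most [|h|] plus [s] times a
    constant times the cube of the weighted sum to order [K], and for small [s]
    twice a bound of [|h|] propagates by induction on [K]. *)
Lemma ana_rsqrt z0 f : ana z0 f -> 0 < f z0 -> ana z0 (rsqrt \o f).
Proof.
move=> [W [s [B [Wo Wz s0 B0 H]]]] fz0.
have [U [Uo Uz HU]] : exists U : set 'rV[R]_m, [/\ open U, U z0 &
    forall y, U y -> f z0 / 2 < f y].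
  apply: near_open.
  have c : {for z0, continuous f}.
    by apply/differentiable_continuous/smooth_diff; case: (H z0 Wz).
  have e0 : 0 < f z0 / 2 by rewrite divr_gt0.
  move/cvgrPdist_lt: c => /(_ _ e0); apply: filterS => y.
  by move=> /ltr_normlW; lra.
pose c := f z0 / 2; have c0 : 0 < c by rewrite divr_gt0.
have f0 y : (W `&` U) y -> 0 < f y by move=> [_ /HU]; exact: lt_trans.
pose A := rsqrt c; have A0 : 0 < A by exact: rsqrt_gt0.
have hA y : (W `&` U) y -> `|rsqrt (f y)| <= A.
  move=> [Wy Uy]; have fy : c < f y := HU y Uy.
  have y0 : 0 < f y := lt_trans c0 fy.
  rewrite ger0_norm; last by apply/ltW/rsqrt_gt0.
  by rewrite /A /rsqrt lef_pV2 ?posrE ?sqrtr_gt0 // ler_sqrt ?ltW.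
pose B1 := s^-1 * B; have B10 : 0 <= B1 by rewrite mulr_ge0 // invr_ge0 ltW.
(* [D] bounds the weighted sums of all partial derivatives of [h] as long as
   that of [h] is at most [2 * A]; then [s1 * D <= A] closes the induction. *)
pose D := m%:R * (2^-1 * (2 * A) ^+ 3 * B1) + 1.
have D0 : 0 < D.
  rewrite ltr_wpDl // mulr_ge0 ?ler0n // mulr_ge0 // mulr_ge0 ?invr_ge0 //.
  by rewrite exprn_ge0 // mulr_ge0 // ltW.
pose s1 := Num.min (s / 2) (A / D).
have s10 : 0 < s1 by rewrite lt_min !divr_gt0.
have Oo : open (W `&` U) by exact: openI.
exists (W `&` U), s1, (2 * A); split=> //; first by rewrite mulr_ge0 // ltW.
have sf y : (W `&` U) y -> smooth_at f y by move=> [/H []].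
have sh y : (W `&` U) y -> smooth_at (rsqrt \o f) y.
  by move=> Oy k; apply: (Ck_rsqrt Oo) => // x Ox; exact: sf.
move=> z Oz; split; first exact: sh.
suff H2 K : forall y, (W `&` U) y -> jetsum s1 K (rsqrt \o f) y <= 2 * A.
  by move=> K; exact: H2.
elim: K => [|K IH] y Oy.
  by rewrite /jetsum big_ord0 mulr_ge0 // ltW.
apply: le_trans (jetsum_rec _ _ _ (ltW s10)) _.
rewrite mulr_natl mulr2n; apply: lerD; first exact: hA.
have Hi i : jetsum s1 K (pd i (rsqrt \o f)) y <= 2^-1 * (2 * A) ^+ 3 * B1.
  pose h := rsqrt \o f.
  rewrite (@jetsum_eq _ _ (W `&` U) _ _ _
     (cst (- 2^-1) \* (h \* (h \* h)) \* pd i f)) //; last first.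
    move=> x Ox; have [_ ->] := pd_rsqrt i (f0 x Ox) (smooth_diff (sf x Ox)).
    by rewrite /= -/h !exprS expr0 mulr1.
  have sM u v : (forall x, (W `&` U) x -> smooth_at u x) ->
     (forall x, (W `&` U) x -> smooth_at v x) ->
     forall x, (W `&` U) x -> smooth_at (u \* v) x.
    by move=> cu cv x Ox k; apply: (CkM Oo) => // w Ow; [exact: cu|exact: cv].
  have sc x : (W `&` U) x -> smooth_at (cst (- 2^-1 : R)) x.
    by move=> _ k; exact: Ck_cst.
  have sp x : (W `&` U) x -> smooth_at (pd i f) x.
    by move=> /sf; exact: smooth_pd.
  have s1' := ltW s10.
  have J u : 0 <= jetsum s1 K u y := jetsum_ge0 _ _ _ s1'.
  apply: le_trans (jetsumM _ Oo s1' _ _ Oy) _ => //.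
    by do 3! (apply: (sM) => //).
  apply: ler_pM => //; last first.
    have s12 : s1 <= s / 2 by rewrite ge_min lexx.
    apply: le_trans (jetsum_mono _ _ _ s1' s12) _.
    apply: le_trans (jetsum_pd _ _ _ _ s0) _.
    by apply: ler_wpM2l; [rewrite invr_ge0 ltW|have [_ ->] := H y Oy.1].
  apply: le_trans (jetsumM _ Oo s1' _ _ Oy) _ => //; first by do 2! (apply: (sM) => //).
  apply: ler_pM => //.
    by apply: le_trans (jetsum_cst _ _ _ s1') _; rewrite normrN ger0_norm ?invr_ge0.
  apply: le_trans (jetsumM _ Oo s1' _ _ Oy) _ => //; first by apply: (sM).
  rewrite exprS; apply: ler_pM => //; first exact: IH.
  apply: le_trans (jetsumM _ Oo s1' _ _ Oy) _ => //.
  by rewrite expr2; apply: ler_pM => //; exact: IH.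
have -> : A = A / D * D by rewrite divfK // gt_eqF.
apply: ler_pM; rewrite ?(ltW s10) //.
- by apply: sumr_ge0 => i _; apply: jetsum_ge0; exact: ltW.
- by rewrite ge_min lexx orbT.
apply: le_trans (ler_sum _ (fun i _ => Hi i)) _.
by rewrite sumr_const card_ord -[leLHS]mulr_natl lerDl.
Qed.

End ReciprocalSquareRoot.

(** * Locally uniform limits *)

Section MeanValue.
Context {R : realType}.

Lemma MVT_cc (f df : R -> R) (a b : R) : a <= b ->
  (forall x, a <= x <= b -> is_derive x 1 f (df x)) ->
  exists2 c, a <= c <= b & f b - f a = df c * (b - a).
Proof.
move=> ab H.
have H1 x : x \in `]a, b[ -> is_derive x 1 f (df x).
  by rewrite in_itv /= => /andP[ax xb]; apply: H; rewrite !ltW.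
have H2 : {within `[a, b], continuous f}.
  apply: derivable_within_continuous => x; rewrite in_itv /= => xab.
  by have [] := H x xab.
by have [c] := MVT_segment ab H1 H2; rewrite in_itv /=; exists c.
Qed.

Context {V W : normedModType R}.

Lemma is_derive_line (h z : V) (t : R) :
  is_derive t 1 (fun t : R => t *: h + z) h.
Proof.
have d0 : differentiable (id : R -> R) t by exact/derivable1_diffP.
have d1 : differentiable (fun t : R => t *: h) t.
  exact: differentiableZl.
have i1 : is_derive t 1 (fun t : R => t *: h) h.
  apply: DeriveDef; first exact: diff_derivable.
  rewrite deriveE // (@diffZl _ _ _ id) ?scale1r //.
  by rewrite -deriveE // derive_id scale1r.
by have := is_deriveD i1 (is_derive_cst z t 1); rewrite addr0.
Qed.

Lemma is_derive_comp_curve (f : V -> W) (c : R -> V) (t : R) (v : V) :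
  is_derive t 1 c v -> differentiable f (c t) ->
  is_derive t 1 (f \o c) ('D_v f (c t)).
Proof.
move=> [dc vc] df.
have dc' : differentiable c t by exact/derivable1_diffP.
have dfc : differentiable (f \o c) t by exact: differentiable_comp.
apply: DeriveDef; first exact: diff_derivable.
by rewrite deriveE // diff_comp //= -(deriveE _ dc') vc -deriveE.
Qed.

Lemma ball_segment (z0 z h : V) (r t : R) : ball z0 r z -> ball z0 r (h + z) ->
  0 <= t <= 1 -> ball z0 r (t *: h + z).
Proof.
rewrite -!ball_normE /= => b1 b2 /andP[t0 t1].
have E (x y : V) : z0 - (x + y) = z0 - y - x by rewrite opprD addrA addrAC.
have -> : z0 - (t *: h + z) = (1 - t) *: (z0 - z) + t *: (z0 - (h + z)).
  by rewrite !E; move: (z0 - z) => w; rewrite scalerBl scale1r scalerBr addrA subrK.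
apply: le_lt_trans (ler_normD _ _) _; rewrite !normrZ.
rewrite (ger0_norm t0) (ger0_norm (_ : 0 <= 1 - t)) ?subr_ge0 //.
set x := `|z0 - z| in b1 *; set y := `|_| in b2 *.
have [t2|t2] := eqVneq t 0; first by rewrite t2 subr0 mul1r mul0r addr0.
have tp : 0 < t by rewrite lt_neqAle eq_sym t2.
have : t * y < t * r by rewrite ltr_pM2l.
have : (1 - t) * x <= (1 - t) * r by rewrite ler_wpM2l ?subr_ge0 // ltW.
by lra.
Qed.

End MeanValue.

Section LimitOfSequences.
Context {R : realType} {m : nat}.
Implicit Types (f g : 'rV[R]_m -> R) (z : 'rV[R]_m) (O : set 'rV[R]_m)
  (i : 'I_m) (k K : nat) (s B : R).

Lemma coord_le_norm z i : `|z ord0 i| <= `|z|.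
Proof.
rewrite [leRHS]/Num.Def.normr /= mx_normrE; apply/bigmax_geP; right => /=.
by exists (ord0, i).
Qed.

Definition linform (L : 'I_m -> R) z : R := \sum_i z ord0 i * L i.

Fact linform_is_linear L : linear (linform L).
Proof.
move=> a u v; rewrite /linform scaler_sumr -big_split.
by apply: eq_bigr => i _; rewrite /= !mxE -[a *: (_ * _)]/(a * (_ * _)); ring.
Qed.
HB.instance Definition _ L := GRing.isLinear.Build R 'rV[R]_m R _ (linform L)
  (linform_is_linear L).

Lemma ana_linform z L : ana z (linform L).
Proof.
by apply: ana_sum => i; apply: anaM; [exact: ana_coord|exact: ana_cst].
Qed.

Lemma linform_delta L i : linform L (delta_mx ord0 i) = L i.
Proof.
rewrite /linform (bigD1 i) //= mxE !eqxx mul1r big1 ?addr0 // => j ji.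
by rewrite mxE (negbTE ji) andbF mul0r.
Qed.

Lemma diff_pd_le f z L :
  (forall e, 0 < e -> \forall h \near (0 : 'rV[R]_m),
     `|f (h + z) - f z - linform L h| <= e * `|h|) ->
  differentiable f z /\ forall i, pd i f z = L i.
Proof.
move=> H; have c : continuous (linform L).
  by move=> y; exact/differentiable_continuous/ana_diff/ana_linform.
have df : differentiable f z by apply/diffP_le; exists (linform L).
split=> // i; rewrite pdE deriveE //.
by rewrite (@diff_le _ _ _ f z (linform L)) //= linform_delta.
Qed.

Lemma jet2_norm f z i j : `|pd j (pd i f) z| <= 2 * jet 2 f z.
Proof.
rewrite /= mulrA divff ?mul1r ?pnatr_eq0 //.
rewrite (bigD1 i) //= invr1 mul1r (bigD1 j) //= -addrA lerDl addr_ge0 //.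
  by apply: sumr_ge0.
by apply: sumr_ge0 => l _; rewrite mul1r; apply: sumr_ge0.
Qed.

Lemma linform_le (L : 'I_m -> R) (D : R) z : 0 <= D -> (forall i, `|L i| <= D) ->
  `|linform L z| <= m%:R * D * `|z|.
Proof.
move=> D0 H; apply: le_trans (ler_norm_sum _ _ _) _.
apply: (@le_trans _ _ (\sum_(i < m) D * `|z|)).
  apply: ler_sum => i _; rewrite normrM mulrC.
  by apply: ler_pM => //; exact: coord_le_norm.
by rewrite sumr_const card_ord -mulrA -[leLHS]mulr_natl.
Qed.

(** The mean value theorem along the segment, applied to [f] and then to its
    partial derivatives; [jet 2] controls all second derivatives. *)
Lemma taylor_le f z0 (r D : R) z h : 0 <= D ->
  (forall y, ball z0 r y -> Ck 2 f y /\ jet 2 f y <= D) ->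
  ball z0 r z -> ball z0 r (h + z) ->
  `|f (h + z) - f z - linform (fun i => pd i f z) h| <=
  2 * m%:R ^+ 2 * D * `|h| ^+ 2.
Proof.
move=> D0 H bz bh.
pose c t : 'rV[R]_m := t *: h + z.
have bc t : 0 <= t <= 1 -> ball z0 r (c t) by exact: ball_segment.
have dc t := is_derive_line h z t.
have dd g (t : R) : differentiable g (c t) ->
    is_derive t 1 (g \o c) (linform (fun i => pd i g (c t)) h).
  move=> dg; have := is_derive_comp_curve (dc t) dg.
  by rewrite derive_pd.
have [t t01] : exists2 t, 0 <= t <= 1 &
    (f \o c) 1 - (f \o c) 0 = linform (fun i => pd i f (c t)) h * (1 - 0).
  apply: MVT_cc => // t t01; apply: dd.
  by have [/Ck_diff] := H _ (bc t t01).
rewrite /= /c scale1r scale0r add0r subr0 mulr1 -/(c t) => ->.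
have /andP[t0 t1] := t01.
rewrite -[X in `|X|]/(\sum_i _ - \sum_i _) -sumrB.
have -> : \sum_(i < m) (h ord0 i * pd i f (c t) - h ord0 i * pd i f z) =
   linform (fun i => pd i f (c t) - pd i f z) h.
  by apply: eq_bigr => i _; rewrite mulrBr.
have step i : `|pd i f (c t) - pd i f z| <= m%:R * (2 * D) * `|h|.
  have [u ut] : exists2 u, 0 <= u <= t &
    (pd i f \o c) t - (pd i f \o c) 0 =
      linform (fun j => pd j (pd i f) (c u)) h * (t - 0).
    apply: MVT_cc => // u /andP[u0 ut]; apply: dd.
    have u01 : 0 <= u <= 1 by rewrite u0 (le_trans ut).
    by have [/Ck_pd/Ck_diff] := H _ (bc u u01).
  have /andP[u0 ut'] := ut; have u01 : 0 <= u <= 1 by rewrite u0 (le_trans ut').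
  rewrite /= {2}/c scale0r add0r subr0 => ->; rewrite normrM (ger0_norm t0).
  rewrite -[leRHS]mulr1; apply: ler_pM => //.
  apply: linform_le => [|j]; first by rewrite mulr_ge0.
  apply: le_trans (jet2_norm _ _ _ _) _; rewrite ler_pM2l //.
  by have [] := H _ (bc u u01).
apply: le_trans (linform_le h _ step) _.
  by rewrite !mulr_ge0 ?ler0n.
rewrite le_eqVlt; apply/orP; left; apply/eqP; ring.
Qed.

End LimitOfSequences.

Section LimitOfAnalytic.
Context {R : realType} {m : nat}.
Implicit Types (f g : 'rV[R]_m -> R) (z : 'rV[R]_m) (O : set 'rV[R]_m)
  (i : 'I_m) (k K : nat) (s B : R).

Lemma cvg_fin_sum (I : Type) (r : seq I) (u : I -> nat -> R) (l : I -> R) :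
  (forall a : I, u a @ \oo --> l a) ->
  (fun N => \sum_(a <- r) u a N) @ \oo --> \sum_(a <- r) l a.
Proof.
move=> H; elim: r => [|i r IH].
  rewrite big_nil (_ : (fun N => _) = cst 0); first exact: cvg_cst.
  by apply/funext => N; rewrite big_nil.
rewrite big_cons (_ : (fun N => _) = (u i) \+ (fun N => \sum_(j <- r) u j N)).
  exact: cvgD.
by apply/funext => N; rewrite big_cons.
Qed.

Lemma norm_delta_le i : `|delta_mx ord0 i : 'rV[R]_m| <= 1.
Proof.
rewrite [leLHS]/Num.Def.normr /= mx_normrE; apply/bigmax_leP; split=> //.
by move=> [a j] _ /=; rewrite mxE; case: (_ && _); rewrite /= ?normr1 ?normr0.
Qed.

Lemma jet2_le s B f z : 0 < s -> jetsum s 3 f z <= B ->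
  jet 2 f z <= s^-1 ^+ 2 * B.
Proof.
move=> s0 H; rewrite exprVn ler_pdivlMl ?exprn_gt0 //.
apply: le_trans H; rewrite /jetsum big_ord_recr lerDr.
by apply: sumr_ge0 => k _; rewrite mulr_ge0 ?jet_ge0 // exprn_ge0 // ltW.
Qed.

(** The second derivatives of the [P N] are bounded uniformly in [N], so
    Taylor's formula compares difference quotients with derivatives uniformly
    in [N]. Hence the derivatives form Cauchy sequences, and the formula itself
    passes to the limit. *)
Lemma limit_pd z0 (r : R) s B (P : nat -> 'rV[R]_m -> R) f :
  0 < s -> 0 <= B -> (forall N, ana_on (ball z0 r) s B (P N)) ->
  (forall z, ball z0 r z -> P N z @[N --> \oo] --> f z) ->
  forall z, ball z0 r z ->
  differentiable f z /\ forall i, pd i (P N) z @[N --> \oo] --> pd i f z.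
Proof.
move=> s0 B0 aP cP z bz.
pose D := s^-1 ^+ 2 * B.
have D0 : 0 <= D by rewrite mulr_ge0 // exprn_ge0 // invr_ge0 ltW.
pose C := 2 * m%:R ^+ 2 * D.
have C0 : 0 <= C by apply: mulr_ge0 => //; rewrite mulr_ge0 // exprn_ge0 ?ler0n.
pose d := r - `|z0 - z|.
have d0 : 0 < d by move: bz; rewrite -ball_normE /= subr_gt0.
have bh (h : 'rV[R]_m) : `|h| < d -> ball z0 r (h + z).
  move=> hd; rewrite -ball_normE /= opprD addrCA addrC.
  apply: le_lt_trans (ler_normB _ _) _.
  by move: hd; rewrite /d; set a := `|_|; set b := `|_|; lra.
have T N (h : 'rV[R]_m) : `|h| < d ->
  `|P N (h + z) - P N z - linform (fun i => pd i (P N) z) h| <= C * `|h| ^+ 2.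
  move=> hd; apply: (@taylor_le _ _ _ z0 r) => //; last exact: bh.
  move=> y by'; have [sy by''] := aP N y by'; split; first exact: sy.
  exact: jet2_le.
have cu i : cvgn (fun N => pd i (P N) z).
  apply/cauchy_cvgP/cauchy_exP => e e0.
  (* A step inside the ball for which the Taylor error is below [e / 2]. *)
  pose t := Num.min (d / 2) (e / (2 * (C + 1))).
  have C1 : 0 < C + 1 by rewrite ltr_wpDl.
  have t0 : 0 < t by rewrite lt_min !divr_gt0 // mulr_gt0.
  have tC : C * t < e / 2.
    have : (C + 1) * t <= e / 2.
      rewrite mulrC -ler_pdivlMr // -mulrA -invfM ge_min; apply/orP; right.
      by [].
    by lra.
  pose h : 'rV[R]_m := t *: delta_mx ord0 i.
  have hn : `|h| <= t.
    by rewrite normrZ gtr0_norm // ler_piMr ?norm_delta_le // ltW.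
  have hd : `|h| < d.
    apply: le_lt_trans hn _; rewrite gt_min; apply/orP; left.
    by rewrite ltr_pdivrMr // ltr_pMr // ltr1n.
  exists (t^-1 * (f (h + z) - f z)).
  have cd : P N (h + z) - P N z @[N --> \oo] --> f (h + z) - f z.
    by apply: cvgB; apply: cP => //; exact: bh.
  have te : 0 < t * (e / 2) by rewrite mulr_gt0 // divr_gt0.
  move/cvgrPdist_lt: cd => /(_ _ te); apply: filterS => N HN.
  have := T N h hd; rewrite /h linearZ /= linform_delta -/h => TN.
  rewrite -ball_normE /= -(ltr_pM2l t0) -[X in X * `|_|]gtr0_norm // -normrM.
  rewrite mulrBr mulVKf ?gt_eqF //.
  have -> : f (h + z) - f z - t * pd i (P N) z =
    (f (h + z) - f z - (P N (h + z) - P N z)) +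
    (P N (h + z) - P N z - t *: pd i (P N) z).
    by rewrite -[_ *: _]/(t * _); ring.
  apply: le_lt_trans (ler_normD _ _) _.
  have : C * `|h| ^+ 2 <= t * (C * t).
    have -> : t * (C * t) = C * t ^+ 2 by ring.
    by apply: ler_wpM2l => //; apply: lerXn2r => //; rewrite nnegrE // ltW.
  have : t * (C * t) < t * (e / 2) by rewrite ltr_pM2l.
  by move: HN TN; lra.
pose L i := limn (fun N => pd i (P N) z).
have cL i : pd i (P N) z @[N --> \oo] --> L i by exact: cu.
have F (h : 'rV[R]_m) : `|h| < d ->
    `|f (h + z) - f z - linform L h| <= C * `|h| ^+ 2.
  move=> hd; have bhz := bh h hd.
  have : `|P N (h + z) - P N z - linform (fun i => pd i (P N) z) h| @[N --> \oo]
     --> `|f (h + z) - f z - linform L h|.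
    apply: cvg_norm; apply: cvgB; first by apply: cvgB; exact: cP.
    by apply: cvg_fin_sum => i; apply: cvgMr.
  by move/cvgr_to_le; apply; apply: nearW => N; exact: T.
have [df pL] : differentiable f z /\ forall i, pd i f z = L i.
  apply: diff_pd_le => e e0.
  have : \forall h \near (0 : 'rV[R]_m), `|h| < Num.min d (e / (C + 1)).
    apply: nbhs0_lt; rewrite lt_min d0 divr_gt0 //.
    by rewrite ltr_wpDl.
  apply: filterS => h; rewrite lt_min => /andP[hd he].
  apply: le_trans (F h hd) _; rewrite expr2 mulrA; apply: ler_wpM2r => //.
  have C1 : 0 < C + 1 by rewrite ltr_wpDl.
  move: he; rewrite ltr_pdivlMr // => he.
  by have := normr_ge0 h; lra.
by split=> // i; rewrite pL.
Qed.

Lemma limit_jet k z0 (r : R) s B (P : nat -> 'rV[R]_m -> R) f :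
  0 < s -> 0 <= B -> (forall N, ana_on (ball z0 r) s B (P N)) ->
  (forall z, ball z0 r z -> P N z @[N --> \oo] --> f z) ->
  forall z, ball z0 r z -> Ck k f z /\ jet k (P N) z @[N --> \oo] --> jet k f z.
Proof.
elim: k s B P f => [|k IH] s B P f s0 B0 aP cP z bz.
  have [df _] := limit_pd s0 B0 aP cP bz.
  by split=> //; apply: cvg_norm; exact: cP.
have [df cpd] := limit_pd s0 B0 aP cP bz.
have H i : Ck k (pd i f) z /\
    jet k (pd i (P N)) z @[N --> \oo] --> jet k (pd i f) z.
  apply: (IH (s / 2) (s^-1 * B)) => //; first by rewrite divr_gt0.
  - by rewrite mulr_ge0 // invr_ge0 ltW.
  - move=> N y /(aP N) [sy by']; split; first exact: smooth_pd.
    move=> K; apply: le_trans (jetsum_pd _ _ _ _ s0) _.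
    by apply: ler_wpM2l => //; rewrite invr_ge0 ltW.
  - by move=> y b; have [_] := limit_pd s0 B0 aP cP b.
split; first by split=> // i; case: (H i).
apply: cvgMr; apply: cvg_fin_sum => i; exact: (H i).2.
Qed.

(** Iterating [limit_pd], all derivatives converge, so all bounds on jets
    pass to pointwise limits. *)
Lemma limit_ana_on z0 (r : R) s B (P : nat -> 'rV[R]_m -> R) f :
  0 < s -> 0 <= B -> (forall N, ana_on (ball z0 r) s B (P N)) ->
  (forall z, ball z0 r z -> P N z @[N --> \oo] --> f z) ->
  ana_on (ball z0 r) s B f.
Proof.
move=> s0 B0 aP cP z bz; split.
  by move=> k; have [] := limit_jet k s0 B0 aP cP bz.
move=> K.
have : jetsum s K (P N) z @[N --> \oo] --> jetsum s K f z.
  apply: cvg_fin_sum => k; apply: cvgMr.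
  by have [] := limit_jet k s0 B0 aP cP bz.
by move/cvgr_to_le; apply; apply: nearW => N; have [_] := aP N z bz.
Qed.

Lemma limit_pdC z0 (r : R) s B (P : nat -> 'rV[R]_m -> R) f :
  0 < s -> 0 <= B -> (forall N, ana_on (ball z0 r) s B (P N)) ->
  (forall z, ball z0 r z -> P N z @[N --> \oo] --> f z) ->
  (forall N z i j, pd i (pd j (P N)) z = pd j (pd i (P N)) z) ->
  forall z, ball z0 r z -> forall i j, pd i (pd j f) z = pd j (pd i f) z.
Proof.
move=> s0 B0 aP cP sP z bz i j.
have H a b : pd a (pd b (P N)) z @[N --> \oo] --> pd a (pd b f) z.
  have [||||_ H] := @limit_pd z0 r (s / 2) (s^-1 * B)
      (fun N => pd b (P N)) (pd b f) _ _ _ _ z bz; last exact: H.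
  - by rewrite divr_gt0.
  - by rewrite mulr_ge0 // invr_ge0 ltW.
  - move=> N y /(aP N) [sy by']; split; first exact: smooth_pd.
    move=> K; apply: le_trans (jetsum_pd _ _ _ _ s0) _.
    by apply: ler_wpM2l => //; rewrite invr_ge0 ltW.
  - by move=> y b'; have [_] := limit_pd s0 B0 aP cP b'.
have H1 := H i j; have H2 := H j i.
have E : (fun N => pd i (pd j (P N)) z) = (fun N => pd j (pd i (P N)) z).
  by apply/funext => N; exact: sP.
rewrite E in H1; exact: (cvg_unique _ H1 H2).
Qed.

End LimitOfAnalytic.

Section PowerSeries.
Context {R : realType} {m : nat}.
Implicit Types (f g : 'rV[R]_m -> R) (z : 'rV[R]_m) (O : set 'rV[R]_m)
  (i : 'I_m) (k K : nat) (s B : R).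

(** Stable under the operations that build polynomials, with bounds that
    compose accordingly: a polynomial in the [y_i - a_i] gets the value of the
    polynomial with absolute coefficients at [r + s]. *)
Definition tame (a : 'rV[R]_m) (r s : R) f B :=
  [/\ 0 <= B, forall z, smooth_at f z,
      forall z i j, pd i (pd j f) z = pd j (pd i f) z &
      forall z, ball a r z -> forall K, jetsum s K f z <= B].

Lemma smoothT_diff f z : (forall y, smooth_at f y) -> differentiable f z.
Proof. by move=> /(_ z) /smooth_diff. Qed.

Lemma tame_cst a r s c : 0 <= s -> tame a r s (cst c) `|c|.
Proof.
move=> s0; split=> //.
- by move=> z k; exact: Ck_cst.
- move=> z i j; have E l : pd l (cst c) = cst 0 :> ('rV[R]_m -> R).
    by apply/funext => y; rewrite pd_cst.
  by rewrite !E !pd_cst.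
- by move=> z _ K; exact: jetsum_cst.
Qed.

Lemma tame_coordB a r s j : 0 <= s -> 0 <= r ->
  tame a r s (fun y => y ord0 j - a ord0 j) (r + s).
Proof.
move=> s0 r0; split=> //; first exact: addr_ge0.
- by move=> z k; exact: Ck_coordB.
- move=> z i l; have E b : pd b (fun y => y ord0 j - a ord0 j) =
      cst (j == b)%:R :> ('rV[R]_m -> R).
    by apply/funext => y; rewrite pd_coordB.
  by rewrite !E !pd_cst.
- move=> z bz K; apply: le_trans (jetsum_coordB _ _ _ _ s0) _.
  rewrite lerD2r; have := coord_le_norm (z - a) j; rewrite !mxE => H.
  apply: le_trans H _; move: bz; rewrite -ball_normE /= distrC; exact: ltW.
Qed.

Lemma tameD a r s f g B C : 0 <= s -> tame a r s f B -> tame a r s g C ->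
  tame a r s (fun z => f z + g z) (B + C).
Proof.
move=> s0 [B0 sf cf bf] [C0 sg cg bg].
have df z := smoothT_diff z sf; have dg z := smoothT_diff z sg.
split; first exact: addr_ge0.
- by move=> z k; apply: (CkD openT) => // y _; [exact: sf|exact: sg].
- move=> z i j; have E l : pd l (f \+ g) = pd l f \+ pd l g.
    by apply/funext => y; rewrite pdD.
  have dp h l y : (forall z, smooth_at h z) -> differentiable (pd l h) y.
    by move=> sh; apply: smooth_diff; exact: smooth_pd.
  rewrite -[fun z => _]/(f \+ g) !E.
  rewrite pdD; [|exact: dp|exact: dp].
  by rewrite [RHS]pdD; [rewrite cf cg|exact: dp|exact: dp].
- move=> z bz K; apply: le_trans (jetsumD K openT s0 _ _ _) _ => //.
  by apply: lerD; [exact: bf|exact: bg].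
Qed.

Lemma tameM a r s f g B C : 0 <= s -> tame a r s f B -> tame a r s g C ->
  tame a r s (fun z => f z * g z) (B * C).
Proof.
move=> s0 [B0 sf cf bf] [C0 sg cg bg].
have df z := smoothT_diff z sf; have dg z := smoothT_diff z sg.
split; first exact: mulr_ge0.
- by move=> z k; apply: (CkM openT) => // y _; [exact: sf|exact: sg].
- move=> z i j; have E l : pd l (f \* g) = (pd l f \* g) \+ (f \* pd l g).
    by apply/funext => y; rewrite pdM.
  have dp h l y : (forall z, smooth_at h z) -> differentiable (pd l h) y.
    by move=> sh; apply: smooth_diff; exact: smooth_pd.
  have H p q : pd p ((pd q f \* g) \+ (f \* pd q g)) z =
     pd p (pd q f) z * g z + pd q f z * pd p g z +
     (pd p f z * pd q g z + f z * pd p (pd q g) z).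
    rewrite pdD; last 2 first.
    - by apply: differentiableM => //; exact: dp.
    - by apply: differentiableM => //; exact: dp.
    rewrite pdM; [|exact: dp|exact: dg].
    by rewrite pdM; [|exact: df|exact: dp].
  by rewrite -[fun z => _]/(f \* g) !E !H cf cg; ring.
- move=> z bz K; apply: le_trans (jetsumM K openT s0 _ _ _) _ => //.
  apply: ler_pM; rewrite ?jetsum_ge0 //; [exact: bf|exact: bg].
Qed.

Lemma tame_ext a r s f g B : f =1 g -> tame a r s f B -> tame a r s g B.
Proof. by move=> /funext ->. Qed.

Lemma tame_prod a r s (I : Type) (q : seq I) (F : I -> 'rV[R]_m -> R)
  (B : I -> R) : 0 <= s -> (forall b, tame a r s (F b) (B b)) ->
  tame a r s (fun z => \prod_(b <- q) F b z) (\prod_(b <- q) B b).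
Proof.
move=> s0 H; elim: q => [|b q IH].
  rewrite big_nil -[X in tame _ _ _ _ X](normr1 R).
  by apply: tame_ext (tame_cst _ _ _ s0) => z; rewrite big_nil.
rewrite big_cons; apply: tame_ext (tameM s0 (H b) IH) => z.
by rewrite big_cons.
Qed.

Lemma tame_sum a r s (I : Type) (q : seq I) (F : I -> 'rV[R]_m -> R)
  (B : I -> R) : 0 <= s -> (forall b, tame a r s (F b) (B b)) ->
  tame a r s (fun z => \sum_(b <- q) F b z) (\sum_(b <- q) B b).
Proof.
move=> s0 H; elim: q => [|b q IH].
  rewrite big_nil -[X in tame _ _ _ _ X](normr0 R).
  by apply: tame_ext (tame_cst _ _ _ s0) => z; rewrite big_nil.
rewrite big_cons; apply: tame_ext (tameD s0 (H b) IH) => z.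
by rewrite big_cons.
Qed.

Lemma tameX a r s f B e : 0 <= s -> tame a r s f B ->
  tame a r s (fun z => f z ^+ e) (B ^+ e).
Proof.
move=> s0 H; elim: e => [|e IH].
  rewrite expr0 -[X in tame _ _ _ _ X](normr1 R).
  by apply: tame_ext (tame_cst _ _ _ s0) => z; rewrite expr0.
rewrite exprS; apply: tame_ext (tameM s0 H IH) => z; by rewrite exprS.
Qed.

Lemma tame_psum a r s (c : ('I_m -> nat) -> R) N : 0 <= s -> 0 <= r ->
  tame a r s (fun z => psum c (z - a) N)
    (psum (fun e => `|c e|) (const_mx (r + s)) N).
Proof.
move=> s0 r0; rewrite /psum; apply: tame_sum => // e.
apply: tameM => //; first exact: tame_cst.
apply: (@tame_ext _ _ _ (fun z => \prod_(i < m) (z ord0 i - a ord0 i) ^+ e i)).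
  by move=> z; apply: eq_bigr => i _; rewrite !mxE.
have -> : \prod_(i < m) (const_mx (r + s) : 'rV[R]_m) ord0 i ^+ e i =
   \prod_(i < m) (r + s) ^+ e i by apply: eq_bigr => i _; rewrite mxE.
by apply: tame_prod => // i; apply: tameX => //; exact: tame_coordB.
Qed.

(** The radius [r] of convergence is shared equally between the displacement
    and the parameter of the weighted sums, both [r / 4], so that the bound is
    a partial sum of the absolutely convergent series at [r / 2]. *)
Lemma analytic_limit f a : analytic_at f a ->
  exists (r s B : R) (P : nat -> 'rV[R]_m -> R), [/\ 0 < r, 0 < s, 0 <= B,
    forall N, tame a r s (P N) B &
    forall z, ball a r z -> P N z @[N --> \oo] --> f z].
Proof.
move=> [c [r [r0 H]]].
have r4 : 0 < r / 4 by rewrite divr_gt0.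
have [cv _] : cvgn (psum (fun e => `|c e|)
     (map_mx Num.norm ((const_mx (r / 2) + a) - a))) /\
     (psum c ((const_mx (r / 2) + a) - a) @ \oo --> f (const_mx (r / 2) + a)).
  apply: H => i; rewrite !mxE addrK gtr0_norm ?divr_gt0 //.
  by rewrite ltr_pdivrMr // ltr_pMr // ltr1n.
have cvE : map_mx Num.norm ((const_mx (r / 2) + a) - a) =
    const_mx (r / 4 + r / 4) :> 'rV[R]_m.
  apply/rowP => i; rewrite !mxE addrK gtr0_norm ?divr_gt0 //; lra.
rewrite cvE in cv.
have [B [B0 HB]] : exists B, 0 <= B /\ forall N,
    psum (fun e => `|c e|) (const_mx (r / 4 + r / 4) : 'rV[R]_m) N <= B.
  have /pinfty_ex_gt0 [B B0 HB] := cvg_seq_bounded cv.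
  exists B; split; first exact: ltW.
  by move=> N; apply: le_trans (ler_norm _) _; exact: HB.
exists (r / 4), (r / 4), B, (fun N z => psum c (z - a) N); split=> //.
- move=> N; have [_ h1 h2 h3] := tame_psum a c N (ltW r4) (ltW r4).
  by split=> // z bz K; apply: le_trans (HB N); exact: h3.
- move=> z bz; have [|_ //] := H z.
  move=> i; have := coord_le_norm (z - a) i; rewrite !mxE => Hi.
  apply: le_lt_trans Hi _; move: bz; rewrite -ball_normE /= distrC => bz.
  by apply: lt_trans bz _; lra.
Qed.

Lemma analytic_ana f a : analytic_at f a -> ana a f.
Proof.
move=> /analytic_limit [r [s [B [P [r0 s0 B0 tP cP]]]]].
exists (ball a r), s, B; split=> //.
- exact: ball_open.
- exact: ballxx.
- apply: limit_ana_on cP => // N z bz; have [_ h1 _ h3] := tP N.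
  by split=> // K; exact: h3.
Qed.

Lemma analytic_pdC f a i j : analytic_at f a ->
  pd i (pd j f) a = pd j (pd i f) a.
Proof.
move=> /analytic_limit [r [s [B [P [r0 s0 B0 tP cP]]]]].
apply: (limit_pdC s0 B0 _ cP) => //.
- by move=> N z bz; have [_ h1 _ h3] := tP N; split=> // K; exact: h3.
- by move=> N z p q; have [_ _ h _] := tP N.
- exact: ballxx.
Qed.

End PowerSeries.

(** * Integral curves of analytic vector fields *)

Section LieDerivatives.
Context {R : realType} {m : nat}.
Implicit Types (f g : 'rV[R]_m -> R) (z : 'rV[R]_m) (O : set 'rV[R]_m)
  (i : 'I_m) (k K j : nat) (s B : R) (F : 'I_m -> 'rV[R]_m -> R).

Definition lie F g z : R := \sum_i F i z * pd i g z.

Lemma Ck_sum O k (I : Type) (r : seq I) (G : I -> 'rV[R]_m -> R) : open O ->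
  (forall a z, O z -> Ck k (G a) z) ->
  forall z, O z -> Ck k (fun z => \sum_(a <- r) G a z) z.
Proof.
move=> Oo cG; elim: r => [|a r IH] z Oz.
  rewrite (_ : (fun z => _) = cst 0); first exact: Ck_cst.
  by apply/funext => y; rewrite big_nil.
rewrite (_ : (fun z => _) = G a \+ (fun z => \sum_(a <- r) G a z)).
  by apply: (CkD Oo) => // y; exact: cG.
by apply/funext => y; rewrite big_cons.
Qed.

Lemma jet_sum O k (I : Type) (r : seq I) (G : I -> 'rV[R]_m -> R) : open O ->
  (forall a z, O z -> Ck k (G a) z) ->
  forall z, O z ->
  jet k (fun z => \sum_(a <- r) G a z) z <= \sum_(a <- r) jet k (G a) z.
Proof.
move=> Oo cG; elim: r => [|a r IH] z Oz.
  rewrite (_ : (fun z => _) = cst 0); last first.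
    by apply/funext => y; rewrite big_nil.
  rewrite big_nil; case: k cG => [|k] _; first by rewrite /= normr0.
  by rewrite jet_cst.
rewrite (_ : (fun z => _) = G a \+ (fun z => \sum_(a <- r) G a z)).
  rewrite big_cons; apply: le_trans (jetD Oo _ _ Oz) _.
  - by move=> y; exact: cG.
  - by move=> y; apply: Ck_sum.
  - by rewrite lerD2l; exact: IH.
by apply/funext => y; rewrite big_cons.
Qed.

Lemma smooth_lie O F g : open O -> (forall i z, O z -> smooth_at (F i) z) ->
  (forall z, O z -> smooth_at g z) -> forall z, O z -> smooth_at (lie F g) z.
Proof.
move=> Oo sF sg z Oz k; apply: (Ck_sum _ Oo) => // i y Oy.
apply: (CkM Oo) => // x Ox; first exact: sF.
by apply: Ck_pd; exact: sg.
Qed.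

Lemma jet_lie O F g k z : open O ->
  (forall i z, O z -> smooth_at (F i) z) ->
  (forall z, O z -> smooth_at g z) -> O z ->
  jet k (lie F g) z <=
  \sum_i \sum_(j < k.+1) jet j (F i) z * jet (k - j) (pd i g) z.
Proof.
move=> Oo sF sg Oz.
have sp i y : O y -> smooth_at (pd i g) y by move=> /sg; exact: smooth_pd.
apply: le_trans (jet_sum _ Oo _ Oz) _.
  by move=> i y Oy; apply: (CkM Oo) => // x Ox; [exact: sF|exact: sp].
apply: ler_sum => i _; apply: (jetM Oo) => // y Oy; [exact: sF|exact: sp].
Qed.

Lemma geometric_half j : \sum_(l < j.+1) 2^-1 ^+ l <= 2 :> R.
Proof.
elim: j => [|j IH]; first by rewrite big_ord1 expr0 ler1n.
rewrite big_ord_recl expr0.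
have -> : \sum_(l < j.+1) 2^-1 ^+ (lift ord0 l) =
    2^-1 * \sum_(l < j.+1) 2^-1 ^+ l :> R.
  by rewrite mulr_sumr; apply: eq_bigr => l _; rewrite -exprS.
lra.
Qed.

(** The numbers [jet j] grow at most geometrically in [j] for an analytic
    function. Along iterated Lie derivatives the binomial factor makes the
    induction close: one more derivative turns ['C(j + k, k)] into
    ['C(j + k.+1, k.+1)], and the convolution with the geometric decay of the
    coefficients of the field only costs a factor 2. *)
Lemma jet_iter_lie O F g A B D k j z : open O -> 0 <= A -> 0 <= B -> 0 < D ->
  (forall i z, O z -> smooth_at (F i) z) ->
  (forall z, O z -> smooth_at g z) ->
  (forall l z, O z -> jet l g z <= A * D ^+ l) ->
  (forall i l z, O z -> jet l (F i) z <= B * (D / 2) ^+ l) -> O z ->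
  smooth_at (iter k (lie F) g) z /\
  jet j (iter k (lie F) g) z <=
    A * (2 * B * D) ^+ k * D ^+ j * (k`!)%:R * 'C(j + k, k)%:R.
Proof.
move=> Oo A0 B0 D0 sF sg bg bF.
have D0' := ltW D0.
elim: k j z => [|k IH] j z Oz.
  split; first exact: sg.
  by rewrite /= bin0 fact0 expr0 !mulr1; exact: bg.
have sk y : O y -> smooth_at (iter k (lie F) g) y by move=> /(IH 0%N) [].
split; first exact: (smooth_lie Oo sF sk).
set h := iter k (lie F) g.
apply: le_trans (jet_lie _ Oo sF sk Oz) _.
pose M := A * (2 * B * D) ^+ k * (k.+1)`!%:R * 'C(j + k.+1, k.+1)%:R.
have M0 : 0 <= M by rewrite !mulr_ge0 ?ler0n ?exprn_ge0 // !mulr_ge0.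
apply: (@le_trans _ _ (\sum_(l < j.+1) B * D ^+ j.+1 * M * 2^-1 ^+ l)).
  rewrite exchange_big; apply: ler_sum => l _ /=.
  have lj : (l <= j)%N by rewrite -ltnS.
  apply: (@le_trans _ _ (\sum_i B * (D / 2) ^+ l * jet (j - l) (pd i h) z)).
    by apply: ler_sum => i _; apply: ler_wpM2r; [exact: jet_ge0|exact: bF].
  rewrite -mulr_sumr -jetS.
  have [_ H] := IH (j - l).+1 z Oz.
  apply: (@le_trans _ _ (B * (D / 2) ^+ l * ((j - l).+1%:R *
    (A * (2 * B * D) ^+ k * D ^+ (j - l).+1 * k`!%:R
       * 'C((j - l).+1 + k, k)%:R)))).
    apply: ler_wpM2l; first by rewrite mulr_ge0 // exprn_ge0 // divr_ge0.
    by apply: ler_wpM2l.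
  have E : (j - l).+1%:R * 'C((j - l).+1 + k, k)%:R * k`!%:R =
      (k.+1)`!%:R * 'C((j - l).+1 + k, k.+1)%:R :> R.
    rewrite -!natrM; congr (_%:R).
    have := mul_bin_left ((j - l).+1 + k) k; rewrite addnK => <-.
    by rewrite factS mulnAC.
  have -> : (j - l).+1%:R * (A * (2 * B * D) ^+ k * D ^+ (j - l).+1 * k`!%:R
       * 'C((j - l).+1 + k, k)%:R) = A * (2 * B * D) ^+ k * D ^+ (j - l).+1 *
      ((j - l).+1%:R * 'C((j - l).+1 + k, k)%:R * k`!%:R) by ring.
  rewrite E /M.
  have -> : D ^+ j.+1 = D ^+ l * D ^+ (j - l).+1.
    by rewrite -exprD addnS subnKC.
  rewrite exprMn.
  have -> : B * (D ^+ l * 2^-1 ^+ l) * (A * (2 * B * D) ^+ k *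
     D ^+ (j - l).+1 * ((k.+1)`!%:R * 'C((j - l).+1 + k, k.+1)%:R)) =
   B * (D ^+ l * D ^+ (j - l).+1) * (A * (2 * B * D) ^+ k * (k.+1)`!%:R *
     'C((j - l).+1 + k, k.+1)%:R) * 2^-1 ^+ l by ring.
  apply: ler_wpM2r; first by rewrite exprn_ge0 // invr_ge0.
  apply: ler_wpM2l; first by rewrite !mulr_ge0 // exprn_ge0.
  apply: ler_wpM2l; first by rewrite !mulr_ge0 ?ler0n ?exprn_ge0 // !mulr_ge0.
  by rewrite ler_nat leq_bin2l // addSnnS leq_add2r leq_subr.
rewrite -mulr_sumr.
apply: le_trans (ler_wpM2l _ (geometric_half j)) _.
  apply: mulr_ge0 => //; apply: mulr_ge0 => //; exact: exprn_ge0.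
rewrite le_eqVlt /M !exprS; apply/orP; left; apply/eqP; ring.
Qed.

End LieDerivatives.

Section AnalyticCurves.
Context {R : realType}.
Implicit Types (a b : R -> R) (tau t : R).

(** Analyticity near [tau] in one variable: Cauchy's bounds on the successive
    derivatives [phi k] of [a]. *)
Definition analytic_curve tau a := exists (phi : nat -> R -> R) (d A C : R),
  [/\ 0 < d, 0 <= A, 0 <= C, forall t, `|t - tau| < d -> phi 0%N t = a t &
    forall k t, `|t - tau| < d ->
      is_derive t 1 (phi k) (phi k.+1 t) /\
      `|phi k t| <= A * C ^+ k * k`!%:R].

(** The successive derivatives of [f] along a solution are the iterated Lie
    derivatives of [f], evaluated along that solution. *)
Lemma integral_curve_analytic m (z : R -> 'rV[R]_m)
    (F : 'I_m -> 'rV[R]_m -> R) (f : 'rV[R]_m -> R) (tau : R) :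
  (\forall t \near tau, is_derive (t : R) (1 : R) z (\row_i F i (z t))) ->
  (forall i, ana (z tau) (F i)) -> ana (z tau) f ->
  analytic_curve tau (f \o z).
Proof.
move=> dz aF af.
have [W [s [B [Wo Wz s0 B0 [HF Hf]]]]] : exists (W : set 'rV[R]_m) (s B : R),
  [/\ open W, W (z tau), 0 < s, 0 <= B &
    (forall i, ana_on W s B (F i)) /\ ana_on W s B f].
  suff [W [s [B [Wo Wz s0 B0 [HF Hf]]]]] : exists (W : set 'rV[R]_m) (s B : R),
    [/\ open W, W (z tau), 0 < s, 0 <= B &
      (forall i, i \in enum 'I_m -> ana_on W s B (F i)) /\ ana_on W s B f].
    exists W, s, B; split=> //; split=> // i; apply: HF.
    by rewrite mem_enum.
  elim: (enum 'I_m) => [|i r [W [s [B [Wo Wz s0 B0 [HF Hf]]]]]].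
    move: af => [W [s [B [Wo Wz s0 B0 H]]]].
    by exists W, s, B; split.
  have [W' [s' [B' [Wo' Wz' s0' B0' H']]]] := aF i.
  have m0 : 0 < Num.min s s' by rewrite lt_min s0.
  exists (W `&` W'), (Num.min s s'), (Num.max B B'); split=> //.
  - exact: openI.
  - by rewrite le_max B0.
  - have X G : ana_on W s B G ->
        ana_on (W `&` W') (Num.min s s') (Num.max B B') G.
      by apply: ana_onS; rewrite ?(ltW m0) ?ge_min ?le_max ?lexx // => ? [].
    split; last exact: X.
    move=> l; rewrite inE => /predU1P[->|lr]; last exact/X/HF.
    by apply: ana_onS H'; rewrite ?(ltW m0) ?ge_min ?le_max ?lexx ?orbT // => ? [].
have jb l G y : ana_on W s B G -> W y -> jet l G y <= B * (2 / s / 2) ^+ l.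
  move=> H /H [_ /(_ l.+1)]; rewrite /jetsum big_ord_recr /= => Hl.
  have -> : 2 / s / 2 = s^-1 by field; rewrite gt_eqF.
  rewrite exprVn ler_pdivlMr ?exprn_gt0 // mulrC.
  apply: le_trans Hl; rewrite lerDr; apply: sumr_ge0 => k _.
  by rewrite mulr_ge0 ?jet_ge0 // exprn_ge0 // ltW.
have D0 : 0 < 2 / s by rewrite divr_gt0.
have dzt : is_derive tau 1 z (\row_i F i (z tau)) := nbhs_singleton dz.
have cz : {for tau, continuous z}.
  apply/differentiable_continuous/derivable1_diffP.
  by have [] := dzt.
have zW : \forall t \near tau, W (z t).
  by apply: cz; apply: open_nbhs_nbhs.
have : \forall t \near tau, W (z t) /\ is_derive (t : R) (1 : R) z (\row_i F i (z t)).
  by near=> t; split; near: t.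
move=> /nbhs_ballP [d d0 Hd].
exists (fun k t => iter k (lie F) f (z t)), d, B, (2 * B * (2 / s)).
split=> //.
  by rewrite !mulr_ge0 // ltW // invr_gt0.
move=> k t td; have [Wt dt] : W (z t) /\ is_derive t 1 z (\row_i F i (z t)).
  by apply: Hd; rewrite /ball /= distrC.
have K j := @jet_iter_lie R m W F f B B (2 / s) k j (z t) Wo B0 B0 D0
   (fun i y Wy => (HF i y Wy).1) (fun y Wy => (Hf y Wy).1).
have bf l y : W y -> jet l f y <= B * (2 / s) ^+ l.
  move=> Wy; apply: le_trans (jb l f y Hf Wy) _; apply: ler_wpM2l => //.
  have D0' := ltW D0.
  by apply: lerXn2r; rewrite ?nnegrE ?divr_ge0 //; lra.
have {}K j := K j bf (fun i l y Wy => jb l (F i) y (HF i) Wy) Wt.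
split; last first.
  by have [_] := K 0%N; rewrite /= binn !mulr1.
have [sk _] := K 0%N.
have := is_derive_comp_curve dt (smooth_diff sk).
rewrite derive_pd; last exact: smooth_diff.
have -> : \sum_i (\row_i F i (z t)) ord0 i * pd i (iter k (lie F) f) (z t) =
  iter k.+1 (lie F) f (z t).
  by apply: eq_bigr => i _; rewrite mxE.
by [].
Unshelve. all: by end_near. Qed.

Lemma derive_le_power (f df : R -> R) (t0 t1 M : R) j : 0 <= M -> t0 <= t1 ->
  f t0 = 0 -> (forall t, t0 <= t <= t1 -> is_derive t 1 f (df t)) ->
  (forall t, t0 <= t <= t1 -> `|df t| <= M * (t - t0) ^+ j) ->
  `|f t1| <= M / j.+1%:R * (t1 - t0) ^+ j.+1.
Proof.
move=> M0 t01 f0 dfd bd.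
have H (g dg : R -> R) : g t0 = 0 ->
    (forall t, t0 <= t <= t1 -> is_derive t 1 g (dg t)) ->
    (forall t, t0 <= t <= t1 -> dg t <= M * (t - t0) ^+ j) ->
    g t1 <= M / j.+1%:R * (t1 - t0) ^+ j.+1.
  move=> g0 dgd bg.
  pose p t := M / j.+1%:R * (t - t0) ^+ j.+1.
  have dp t : is_derive t 1 p (M * (t - t0) ^+ j).
    have i0 : is_derive t 1 (fun t => t - t0) 1.
      by have := is_deriveB (is_derive_id t 1) (is_derive_cst t0 t 1); rewrite subr0.
    have := is_deriveZ (M / j.+1%:R) (is_deriveX j.+1 i0).
    have -> : p = (M / j.+1%:R) *: ((fun t => t - t0) ^+ j.+1).
      by apply/funext => u; rewrite /p -[RHS]/(_ * _) exprfctE.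
    move=> dd; apply: (@is_derive_eq _ _ _ _ _ _ _ _ dd).
    rewrite /= -![_ *: _]/(_ * _) mulr1.
    by rewrite !mulrA divfK ?pnatr_eq0.
  have [c ct E] : exists2 c, t0 <= c <= t1 & (g - p) t1 - (g - p) t0 =
      (dg c - M * (c - t0) ^+ j) * (t1 - t0).
    apply: (@MVT_cc R (g - p) (fun c => dg c - M * (c - t0) ^+ j)) => // t tt.
    by apply: is_deriveB; exact: dgd.
  rewrite -subr_le0; have -> : g t1 - M / j.+1%:R * (t1 - t0) ^+ j.+1 =
     (g - p) t1 - (g - p) t0.
    rewrite /p -![(_ - _ : _ -> _) _]/(_ - _) g0 subrr expr0n mulr0.
    by rewrite subrr subr0.
  rewrite E; apply: mulr_le0_ge0; last by rewrite subr_ge0.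
  by rewrite subr_le0; exact: bg.
rewrite ler_norml; apply/andP; split; last first.
  by apply: (H f df) => // t tt; apply: le_trans (ler_norm _) _; exact: bd.
rewrite lerNl; apply: (H (- f) (fun t => - df t)).
- by rewrite -[LHS]/(- f t0) f0 oppr0.
- by move=> t tt; apply: is_deriveN; exact: dfd.
- by move=> t tt; apply: le_trans (ler_norm _) _; rewrite normrN; exact: bd.
Qed.

(** Taylor's formula: all derivatives vanish at [t0], so the remainder of
    order [j] bounds the function itself. *)
Lemma flat_le (psi : nat -> R -> R) (t0 t1 A C : R) j k t :
  0 <= A -> 0 <= C -> (forall k, psi k t0 = 0) ->
  (forall k t, t0 <= t <= t1 -> is_derive t 1 (psi k) (psi k.+1 t)) ->
  (forall k t, t0 <= t <= t1 -> `|psi k t| <= A * C ^+ k * k`!%:R) ->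
  t0 <= t <= t1 ->
  `|psi k t| <= A * C ^+ (k + j) * (k + j)`!%:R / j`!%:R * (t - t0) ^+ j.
Proof.
move=> A0 C0 p0 dp bp; elim: j k t => [|j IH] k t tt.
  by rewrite addn0 fact0 divr1 expr0 mulr1; exact: bp.
have /andP[t0t tt1] := tt.
have M0 : 0 <= A * C ^+ (k.+1 + j) * (k.+1 + j)`!%:R / j`!%:R.
  by rewrite !mulr_ge0 ?invr_ge0 ?ler0n ?exprn_ge0.
apply: le_trans (@derive_le_power (psi k) (psi k.+1) t0 t _ j M0 t0t _ _ _) _ => //.
- move=> u /andP[u0 ut]; apply: dp; rewrite u0 /=; exact: le_trans ut tt1.
- by move=> u /andP[u0 ut]; apply: IH; rewrite u0 /=; exact: le_trans ut tt1.
rewrite addSnnS factS natrM invfM [_^-1 / _]mulrC !mulrA.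
by apply: ler_wpM2r; [rewrite exprn_ge0 // subr_ge0|].
Qed.

(** The difference vanishes with all its derivatives at a time [t0] slightly
    before [tau], where the radius of convergence of its Taylor series is large
    enough to reach beyond [tau]. *)
Lemma analytic_curve_unique tau a b : analytic_curve tau a ->
  analytic_curve tau b ->
  (exists2 d, 0 < d & forall t, tau - d < t < tau -> a t = b t) ->
  exists2 d, 0 < d & forall t, `|t - tau| < d -> a t = b t.
Proof.
move=> [phi [d1 [A1 [C1 [d10 A10 C10 pa H1]]]]].
move=> [chi [d2 [A2 [C2 [d20 A20 C20 pb H2]]]]] [d3 d30 ab].
pose A := A1 + A2; pose C := C1 + C2.
have A0 : 0 <= A by exact: addr_ge0.
have C0 : 0 <= C by exact: addr_ge0.
pose d := Num.min d1 (Num.min d2 d3).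
have d0 : 0 < d by rewrite !lt_min d10 d20.
have [dd1 dd2 dd3] : [/\ d <= d1, d <= d2 & d <= d3].
  by rewrite /d !ge_min !lexx !orbT.
pose psi k t := phi k t - chi k t.
have dpsi k t : `|t - tau| < d -> is_derive t 1 (psi k) (psi k.+1 t).
  move=> td; apply: is_deriveB.
    by have [] := H1 k t (lt_le_trans td dd1).
  by have [] := H2 k t (lt_le_trans td dd2).
have bpsi k t : `|t - tau| < d -> `|psi k t| <= A * C ^+ k * k`!%:R.
  move=> td; apply: le_trans (ler_normB _ _) _.
  have [_ h1] := H1 k t (lt_le_trans td dd1).
  have [_ h2] := H2 k t (lt_le_trans td dd2).
  apply: le_trans (lerD h1 h2) _; rewrite -mulrDl; apply: ler_wpM2r => //.
  rewrite /A mulrDl; apply: lerD; apply: ler_wpM2l => //.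
    by apply: lerXn2r; rewrite ?nnegrE // lerDl.
  by apply: lerXn2r; rewrite ?nnegrE // lerDr.
have z0 k t : tau - d < t < tau -> psi k t = 0.
  elim: k t => [|k IH] t /andP[t1 t2].
    have td : `|t - tau| < d by rewrite ltr_norml; apply/andP; split; lra.
    rewrite /psi pa ?pb ?(lt_le_trans td) // ab ?subrr //.
    by apply/andP; split=> //; lra.
  have td : `|t - tau| < d by rewrite ltr_norml; apply/andP; split; lra.
  have [_ <-] := dpsi k t td.
  rewrite (@near_eq_derive _ _ _ (psi k) (cst 0)) ?derive_cst //.
  have : \forall u \near t, u \in `](tau - d), tau[.
    by apply: near_in_itvoo; rewrite in_itv /= t1.
  by apply: filterS => u; rewrite in_itv /= => /IH.
(* From [t0 = tau - e] every [t < tau + e] is at distance at most [2 * e],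
   at most half the radius [1 / C]. *)
pose e := Num.min (d / 2) (1 / (4 * (C + 1))).
have C1' : 0 < C + 1 by rewrite ltr_wpDl.
have e0 : 0 < e by rewrite lt_min !divr_gt0 // mulr_gt0.
have ed : e <= d / 2 by rewrite ge_min lexx.
have Ce : C * (2 * e) <= 1 / 2.
  have : e * (4 * (C + 1)) <= 1.
    by rewrite -ler_pdivlMr ?mulr_gt0 // ge_min lexx orbT.
  by move: e0; nra.
exists e => // t te.
have td : `|t - tau| < d by apply: lt_le_trans te _; lra.
suff : psi 0%N t = 0.
  by rewrite /psi pa ?pb ?(lt_le_trans td) // => /subr0_eq.
move: te; rewrite ltr_norml => /andP[te1 te2].
pose t0 := tau - e.
have sm u : t0 <= u <= tau + e -> `|u - tau| < d.
  rewrite /t0 => /andP[u1 u2]; rewrite ltr_norml; apply/andP; split; lra.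
have Hj j : `|psi 0%N t| <= A * (1 / 2) ^+ j.
  have tt : t0 <= t <= tau + e by apply/andP; split; rewrite /t0; lra.
  have := @flat_le psi t0 (tau + e) A C j 0%N t A0 C0 _ _ _ tt.
  rewrite add0n mulfK ?pnatr_eq0 -?lt0n ?fact_gt0 // => H.
  apply: le_trans (H _ _ _) _.
  - by move=> k; apply: z0; rewrite /t0; apply/andP; split; lra.
  - by move=> k u /sm; exact: dpsi.
  - by move=> k u /sm; exact: bpsi.
  rewrite -mulrA -exprMn; apply: ler_wpM2l => //.
  have tp : 0 <= t - t0 by rewrite /t0; lra.
  apply: lerXn2r; rewrite ?nnegrE ?mulr_ge0 ?divr_ge0 //.
  apply: le_trans Ce; apply: ler_wpM2l => //; rewrite /t0; lra.
have c0 : A * (1 / 2) ^+ j @[j --> \oo] --> (0 : R).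
  rewrite -[X in _ --> X](mulr0 A); apply: cvgMr; apply: cvg_expr.
  by rewrite ger0_norm ?divr_ge0 // ltr_pdivrMr // mul1r ltr1n.
apply/eqP; rewrite -normr_le0.
by apply: (cvgr_to_ge c0); exact: nearW.
Qed.

End AnalyticCurves.

(** * Vector fields in coordinates *)

Section Coordinates.
Context {R : realType}.

Definition co (T : Type) (n : nat) (F : T -> 'rV[R]_n) (b : 'I_n) : T -> R :=
  fun z => F z ord0 b.

Section Maps.
Context {V : normedModType R} {n : nat}.
Implicit Types (F : V -> 'rV[R]_n) (b : 'I_n).

Lemma diff_co F z b : differentiable F z -> differentiable (co F b) z.
Proof.
move=> dF.
apply: (@differentiable_comp _ _ _ _ F (fun N : 'rV[R]_n => N ord0 b)) => //.
exact: differentiable_coord.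
Qed.

Lemma co_diff F z : (forall b, differentiable (co F b) z) -> differentiable F z.
Proof.
move=> H; have -> : F = \sum_(b < n) (fun z => co F b z *: delta_mx ord0 b).
  apply/funext => y; rewrite fct_sumE [LHS]row_sum_delta.
  by [].
by apply: differentiable_sum => b; exact: differentiableZl.
Qed.

Lemma derive_co F z v b : differentiable F z ->
  ('D_v F z) ord0 b = 'D_v (co F b) z.
Proof. by move=> dF; rewrite derive_mx ?mxE //; exact: diff_derivable. Qed.

Lemma derive_sumM (f g : 'I_n -> V -> R) z v :
  (forall b, differentiable (f b) z) -> (forall b, differentiable (g b) z) ->
  differentiable (fun y => \sum_b f b y * g b y) z /\
  'D_v (fun y => \sum_b f b y * g b y) z =
  \sum_b ('D_v (f b) z * g b z + f b z * 'D_v (g b) z).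
Proof.
move=> df dg.
have -> : (fun y => \sum_b f b y * g b y) = \sum_b (f b * g b).
  by apply/funext => y; rewrite fct_sumE.
split.
  by apply: differentiable_sum => b; exact: differentiableM.
rewrite derive_sum; last first.
  by move=> b; apply: diff_derivable; exact: differentiableM.
apply: eq_bigr => b _; rewrite deriveM; try exact: diff_derivable.
by rewrite addrC -![_ *: _]/(_ * _) [g b z * _]mulrC.
Qed.

End Maps.

Lemma is_derive_co n (c : R -> 'rV[R]_n) (t : R) (w : 'rV[R]_n) :
  is_derive t 1 c w <-> forall b, is_derive t 1 (co c b) (w ord0 b).
Proof.
split=> [[dc <-] b|H].
  have dc' : differentiable c t by exact/derivable1_diffP.
  have dcb : differentiable (co c b) t by exact: diff_co.
  by apply: DeriveDef; [exact: diff_derivable|rewrite derive_co].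
have dc : derivable c t 1.
  by apply/derivable_mxP => a b; rewrite (ord1 a); have [] := H b.
apply: DeriveDef => //; apply/rowP => b.
by rewrite derive_mx // mxE; have [_] := H b.
Qed.


Lemma jacobian_pd m n (F : 'rV[R]_m -> 'rV[R]_n) z a b : differentiable F z ->
  jacobian F z a b = pd a (co F b) z.
Proof.
move=> dF; by rewrite pdE -derive_co // deriveEjacobian // -rowE [RHS]mxE.
Qed.

Section Fields.
Context {n : nat}.
Implicit Types (A B : 'rV[R]_n -> 'rV[R]_n) (z : 'rV[R]_n).

Definition lbr A B z : 'rV[R]_n := 'D_(A z) B z - 'D_(B z) A z.

Lemma lbrE A B z b : differentiable A z -> differentiable B z ->
  lbr A B z ord0 b =
  \sum_a (A z ord0 a * pd a (co B b) z - B z ord0 a * pd a (co A b) z).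
Proof.
move=> dA dB; rewrite /lbr mxE [X in _ + X]mxE !derive_co //.
by rewrite !derive_pd; try exact: diff_co; rewrite -sumrB.
Qed.

(** [V] pushes [A] forward to [A'] near [y]. *)
Definition related V A A' (y : 'rV[R]_n) := \forall z \near y,
  A' (V z) = \row_b \sum_c A z ord0 c * pd c (co V b) z.

(** Differentiating the law of transformation of vector fields brings in the
    second derivatives of the change of coordinates. Their symmetry is what
    makes brackets and cotangent lifts independent of coordinates. *)
Lemma derive_related V A A' y v b : related V A A' y ->
  differentiable V y -> (forall c, differentiable (pd c (co V b)) y) ->
  differentiable A y -> differentiable A' (V y) ->
  'D_('D_v V y) (co A' b) (V y) =
  \sum_c ('D_v (co A c) y * pd c (co V b) y +
          A y ord0 c * 'D_v (pd c (co V b)) y).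
Proof.
move=> rel dV dpV dA dA'.
have dA'b : differentiable (co A' b) (V y) by exact: diff_co.
have dAc c : differentiable (co A c) y by exact: diff_co.
have [_ <-] := derive_sumM v dAc dpV.
rewrite deriveE // [in LHS]deriveE // -[LHS]/(('d _ _ \o 'd _ _) v).
rewrite -diff_comp // -deriveE; last exact: differentiable_comp.
apply: near_eq_derive; apply: filterS rel => z /= Hz.
by rewrite /co Hz mxE.
Qed.

Lemma related_derive V A A' y : related V A A' y -> differentiable V y ->
  A' (V y) = 'D_(A y) V y.
Proof.
move=> rel dV; apply/rowP => b; rewrite derive_co // derive_pd; last exact: diff_co.
by rewrite (nbhs_singleton rel) mxE.
Qed.

Lemma lbr_related V A A' B B' y :
  related V A A' y -> related V B B' y ->
  differentiable V y -> (forall b c, differentiable (pd c (co V b)) y) ->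
  (forall b c d, pd c (pd d (co V b)) y = pd d (pd c (co V b)) y) ->
  differentiable A y -> differentiable A' (V y) ->
  differentiable B y -> differentiable B' (V y) ->
  lbr A' B' (V y) = \row_b \sum_c lbr A B y ord0 c * pd c (co V b) y.
Proof.
move=> rA rB dV dpV sV dA dA' dB dB'.
apply/rowP => b; rewrite [RHS]mxE /lbr mxE [X in _ + X]mxE.
rewrite (related_derive rA dV) (related_derive rB dV) !derive_co //.
rewrite (derive_related _ rB) // (derive_related _ rA) //.
rewrite !big_split /= opprD addrACA -sumrB.
have -> : \sum_c (B y ord0 c * 'D_(A y) (pd c (co V b)) y) -
          \sum_c (A y ord0 c * 'D_(B y) (pd c (co V b)) y) = 0.
  apply/eqP; rewrite subr_eq0; apply/eqP.
  under eq_bigr => c _ do rewrite derive_pd // mulr_sumr.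
  under [RHS]eq_bigr => c _ do rewrite derive_pd // mulr_sumr.
  rewrite [RHS]exchange_big; apply: eq_bigr => c _; apply: eq_bigr => d _ /=.
  by rewrite sV; ring.
rewrite addr0; apply: eq_bigr => c _.
by rewrite /lbr mxE [X in _ = (_ + X) * _]mxE !derive_co // mulrBl.
Qed.

(** The differential, in the base point, of the pairing of [q] with [A]. *)
Definition cograd A z (q : 'rV[R]_n) : 'rV[R]_n :=
  \row_a \sum_c q ord0 c * pd a (co A c) z.

(** The equation of the cotangent lift of a flow has the same form in both
    coordinate systems: the second derivatives of [V] produced by [qi] and those
    produced by the change of the field cancel. *)
Lemma cotangent_lift_related V A A' (yi qi qj : R -> 'rV[R]_n) (t : R) :
  let y := yi t in
  related V A A' y ->
  differentiable V y -> (forall b c, differentiable (pd c (co V b)) y) ->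
  (forall b c d, pd c (pd d (co V b)) y = pd d (pd c (co V b)) y) ->
  differentiable A y -> differentiable A' (V y) ->
  is_derive t 1 yi (A y) ->
  (\forall s \near t,
     qi s = \row_a \sum_b qj s ord0 b * pd a (co V b) (yi s)) ->
  is_derive t 1 qj (- cograd A' (V y) (qj t)) ->
  is_derive t 1 qi (- cograd A y (qi t)).
Proof.
move=> y rel dV dpV sV dA dA' dyi qiE dqj.
apply/is_derive_co => a.
have dyi' : differentiable yi t by apply/derivable1_diffP; case: dyi.
have dqj' : differentiable qj t by apply/derivable1_diffP; case: dqj.
have dqjb b : differentiable (co qj b) t by exact: diff_co.
have dpb b : differentiable (pd a (co V b) \o yi) t.
  by apply: differentiable_comp => //; exact: dpV.
have [dS vS] := derive_sumM (1 : R) dqjb dpb.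
have e : \forall s \near t,
   \sum_b co qj b s * (pd a (co V b) \o yi) s = co qi a s.
  by apply: filterS qiE => s Hs; rewrite /co Hs mxE.
apply: (near_eq_is_derive e); apply: DeriveDef; first exact: diff_derivable.
rewrite vS {vS}.
have E1 b : 'D_1 (co qj b) t = - cograd A' (V y) (qj t) ord0 b.
  have [_] := (is_derive_co qj t _).1 dqj b; by rewrite mxE => ->.
have E2 b : 'D_1 (pd a (co V b) \o yi) t =
    \sum_c A y ord0 c * pd c (pd a (co V b)) y.
  have [_ ->] := is_derive_comp_curve dyi (dpV b a).
  by rewrite derive_pd.
under eq_bigr => b _ do rewrite E1 E2.
rewrite big_split /= [X in _ = X]mxE.
rewrite (nbhs_singleton qiE).
have K b : 'D_('D_(delta_mx ord0 a) V y) (co A' b) (V y) =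
    \sum_c (pd a (co A c) y * pd c (co V b) y +
            A y ord0 c * pd a (pd c (co V b)) y).
  rewrite (derive_related _ rel) //.
  by apply: eq_bigr => c _; rewrite !(pdE a).
have J b : pd a (co V b) y = ('D_(delta_mx ord0 a) V y) ord0 b.
  by rewrite derive_co // pdE.
have {}E1 : \sum_b - cograd A' (V y) (qj t) ord0 b * (pd a (co V b) \o yi) t =
   - \sum_d qj t ord0 d * 'D_('D_(delta_mx ord0 a) V y) (co A' d) (V y).
  rewrite -sumrN.
  under [RHS]eq_bigr => d _.
    rewrite derive_pd; last exact: diff_co.
    rewrite mulr_sumr -sumrN; over.
  rewrite exchange_big /=; apply: eq_bigr => b _.
  rewrite mxE mulNr mulr_suml -sumrN; apply: eq_bigr => d _.
  by rewrite /comp -/y J; ring.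
rewrite E1 {E1}.
under [X in - X + _]eq_bigr => d _ do rewrite K big_split mulrDr /=.
rewrite big_split /= opprD -addrA.
have -> : - (\sum_d qj t ord0 d *
     \sum_c A y ord0 c * pd a (pd c (co V d)) y) +
   \sum_b co qj b t * \sum_c A y ord0 c * pd c (pd a (co V b)) y = 0.
  apply/eqP; rewrite addrC subr_eq0; apply/eqP; apply: eq_bigr => d _.
  congr (_ * _); by apply: eq_bigr => c _; rewrite sV.
rewrite addr0 mxE; congr (- _).
under eq_bigr => d _ do rewrite mulr_sumr.
rewrite exchange_big; apply: eq_bigr => c _ /=.
rewrite mxE mulr_suml; apply: eq_bigr => d _.
by rewrite -/y; ring.
Qed.

End Fields.
End Coordinates.

(** * Charts *)

Section SmoothCoordinates.
Context {R : realType} {n : nat}.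

Lemma smooth_on_co (U : set 'rV[R]_n) (F : 'rV[R]_n -> 'rV[R]_n) b z :
  open U -> smooth_on U F -> U z -> smooth_at (co F b) z.
Proof.
move=> Uo sF Uz k.
suff H vs y : U y -> Ck k
    (co (foldr (fun v (h : 'rV[R]_n -> 'rV[R]_n) y => 'D_v h y) F vs) b) y.
  exact: (H [::]).
elim: k vs y => [|k IH] vs y Uy.
  by split=> //; apply: diff_co; exact: sF.
split; first by apply: diff_co; exact: sF.
move=> i; apply: (Ck_eq Uo _ Uy (IH (delta_mx ord0 i :: vs) y Uy)) => x Ux.
by rewrite pdE -derive_co //; exact: sF.
Qed.

Lemma derive_compE (U V W : normedModType R) (F : U -> V) (G : V -> W) z v :
  differentiable F z -> differentiable G (F z) ->
  'D_v (G \o F) z = 'D_('D_v F z) G (F z).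
Proof.
move=> dF dG; rewrite deriveE; last exact: differentiable_comp.
by rewrite diff_comp //= -(deriveE v dF) -deriveE.
Qed.

End SmoothCoordinates.

Section Charts.
Context {R : realType} {n : nat} (M : analyticManifold R n).
Implicit Types (x : M) (i j k : atlas M) (X Y : vfield M).

Definition trans i j : 'rV[R]_n -> 'rV[R]_n := chart j \o @ichart R n M i.

Lemma near_chart i x (P : set M) : dom i x -> open P -> P x ->
  \forall y \near chart i x, exists x', [/\ dom i x', P x' & y = chart i x'].
Proof.
move=> ix Po Px.
have cy : (chart i @` dom i) (chart i x) by exists x.
have h1 : \forall y \near chart i x, (chart i @` dom i) y.
  by apply: open_nbhs_nbhs; split=> //; exact: codom_open.
have h2 : \forall y \near chart i x, P (ichart i y).
  have := @ichart_continuous _ _ M i _ cy; apply.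
  by rewrite chartK //; apply: open_nbhs_nbhs.
apply: filterS2 h1 h2 => y [x' ix' <-]; rewrite chartK // => Px'.
by exists x'.
Qed.

Lemma trans_chart i j x : dom i x -> trans i j (chart i x) = chart j x.
Proof. by move=> ix; rewrite /trans /= chartK. Qed.

Lemma trans_analytic i j x b : dom i x -> dom j x ->
  analytic_at (co (trans i j) b) (chart i x).
Proof.
move=> ix jx; apply: (@transition_analytic _ _ M i j b); by exists x.
Qed.

Lemma trans_diff i j x : dom i x -> dom j x ->
  differentiable (trans i j) (chart i x).
Proof.
move=> ix jx; apply: co_diff => b.
exact/ana_diff/analytic_ana/trans_analytic.
Qed.

Lemma trans_pd_diff i j x b c : dom i x -> dom j x ->
  differentiable (pd c (co (trans i j) b)) (chart i x).
Proof.
move=> ix jx; exact/ana_diff/ana_pd/analytic_ana/trans_analytic.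
Qed.

Lemma trans_pdC i j x b c d : dom i x -> dom j x ->
  pd c (pd d (co (trans i j) b)) (chart i x) =
  pd d (pd c (co (trans i j) b)) (chart i x).
Proof. by move=> ix jx; exact/analytic_pdC/trans_analytic. Qed.

Lemma transJE i j x v : dom i x -> dom j x ->
  v *m transJ i j x = 'D_v (trans i j) (chart i x).
Proof. by move=> ix jx; rewrite deriveEjacobian //; exact: trans_diff. Qed.

Lemma transJ_pd i j x a b : dom i x -> dom j x ->
  transJ i j x a b = pd a (co (trans i j) b) (chart i x).
Proof. by move=> ix jx; apply: jacobian_pd; exact: trans_diff. Qed.

Local Opaque transJ.

Lemma transJ_id i x : dom i x -> transJ i i x = 1%:M.
Proof.
move=> ix; apply/row_matrixP => a; rewrite !rowE transJE // mulmx1.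
rewrite (@near_eq_derive _ _ _ _ id) ?derive_id //.
apply: filterS (near_chart ix openT I) => y [x' [ix' _ ->]].
by rewrite trans_chart.
Qed.

(** The chain rule for transition maps. *)
Lemma transJ_cocycle i j k x : dom i x -> dom j x -> dom k x ->
  transJ i k x = transJ i j x *m transJ j k x.
Proof.
move=> ix jx kx; apply/row_matrixP => a; rewrite row_mul.
have rE (j1 j2 : atlas M) : dom j1 x -> dom j2 x ->
    row a (transJ j1 j2 x) = 'D_(delta_mx ord0 a) (trans j1 j2) (chart j1 x).
  by move=> j1x j2x; rewrite rowE; exact: transJE.
apply: (etrans (rE _ _ ix kx)); apply: esym.
apply: (etrans (transJE _ jx kx)).
have e1 := rE _ _ ix jx.
have dF := trans_diff ix jx.
have dG := trans_diff jx kx.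
rewrite -(trans_chart j ix) in dG *.
apply: (etrans (congr1 (fun v => 'D_v (trans j k) (trans i j (chart i x))) e1)).
apply: (etrans (esym (derive_compE _ dF dG))).
apply: near_eq_derive.
apply: filterS (near_chart ix (dom_open j) jx) => y [x' [ix' jx' ->]].
by rewrite /= (trans_chart _ ix') (trans_chart _ jx') (trans_chart _ ix').
Qed.

Lemma vf_locE i X x : dom i x ->
  vf_loc i X (chart i x) = X x *m transJ (chart_at x) i x.
Proof. by move=> ix; rewrite /vf_loc chartK. Qed.

Lemma vf_loc_at X x : vf_loc (chart_at x) X (chart (chart_at x) x) = X x.
Proof.
by rewrite vf_locE ?transJ_id ?mulmx1 //; exact: dom_chart_at.
Qed.

Lemma vf_loc_change i j X x : dom i x -> dom j x ->
  vf_loc j X (chart j x) = vf_loc i X (chart i x) *m transJ i j x.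
Proof.
move=> ix jx; apply: (etrans (vf_locE X jx)); apply: esym.
apply: (etrans (congr1 (mulmx^~ (transJ i j x)) (vf_locE X ix))).
apply: (etrans (esym (mulmxA _ _ _))); congr (_ *m _).
apply: esym; exact: (transJ_cocycle (dom_chart_at x) ix jx).
Qed.

Lemma vf_related i j X x : dom i x -> dom j x ->
  related (trans i j) (vf_loc i X) (vf_loc j X) (chart i x).
Proof.
move=> ix jx.
apply: filterS (near_chart ix (dom_open j) jx) => y [x' [ix' jx' ->]].
rewrite (trans_chart j ix').
apply: (etrans (vf_loc_change X ix' jx')).
apply/rowP => b; rewrite [LHS]mxE [RHS]mxE; apply: eq_bigr => c _.
by congr (_ * _); exact: transJ_pd.
Qed.

Lemma hlin_cot j X y (p : 'rV[R]_n) :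
  let z := ichart j y in hlin X z (cot_change j (chart_at z) z p) =
  \sum_c p ord0 c * vf_loc j X y ord0 c.
Proof.
rewrite /hlin /dotrow /cot_change /vf_loc /tan_change.
move: (ichart j y) => z /=.
under eq_bigr => c _ do rewrite mxE mulr_suml.
rewrite exchange_big; apply: eq_bigr => d _ /=.
rewrite mxE mulr_sumr; apply: eq_bigr => c _.
by rewrite mxE; ring.
Qed.

Local Opaque vf_loc trans bracket.

Definition smooth_field X :=
  forall i x b, dom i x -> smooth_at (co (vf_loc i X) b) (chart i x).

Lemma smooth_vf_field X : smooth_vf X -> smooth_field X.
Proof.
move=> sX i x b ix; apply: (smooth_on_co b (@codom_open _ _ M i) (sX i)).
by exists x.
Qed.

Lemma smooth_field_diff X i x : smooth_field X -> dom i x ->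
  differentiable (vf_loc i X) (chart i x).
Proof.
by move=> sX ix; apply: co_diff => b; apply: smooth_diff; exact: sX.
Qed.

Lemma bracket_loc i X Y x : smooth_field X -> smooth_field Y -> dom i x ->
  vf_loc i (bracket X Y) (chart i x) =
  lbr (vf_loc i X) (vf_loc i Y) (chart i x).
Proof.
move=> sX sY ix; have jx := dom_chart_at x.
have B : bracket X Y x = lbr (vf_loc (chart_at x) X) (vf_loc (chart_at x) Y)
    (chart (chart_at x) x).
  by rewrite /lbr !vf_loc_at.
apply: (etrans (vf_locE (bracket X Y) ix)).
move: B jx; move: (chart_at x) => j e jx.
apply: (etrans (congr1 (mulmx^~ (transJ j i x)) e)).
rewrite -(trans_chart i jx).
apply: esym; apply: (etrans (lbr_related (vf_related X jx ix)
  (vf_related Y jx ix) (trans_diff jx ix) _ _ _ _ _ _)).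
- by move=> b c; exact: trans_pd_diff.
- by move=> b c d; exact: trans_pdC.
- exact: smooth_field_diff.
- by rewrite (trans_chart i jx); exact: smooth_field_diff.
- exact: smooth_field_diff.
- by rewrite (trans_chart i jx); exact: smooth_field_diff.
apply/rowP => b; rewrite [LHS]mxE [RHS]mxE; apply: eq_bigr => c _.
congr (_ * _); apply: esym; exact: transJ_pd.
Qed.

Lemma smooth_bracket X Y : smooth_field X -> smooth_field Y ->
  smooth_field (bracket X Y).
Proof.
move=> sX sY i x b ix k.
have Uo := @codom_open _ _ M i.
have Ux : (chart i @` dom i) (chart i x) by exists x.
pose F a z := vf_loc i X z ord0 a * pd a (co (vf_loc i Y) b) z -
   vf_loc i Y z ord0 a * pd a (co (vf_loc i X) b) z.
apply: (@Ck_eq _ _ (chart i @` dom i) k (fun z => \sum_a F a z)) => //.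
  move=> _ [x' ix' <-]; rewrite /co bracket_loc // lbrE //.
    exact: smooth_field_diff.
  exact: smooth_field_diff.
apply: (Ck_sum _ Uo) => // a _ [y iy <-].
have sM f g : (forall z, (chart i @` dom i) z -> smooth_at f z) ->
    (forall z, (chart i @` dom i) z -> smooth_at g z) ->
    forall z, (chart i @` dom i) z -> Ck k (f \* g) z.
  by move=> sf sg; apply: (CkM Uo) => z Uz; [exact: sf|exact: sg].
have s1 Z c z : smooth_field Z -> (chart i @` dom i) z ->
    smooth_at (co (vf_loc i Z) c) z.
  by move=> sZ [y' iy' <-]; exact: sZ.
have s2 Z c d z : smooth_field Z -> (chart i @` dom i) z ->
    smooth_at (pd d (co (vf_loc i Z) c)) z.
  by move=> sZ Uz; apply: smooth_pd; exact: s1.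
have Uy : (chart i @` dom i) (chart i y) by exists y.
apply: (@Ck_eq _ _ (chart i @` dom i) k
  ((co (vf_loc i X) a \* pd a (co (vf_loc i Y) b)) \+
   cst (-1) \* (co (vf_loc i Y) a \* pd a (co (vf_loc i X) b)))) => //.
  by move=> z _; rewrite /F /= mulN1r.
apply: (CkD Uo) => // z Uz.
  by apply: sM => // w Uw; [exact: s1|exact: s2].
apply: (CkM Uo) => // w Uw; first exact: Ck_cst.
by apply: sM => // v Uv; [exact: s1|exact: s2].
Qed.

Lemma gradient_sum (f g : 'I_n -> 'rV[R]_n -> R) z a :
  (forall b, differentiable (f b) z) -> (forall b, differentiable (g b) z) ->
  gradient (fun y => \sum_b f b y * g b y) z ord0 a =
  \sum_b (pd a (f b) z * g b z + f b z * pd a (g b) z).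
Proof.
move=> df dg; rewrite mxE.
have [_ ->] := derive_sumM (delta_mx ord0 a) df dg.
by apply: eq_bigr => b _; rewrite !pdE.
Qed.

Lemma gradient_linear (v p : 'rV[R]_n) :
  gradient (fun q => \sum_b q ord0 b * v ord0 b) p = v.
Proof.
apply/rowP => a.
rewrite (@gradient_sum (fun b q => q ord0 b) (fun b => cst (v ord0 b))).
- rewrite (bigD1 a) //= pd_coord pd_cst eqxx mul1r mulr0 addr0.
  rewrite big1 ?addr0 // => b ba.
  by rewrite pd_coord pd_cst (negbTE ba) mul0r mulr0 addr0.
- by move=> b; exact: diff_coord.
- by move=> b; exact: differentiable_cst.
Qed.

Lemma gradient_field (A : 'rV[R]_n -> 'rV[R]_n) (q : 'rV[R]_n) z :
  differentiable A z ->
  gradient (fun y => \sum_b q ord0 b * A y ord0 b) z = cograd A z q.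
Proof.
move=> dA; apply/rowP => a.
rewrite (@gradient_sum (fun b => cst (q ord0 b)) (fun b => co A b)).
- by rewrite mxE; apply: eq_bigr => b _; rewrite pd_cst mul0r add0r.
- by move=> b; exact: differentiable_cst.
- by move=> b; exact: diff_co.
Qed.

Lemma ham_vf_hlin X x p : smooth_field X ->
  ham_vf (hlin X) x p =
  (X x, - cograd (vf_loc (chart_at x) X) (chart (chart_at x) x) p).
Proof.
move=> sX; rewrite /ham_vf; congr (_, - _).
  exact: gradient_linear.
rewrite -gradient_field; last by apply: smooth_field_diff => //; exact: dom_chart_at.
apply: (congr1 (fun f => gradient f _)); apply/funext => y.
exact: (hlin_cot (chart_at x) X y p).
Qed.

Definition base_curve i (gam : R -> M) : R -> 'rV[R]_n := chart i \o gam.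
Definition cot_curve i (gam : R -> M) (p : R -> 'rV[R]_n) : R -> 'rV[R]_n :=
  fun s => cot_change (chart_at (gam s)) i (gam s) (p s).

(** Integral curves are defined through a chart that varies along the curve;
    this brings their equation to the fixed chart [i]. *)
Lemma curve_in_chart i X (gam : R -> M) (p : R -> 'rV[R]_n) (t : R) :
  smooth_field X -> dom i (gam t) -> {for t, continuous gam} ->
  is_derive t 1 (base_curve (chart_at (gam t)) gam) (X (gam t)) ->
  is_derive t 1 (cot_curve (chart_at (gam t)) gam p)
    (- cograd (vf_loc (chart_at (gam t)) X)
         (chart (chart_at (gam t)) (gam t)) (p t)) ->
  is_derive t 1 (base_curve i gam) (vf_loc i X (chart i (gam t))) /\
  is_derive t 1 (cot_curve i gam p)
    (- cograd (vf_loc i X) (chart i (gam t)) (cot_curve i gam p t)).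
Proof.
move=> sX ix cg dy dq; have jx := dom_chart_at (gam t).
set j := chart_at (gam t) in jx dy dq.
have near_dom k : dom k (gam t) -> \forall s \near t, dom k (gam s).
  by move=> kx; apply: cg; apply: open_nbhs_nbhs; split=> //; exact: dom_open.
have dyi : is_derive t 1 (base_curve i gam) (vf_loc i X (chart i (gam t))).
  rewrite -(trans_chart i jx) (related_derive (vf_related X jx ix)); last first.
    exact: trans_diff.
  rewrite vf_loc_at.
  have := is_derive_comp_curve dy (trans_diff jx ix).
  apply: near_eq_is_derive; apply: filterS (near_dom j jx) => s js.
  by rewrite /= /base_curve /= trans_chart.
split; first exact: dyi.
have qjt : cot_curve j gam p t = p t.
  by rewrite /cot_curve /cot_change transJ_id // trmx1 mulmx1.
apply: (@cotangent_lift_related _ _ (trans i j) (vf_loc i X) (vf_loc j X)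
  (base_curve i gam) (cot_curve i gam p) (cot_curve j gam p) t).
- exact: vf_related.
- exact: trans_diff.
- by move=> b c; exact: trans_pd_diff.
- by move=> b c d; exact: trans_pdC.
- exact: smooth_field_diff.
- by rewrite /base_curve /= trans_chart //; exact: smooth_field_diff.
- apply: filterS2 (near_dom i ix) (near_dom j jx) => s is' js.
  rewrite /cot_curve /cot_change (@transJ_cocycle i j) //; last exact: dom_chart_at.
  rewrite trmx_mul mulmxA; apply/rowP => a; rewrite [LHS]mxE [RHS]mxE.
  apply: eq_bigr => b _; congr (_ * _); rewrite mxE; exact: transJ_pd.
- by rewrite qjt /base_curve /= trans_chart.
Qed.

End Charts.

(** * Hamiltonian curves in a chart *)

Section OrdinaryDerivative.
Context {R : realType} {V W : normedModType R}.

Lemma deriv_within_is_derive (a b t : R) (f : R -> V) (v : V) : a < t < b ->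
  deriv_within `[a, b] f t v -> is_derive t 1 f v.
Proof.
move=> tab H.
have c : h^-1 *: ((f \o shift t) (h *: 1) - f t) @[h --> 0^'] --> v.
  pose g (h : R) : R := h + t.
  have -> : (fun h => h^-1 *: ((f \o shift t) (h *: 1) - f t)) =
      (fun s => (s - t)^-1 *: (f s - f t)) \o g.
    by apply/funext => h; rewrite /g /= addrK -[h *: 1]/(h * 1) mulr1.
  apply: (@cvg_comp _ _ _ g _ _ _ _ _ H) => P.
  have : \forall h \near (0 : R), `[a, b]%classic (h + t).
    have c0 : {for 0, continuous g}.
      by apply: cvgD; [exact: cvg_id|exact: cvg_cst].
    have : \forall s \near g 0, s \in `]a, b[.
      by rewrite /g add0r; apply: near_in_itvoo; rewrite in_itv.
    move/c0; apply: filterS => h /=.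
    by rewrite !in_itv /= => /andP[h1 h2]; rewrite !ltW.
  move=> hab; rewrite /within /= => HP.
  rewrite /dnbhs /within /= in HP *.
  have : \forall s \near (0 + t), s != t -> `[a, b]%classic s -> P s.
    by rewrite add0r.
  have c0 : (h + t) @[h --> (0 : R)] --> 0 + t.
    by apply: cvgD; [exact: cvg_id|exact: cvg_cst].
  move/c0 => HP'.
  rewrite nbhs_simpl /= in HP' *.
  apply: filterS2 hab HP' => h hab' Ph h0; apply: Ph => //.
  by rewrite -subr_eq0 addrK.
by apply: DeriveDef; [apply/cvg_ex; exists v|exact: cvg_lim].
Qed.

Lemma is_derive_pair (f : R -> V) (g : R -> W) (t : R) (v : V) (w : W) :
  is_derive t 1 (fun s => (f s, g s)) (v, w) ->
  is_derive t 1 f v /\ is_derive t 1 g w.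
Proof.
move=> [/cvg_ex [[l1 l2] H] E].
have {E} : (l1, l2) = (v, w) by rewrite -E; apply: esym; exact: (cvg_lim (@norm_hausdorff _ _) H).
move=> [? ?]; subst l1 l2.
have H1 : h^-1 *: ((f \o shift t) (h *: 1) - f t) @[h --> 0^'] --> v.
  exact: (cvg_comp _ _ H (@cvg_fst _ _ (nbhs v) (nbhs w) _)).
have H2 : h^-1 *: ((g \o shift t) (h *: 1) - g t) @[h --> 0^'] --> w.
  exact: (cvg_comp _ _ H (@cvg_snd _ _ (nbhs v) (nbhs w) _)).
split; apply: DeriveDef; try exact: cvg_lim.
  by apply/cvg_ex; exists v.
by apply/cvg_ex; exists w.
Qed.

End OrdinaryDerivative.

Section FrameCurves.
Context {R : realType} {n : nat} (M : analyticManifold R n).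
Implicit Types (x : M) (i j k : atlas M) (X Y : vfield M).

Definition comb2 (m1 m2 : R) X1 X2 : vfield M :=
  fun x => m1 *: X1 x + m2 *: X2 x.

Lemma vf_loc_comb2 i m1 m2 X1 X2 :
  vf_loc i (comb2 m1 m2 X1 X2) =
  m1 *: vf_loc i X1 + m2 *: vf_loc i X2.
Proof.
by apply/funext => y; rewrite /vf_loc /tan_change mulmxDl -!scalemxAl.
Qed.

Local Opaque transJ vf_loc trans bracket.

Lemma co_comb2 (m1 m2 : R) (A1 A2 : 'rV[R]_n -> 'rV[R]_n) b :
  co (m1 *: A1 + m2 *: A2) b = (cst m1 \* co A1 b) \+ (cst m2 \* co A2 b).
Proof. by apply/funext => y; rewrite /co !mxE. Qed.

Lemma cograd_comb2 (m1 m2 : R) (A1 A2 : 'rV[R]_n -> 'rV[R]_n) y q :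
  differentiable A1 y -> differentiable A2 y ->
  cograd (m1 *: A1 + m2 *: A2) y q = m1 *: cograd A1 y q + m2 *: cograd A2 y q.
Proof.
move=> d1 d2; apply/rowP => a; rewrite !mxE !mulr_sumr -big_split.
apply: eq_bigr => c _ /=; rewrite co_comb2.
have dc (m : R) A : differentiable A y -> differentiable (cst m \* co A c) y.
  by move=> dA; apply: differentiableM; [exact: differentiable_cst|exact: diff_co].
rewrite pdD; [|exact: dc|exact: dc].
rewrite !pdM ?pd_cst; try exact: differentiable_cst; try exact: diff_co.
by rewrite /=; ring.
Qed.

Lemma smooth_comb2 m1 m2 X1 X2 : smooth_field X1 -> smooth_field X2 ->
  smooth_field (comb2 m1 m2 X1 X2).
Proof.
move=> s1 s2 i x b ix k; rewrite vf_loc_comb2 co_comb2.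
have Uo := @codom_open _ _ M i.
have Ux : (chart i @` dom i) (chart i x) by exists x.
apply: (CkD Uo) => // _ [x' ix' <-]; apply: (CkM Uo).
- by move=> *; exact: Ck_cst.
- by move=> _ [x'' ix'' <-]; exact: s1.
- by exists x'.
- by move=> *; exact: Ck_cst.
- by move=> _ [x'' ix'' <-]; exact: s2.
- by exists x'.
Qed.

Lemma hlin_loc i X x (p : 'rV[R]_n) : dom i x ->
  hlin X x p =
  dotrow (cot_change (chart_at x) i x p) (vf_loc i X (chart i x)).
Proof.
move=> ix; have jx := dom_chart_at x.
have := hlin_cot i X (chart i x) (cot_change (chart_at x) i x p).
rewrite chartK // => H; apply: etrans H; congr (hlin X x _).
rewrite /cot_change -mulmxA -trmx_mul.
have := transJ_cocycle jx ix jx.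
by rewrite transJ_id // => <-; rewrite trmx1 mulmx1.
Qed.

Lemma frame_curve_in_chart i X1 X2 (m1 m2 : R) (gam : R -> M)
    (p : R -> 'rV[R]_n) (t : R) :
  let j := chart_at (gam t) in
  let y := chart i (gam t) in
  smooth_field X1 -> smooth_field X2 -> dom i (gam t) ->
  {for t, continuous gam} ->
  is_derive t 1 (fun s => (chart j (gam s),
                 cot_change (chart_at (gam s)) j (gam s) (p s)))
    (m1 *: ham_vf (hlin X1) (gam t) (p t) +
     m2 *: ham_vf (hlin X2) (gam t) (p t)) ->
  is_derive t 1 (base_curve i gam)
    (m1 *: vf_loc i X1 y + m2 *: vf_loc i X2 y) /\
  is_derive t 1 (cot_curve i gam p)
    (- (m1 *: cograd (vf_loc i X1) y (cot_curve i gam p t) +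
        m2 *: cograd (vf_loc i X2) y (cot_curve i gam p t))).
Proof.
move=> j y s1 s2 ix cg; have jx := dom_chart_at (gam t).
rewrite !ham_vf_hlin // => D.
have {D} [dy dq] : is_derive t 1 (base_curve j gam) (m1 *: X1 (gam t) + m2 *: X2 (gam t)) /\
   is_derive t 1 (cot_curve j gam p)
     (- cograd (vf_loc j (comb2 m1 m2 X1 X2)) (chart j (gam t)) (p t)).
  apply: is_derive_pair.
  rewrite vf_loc_comb2 cograd_comb2; try exact: smooth_field_diff.
  by rewrite opprD -!scalerN.
have [] := curve_in_chart (smooth_comb2 m1 m2 s1 s2) ix cg dy dq.
by rewrite vf_loc_comb2 cograd_comb2; try exact: smooth_field_diff.
Qed.

Lemma ham_vf_normal X1 X2 x (p : 'rV[R]_n) :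
  smooth_field X1 -> smooth_field X2 ->
  ham_vf (H_normal X1 X2) x p =
  hlin X1 x p *: ham_vf (hlin X1) x p + hlin X2 x p *: ham_vf (hlin X2) x p.
Proof.
move=> s1 s2.
have half (f g : 'rV[R]_n -> R) z : differentiable f z -> differentiable g z ->
    gradient (fun y => 2%:R^-1 * (f y ^+ 2 + g y ^+ 2)) z =
    f z *: gradient f z + g z *: gradient g z.
  move=> df dg; apply/rowP => a; rewrite !mxE -!pdE.
  have -> : (fun y => 2^-1 * (f y ^+ 2 + g y ^+ 2)) =
     cst 2^-1 \* ((f \* f) \+ (g \* g)).
    by apply/funext => y; rewrite /= !expr2.
  have dff := differentiableM df df; have dgg := differentiableM dg dg.
  rewrite pdM; [|exact: differentiable_cst|exact: differentiableD].
  rewrite pd_cst pdD // !pdM //.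
  by rewrite mul0r add0r /=; field.
have dlin X : differentiable (fun q => hlin X x q) p.
  have [] := @derive_sumM _ _ n (fun b (q : 'rV[R]_n) => q ord0 b)
    (fun b => cst (X x ord0 b)) p 0 _ _ => //.
  by move=> b; exact: diff_coord.
have jx := dom_chart_at x.
pose f X := fun y => let z := ichart (chart_at x) y in
                        hlin X z (cot_change (chart_at x) (chart_at z) z p).
have df X : smooth_field X -> differentiable (f X) (chart (chart_at x) x).
  move=> sX.
  have -> : f X = (fun y => \sum_b p ord0 b * vf_loc (chart_at x) X y ord0 b).
    by apply/funext => y; exact: hlin_cot.
  have [] := @derive_sumM _ _ n (fun b => cst (p ord0 b))
    (fun b => co (vf_loc (chart_at x) X) b) (chart (chart_at x) x) 0 _ _ => //.
  by move=> b; apply: diff_co; exact: smooth_field_diff.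
have fx X : f X (chart (chart_at x) x) = hlin X x p.
  rewrite /f chartK // /cot_change transJ_id // trmx1 mulmx1.
  by [].
rewrite /ham_vf -![RHS]/(_, _); congr (_, _).
  exact: half.
rewrite [X in - X](half (f X1) (f X2)); [|exact: df|exact: df].
by rewrite !fx opprD -!scalerN.
Qed.

End FrameCurves.

(** * Orthogonal changes of frame *)

(** Locked for the same reason as [pd]. *)
HB.lock Definition der (R : realType) (V W : normedModType R)
  (f : V -> W) (y v : V) : W := 'D_v f y.

Lemma derE (R : realType) (V W : normedModType R) (f : V -> W) (y v : V) :
  der f y v = 'D_v f y.
Proof. by rewrite der.unlock. Qed.

Section SmoothIn.
Context {R : realType} {n : nat}.
Implicit Types (f g : 'rV[R]_n -> R) (O : set 'rV[R]_n)
  (Z W A B : 'rV[R]_n -> 'rV[R]_n) (y v q : 'rV[R]_n).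

Definition smooth_in O f := forall z, O z -> smooth_at f z.

Lemma smooth_inD O f g : open O -> smooth_in O f -> smooth_in O g ->
  smooth_in O (fun z => f z + g z).
Proof.
by move=> Oo sf sg z Oz k; apply: (CkD Oo) => // y Oy; [exact: sf|exact: sg].
Qed.

Lemma smooth_inM O f g : open O -> smooth_in O f -> smooth_in O g ->
  smooth_in O (fun z => f z * g z).
Proof.
by move=> Oo sf sg z Oz k; apply: (CkM Oo) => // y Oy; [exact: sf|exact: sg].
Qed.

Lemma smooth_in_cst O (c : R) : smooth_in O (cst c).
Proof. by move=> z _ k; exact: Ck_cst. Qed.

Lemma smooth_in_eq O f g : open O -> (forall z, O z -> f z = g z) ->
  smooth_in O f -> smooth_in O g.
Proof. by move=> Oo fg sf z Oz k; exact: (Ck_eq Oo fg Oz (sf z Oz k)). Qed.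

Lemma smooth_inN O f : open O -> smooth_in O f -> smooth_in O (fun z => - f z).
Proof.
move=> Oo sf; apply: (smooth_in_eq Oo _ (smooth_inM Oo (@smooth_in_cst O (-1)) sf)).
by move=> z _; rewrite mulN1r.
Qed.

Lemma smooth_inB O f g : open O -> smooth_in O f -> smooth_in O g ->
  smooth_in O (fun z => f z - g z).
Proof. by move=> Oo sf sg; apply: smooth_inD => //; exact: smooth_inN. Qed.

Lemma smooth_in_sum O (I : Type) (r : seq I) (F : I -> 'rV[R]_n -> R) :
  open O -> (forall a, smooth_in O (F a)) ->
  smooth_in O (fun z => \sum_(a <- r) F a z).
Proof.
by move=> Oo sF z Oz k; apply: (Ck_sum _ Oo) => // a y Oy; exact: sF.
Qed.

Lemma smooth_in_pd O i f : smooth_in O f -> smooth_in O (pd i f).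
Proof. by move=> sf z /sf; exact: smooth_pd. Qed.

Lemma smooth_in_diff O f z : smooth_in O f -> O z -> differentiable f z.
Proof. by move=> sf /sf /smooth_diff. Qed.

Lemma smooth_inV O f : open O -> smooth_in O f -> (forall z, O z -> 0 < f z) ->
  smooth_in O (fun z => (f z)^-1).
Proof.
move=> Oo sf f0.
have sr : smooth_in O (rsqrt \o f).
  by move=> z Oz k; apply: (Ck_rsqrt Oo) => // y Oy; exact: sf.
apply: (smooth_in_eq Oo _ (smooth_inM Oo sr sr)) => z Oz /=.
rewrite -expr2 -[LHS]mulr1 -(mulfV (_ : f z != 0)) ?gt_eqF ?f0 //.
by rewrite mulrA rsqrt_sqr ?f0 // mul1r.
Qed.

Definition smooth_vec O Z := forall b, smooth_in O (co Z b).

Lemma smooth_vec_diff O Z z : smooth_vec O Z -> O z -> differentiable Z z.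
Proof.
by move=> sZ Oz; apply: co_diff => b; exact: (smooth_in_diff (sZ b) Oz).
Qed.

Lemma smooth_in_derive O f Z : open O -> smooth_in O f -> smooth_vec O Z ->
  smooth_in O (fun z => der f z (Z z)).
Proof.
move=> Oo sf sZ.
have s : smooth_in O (fun z => \sum_a co Z a z * pd a f z).
  by apply: smooth_in_sum => // a; apply: smooth_inM => //; exact: smooth_in_pd.
apply: (smooth_in_eq Oo _ s) => z Oz.
by rewrite derE derive_pd //; exact: (smooth_in_diff sf Oz).
Qed.

Lemma smooth_vec_lbr O A B : open O -> smooth_vec O A -> smooth_vec O B ->
  smooth_vec O (lbr A B).
Proof.
move=> Oo sA sB b.
apply: (smooth_in_eq Oo _ (smooth_inB Oo (smooth_in_derive Oo (sB b) sA)
  (smooth_in_derive Oo (sA b) sB))) => z Oz.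
rewrite !derE [RHS]mxE [X in _ = _ + X]mxE !derive_co //.
  exact: smooth_vec_diff Oz.
exact: smooth_vec_diff Oz.
Qed.

Lemma dotrowD q u v : dotrow q (u + v) = dotrow q u + dotrow q v :> R.
Proof.
by rewrite -big_split; apply: eq_bigr => i _; rewrite mxE mulrDr.
Qed.

Lemma dotrowZ (s : R) q v : dotrow q (s *: v) = s * dotrow q v.
Proof.
by rewrite mulr_sumr; apply: eq_bigr => i _; rewrite mxE; ring.
Qed.

Lemma dotrowN q v : dotrow q (- v) = - dotrow q v :> R.
Proof. by rewrite -scaleN1r dotrowZ mulN1r. Qed.

Lemma smooth_in_dotrow O q Z : open O -> smooth_vec O Z ->
  smooth_in O (fun z => dotrow q (Z z)).
Proof.
move=> Oo sZ; apply: smooth_in_sum => // a.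
by apply: smooth_inM; [|exact: smooth_in_cst|exact: sZ].
Qed.

Lemma derive_lin2 Z y (s t : R) u v : differentiable Z y ->
  der Z y (s *: u + t *: v) = s *: der Z y u + t *: der Z y v.
Proof. by move=> dZ; rewrite !derE !deriveE // linearD !linearZ. Qed.

Lemma lbr_der A B y : lbr A B y = der B y (A y) - der A y (B y).
Proof. by rewrite !derE. Qed.

Lemma derive_comb3 O W Z1 Z2 B (f g h : 'rV[R]_n -> R) y v : open O ->
  (forall z, O z -> B z = f z *: W z + g z *: Z1 z + h z *: Z2 z) ->
  smooth_in O f -> smooth_in O g -> smooth_in O h ->
  smooth_vec O W -> smooth_vec O Z1 -> smooth_vec O Z2 -> O y ->
  der B y v = f y *: der W y v + g y *: der Z1 y v + h y *: der Z2 y v +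
    (der f y v *: W y + der g y v *: Z1 y + der h y v *: Z2 y).
Proof.
move=> Oo HB sf sg sh sW s1 s2 Oy; rewrite !derE; apply/rowP => b.
have df := smooth_in_diff sf Oy; have dg := smooth_in_diff sg Oy.
have dh := smooth_in_diff sh Oy.
have dW := smooth_in_diff (sW b) Oy; have d1 := smooth_in_diff (s1 b) Oy.
have d2 := smooth_in_diff (s2 b) Oy.
have E z : O z ->
    ((f \* co W b) \+ (g \* co Z1 b) \+ (h \* co Z2 b)) z = co B b z.
  by move=> Oz; rewrite /co HB // !mxE.
have dM (p r : 'rV[R]_n -> R) : differentiable p y -> differentiable r y ->
    differentiable (p \* r) y by exact: differentiableM.
have dB : differentiable B y.
  apply: co_diff => e.
  have E' z : O z ->
      ((f \* co W e) \+ (g \* co Z1 e) \+ (h \* co Z2 e)) z = co B e z.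
    by move=> Oz; rewrite /co HB // !mxE.
  apply: (diff_eq_on Oo E' Oy).
  apply: differentiableD; first apply: differentiableD; apply: dM => //.
  - exact: (smooth_in_diff (sW e) Oy).
  - exact: (smooth_in_diff (s1 e) Oy).
  - exact: (smooth_in_diff (s2 e) Oy).
rewrite derive_co // -(near_eq_derive _ (in_near Oo Oy E)).
have MM (p r : 'rV[R]_n -> R) : differentiable p y -> differentiable r y ->
    'D_v (p \* r) y = p y * 'D_v r y + 'D_v p y * r y.
  move=> dp dr; have -> := @deriveM R _ p r y v; try exact: diff_derivable.
  by rewrite -![_ *: _]/(_ * _) [r y * _]mulrC.
have DD (p r : 'rV[R]_n -> R) : differentiable p y -> differentiable r y ->
    'D_v (p \+ r) y = 'D_v p y + 'D_v r y.
  by move=> dp dr; apply: deriveD; exact: diff_derivable.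
rewrite DD; [|by apply: differentiableD; exact: dM|exact: dM].
rewrite DD; [|exact: dM|exact: dM].
rewrite !MM //.
rewrite -(derive_co _ _ (smooth_vec_diff sW Oy)).
rewrite -(derive_co _ _ (smooth_vec_diff s1 Oy)).
rewrite -(derive_co _ _ (smooth_vec_diff s2 Oy)).
move: ('D_v W y) ('D_v Z1 y) ('D_v Z2 y) => u1 u2 u3.
by rewrite !mxE /co; ring.
Qed.

End SmoothIn.

Section FrameChange.
Context {R : realType} {n : nat}.
Implicit Types (O : set 'rV[R]_n) (Z A : 'rV[R]_n -> 'rV[R]_n)
  (a b c d : 'rV[R]_n -> R) (y v q : 'rV[R]_n).

Record orthogonal_change O Z1 Z2 A1 A2 a b c d : Prop := OrthogonalChange {
  oc_open : open O;
  oc_Z1 : smooth_vec O Z1;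
  oc_Z2 : smooth_vec O Z2;
  oc_A1 : smooth_vec O A1;
  oc_A2 : smooth_vec O A2;
  oc_a : smooth_in O a;
  oc_b : smooth_in O b;
  oc_c : smooth_in O c;
  oc_d : smooth_in O d;
  oc_E1 : forall y, O y -> A1 y = a y *: Z1 y + b y *: Z2 y;
  oc_E2 : forall y, O y -> A2 y = c y *: Z1 y + d y *: Z2 y;
  oc_orth : forall y, O y -> [/\ a y ^+ 2 + b y ^+ 2 = 1,
    c y ^+ 2 + d y ^+ 2 = 1 & a y * c y + b y * d y = 0] }.

Lemma orthogonal_transpose (a b c d : R) : a ^+ 2 + b ^+ 2 = 1 ->
  c ^+ 2 + d ^+ 2 = 1 -> a * c + b * d = 0 ->
  [/\ a ^+ 2 + c ^+ 2 = 1, b ^+ 2 + d ^+ 2 = 1, a * b + c * d = 0 &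
      (a * d - b * c) ^+ 2 = 1].
Proof.
move=> h1 h2 h3.
have e : (a * d - b * c) ^+ 2 = 1.
  have -> : (a * d - b * c) ^+ 2 =
    (a ^+ 2 + b ^+ 2) * (c ^+ 2 + d ^+ 2) - (a * c + b * d) ^+ 2 by ring.
  by rewrite h1 h2 h3; ring.
have ed : d = (a * d - b * c) * a.
  have -> : (a * d - b * c) * a =
    d * (a ^+ 2 + b ^+ 2) - b * (a * c + b * d) by ring.
  by rewrite h1 h3; ring.
have ec : c = - (a * d - b * c) * b.
  have -> : - (a * d - b * c) * b =
    c * (a ^+ 2 + b ^+ 2) - a * (a * c + b * d) by ring.
  by rewrite h1 h3; ring.
split=> //.
- by rewrite [in c ^+ 2]ec exprMn sqrrN e mul1r.
- by rewrite [in d ^+ 2]ed exprMn e mul1r addrC.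
- have -> : c * d = - (a * d - b * c) * b * ((a * d - b * c) * a).
    by rewrite -ed -ec.
  move: e; set D := _ - _ => e.
  have -> : a * b + - D * b * (D * a) = a * b * (1 - D ^+ 2) by ring.
  by rewrite e subrr mulr0.
Qed.

Lemma derive_comb2 O Z1 Z2 B (f g : 'rV[R]_n -> R) y v : open O ->
  (forall z, O z -> B z = f z *: Z1 z + g z *: Z2 z) ->
  smooth_in O f -> smooth_in O g ->
  smooth_vec O Z1 -> smooth_vec O Z2 -> O y ->
  der B y v = f y *: der Z1 y v + g y *: der Z2 y v +
    (der f y v *: Z1 y + der g y v *: Z2 y).
Proof.
move=> Oo HB sf sg s1 s2 Oy.
rewrite (@derive_comb3 _ _ O Z1 Z1 Z2 B (cst 0) f g y v) //.
- by rewrite (derE (cst 0)) derive_cst !scale0r !add0r.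
- by move=> z Oz; rewrite HB // scale0r add0r.
- exact: smooth_in_cst.
Qed.

Lemma cograd_dotrow Z y q : differentiable Z y ->
  cograd Z y q = \row_e dotrow q (der Z y (delta_mx ord0 e)).
Proof.
move=> dZ; apply/rowP => e; rewrite !mxE; apply: eq_bigr => b _.
by rewrite derE derive_co // pdE.
Qed.

(** The two sides are the partial gradients, in momentum and in position, of
    half the sum of the squares of the momenta, which is the same for all
    orthonormal frames. *)
Lemma normal_frame_change O Z1 Z2 A1 A2 a b c d y q :
  orthogonal_change O Z1 Z2 A1 A2 a b c d -> O y ->
  dotrow q (A1 y) *: A1 y + dotrow q (A2 y) *: A2 y =
  dotrow q (Z1 y) *: Z1 y + dotrow q (Z2 y) *: Z2 y /\
  dotrow q (A1 y) *: cograd A1 y q + dotrow q (A2 y) *: cograd A2 y q =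
  dotrow q (Z1 y) *: cograd Z1 y q + dotrow q (Z2 y) *: cograd Z2 y q.
Proof.
move=> H Oy; have Oo := oc_open H.
have [h1 h2 h3] := oc_orth H Oy.
have [g1 g2 g3 _] := orthogonal_transpose h1 h2 h3.
have dT e :
  [/\ a y * der a y e + c y * der c y e = 0,
      b y * der b y e + d y * der d y e = 0 &
      a y * der b y e + b y * der a y e + (c y * der d y e + d y * der c y e) = 0].
  have G z : O z -> [/\ a z * a z + c z * c z = 1,
      b z * b z + d z * d z = 1 & a z * b z + c z * d z = 0].
    move=> Oz; have [k1 k2 k3] := oc_orth H Oz.
    by have [j1 j2 j3 _] := orthogonal_transpose k1 k2 k3; rewrite -!expr2.
  have K (f1 f2 f3 f4 : 'rV[R]_n -> R) (w : R) : smooth_in O f1 ->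
      smooth_in O f2 -> smooth_in O f3 -> smooth_in O f4 ->
      (forall z, O z -> f1 z * f2 z + f3 z * f4 z = w) ->
      f1 y * der f2 y e + f2 y * der f1 y e +
      (f3 y * der f4 y e + f4 y * der f3 y e) = 0.
    rewrite !derE; move=> s1 s2 s3 s4 E.
    have d1 := smooth_in_diff s1 Oy; have d2 := smooth_in_diff s2 Oy.
    have d3 := smooth_in_diff s3 Oy; have d4 := smooth_in_diff s4 Oy.
    have <- : 'D_e ((f1 \* f2) \+ (f3 \* f4)) y = 0.
      by rewrite (near_eq_derive _ (in_near Oo Oy E)) derive_cst.
    have d12 := differentiableM d1 d2; have d34 := differentiableM d3 d4.
    have -> := @deriveD R _ _ (f1 \* f2) (f3 \* f4) y e; last 2 first.
    - exact: diff_derivable.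
    - exact: diff_derivable.
    by congr (_ + _); rewrite deriveM //; exact: diff_derivable.
  split.
  - have := K a a c c 1 (oc_a H) (oc_a H) (oc_c H) (oc_c H)
      (fun z Oz => let: And3 h _ _ := G z Oz in h); lra.
  - have := K b b d d 1 (oc_b H) (oc_b H) (oc_d H) (oc_d H)
      (fun z Oz => let: And3 _ h _ := G z Oz in h); lra.
  - exact: (K a b c d 0 (oc_a H) (oc_b H) (oc_c H) (oc_d H)
      (fun z Oz => let: And3 _ _ h := G z Oz in h)).
rewrite !cograd_dotrow; try exact: (smooth_vec_diff _ Oy (O := O)); last 4 first.
- exact: smooth_vec_diff (oc_Z2 H) Oy.
- exact: smooth_vec_diff (oc_Z1 H) Oy.
- exact: smooth_vec_diff (oc_A2 H) Oy.
- exact: smooth_vec_diff (oc_A1 H) Oy.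
split; apply/rowP => e.
  rewrite (oc_E1 H Oy) (oc_E2 H Oy) !dotrowD !dotrowZ !mxE.
  set k1 := dotrow q _; set k2 := dotrow q _.
  set u := Z1 y _ _; set v := Z2 y _ _.
  have -> : (a y * k1 + b y * k2) * (a y * u + b y * v) +
     (c y * k1 + d y * k2) * (c y * u + d y * v) =
     (a y ^+ 2 + c y ^+ 2) * k1 * u + (b y ^+ 2 + d y ^+ 2) * k2 * v +
     (a y * b y + c y * d y) * (k1 * v + k2 * u) by ring.
  by rewrite g1 g2 g3; ring.
rewrite !mxE (oc_E1 H Oy) (oc_E2 H Oy) !dotrowD !dotrowZ.
rewrite (derive_comb2 _ Oo (oc_E1 H) (oc_a H) (oc_b H) (oc_Z1 H) (oc_Z2 H) Oy).
rewrite (derive_comb2 _ Oo (oc_E2 H) (oc_c H) (oc_d H) (oc_Z1 H) (oc_Z2 H) Oy).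
have [t1 t2 t3] := dT (delta_mx ord0 e).
rewrite !dotrowD !dotrowZ.
set k1 := dotrow q (Z1 y); set k2 := dotrow q (Z2 y).
move: t1 t2 t3.
set da := der a _ _; set db := der b _ _; set dc := der c _ _.
set dd := der d _ _ => t1 t2 t3.
set u := dotrow q (der Z1 _ _); set w := dotrow q (der Z2 _ _).
have -> : (a y * k1 + b y * k2) * (a y * u + b y * w + (da * k1 + db * k2)) +
   (c y * k1 + d y * k2) * (c y * u + d y * w + (dc * k1 + dd * k2)) =
   (a y ^+ 2 + c y ^+ 2) * k1 * u + (b y ^+ 2 + d y ^+ 2) * k2 * w +
   (a y * b y + c y * d y) * (k1 * w + k2 * u) +
   (a y * da + c y * dc) * k1 ^+ 2 + (b y * db + d y * dd) * k2 ^+ 2 +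
   (a y * db + b y * da + (c y * dd + d y * dc)) * k1 * k2 by ring.
by rewrite g1 g2 g3 t1 t2 t3; ring.
Qed.

(** Where [q] annihilates [Z1], [Z2], [W] and the bracket of [Z1] and [Z2], the
    derivatives of the coefficients do not contribute. *)
Lemma dotrow_lbr_comb O W Z1 Z2 A B (a b f g h : 'rV[R]_n -> R) y q :
  open O -> smooth_vec O W -> smooth_vec O Z1 -> smooth_vec O Z2 ->
  smooth_in O a -> smooth_in O b ->
  smooth_in O f -> smooth_in O g -> smooth_in O h ->
  (forall z, O z -> A z = a z *: Z1 z + b z *: Z2 z) ->
  (forall z, O z -> B z = f z *: W z + g z *: Z1 z + h z *: Z2 z) -> O y ->
  dotrow q (Z1 y) = 0 -> dotrow q (Z2 y) = 0 -> dotrow q (W y) = 0 ->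
  dotrow q (lbr Z1 Z2 y) = 0 ->
  dotrow q (lbr A B y) =
  f y * (a y * dotrow q (lbr Z1 W y) + b y * dotrow q (lbr Z2 W y)).
Proof.
move=> Oo sW s1 s2 sa sb sf sg sh HA HB Oy k1 k2 kW.
have dW := smooth_vec_diff sW Oy.
have d1 := smooth_vec_diff s1 Oy; have d2 := smooth_vec_diff s2 Oy.
rewrite !lbr_der.
rewrite (derive_comb3 _ Oo HB sf sg sh sW s1 s2 Oy).
rewrite (derive_comb2 _ Oo HA sa sb s1 s2 Oy).
rewrite (HA y Oy) (HB y Oy).
have l3 Z (r s t : R) u v w : differentiable Z y ->
   der Z y (r *: u + s *: v + t *: w) =
   r *: der Z y u + s *: der Z y v + t *: der Z y w.
  by move=> dZ; rewrite !derE !deriveE // !linearD !linearZ.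
rewrite !l3 //. rewrite !derive_lin2 // !(dotrowD, dotrowN, dotrowZ) k1 k2 kW => K.
move: K; set p12 := dotrow q (der Z2 y (Z1 y)).
set p21 := dotrow q (der Z1 y (Z2 y)).
move=> /subr0_eq E; rewrite E; ring.
Qed.

Lemma lbr_comb O Z1 Z2 A1 A2 a b c d y :
  orthogonal_change O Z1 Z2 A1 A2 a b c d -> O y ->
  lbr A1 A2 y = (a y * d y - b y * c y) *: lbr Z1 Z2 y +
    (der c y (A1 y) - der a y (A2 y)) *: Z1 y +
    (der d y (A1 y) - der b y (A2 y)) *: Z2 y.
Proof.
move=> H Oy; have Oo := oc_open H.
have d1 := smooth_vec_diff (oc_Z1 H) Oy.
have d2 := smooth_vec_diff (oc_Z2 H) Oy.
rewrite !lbr_der.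
rewrite (derive_comb2 _ Oo (oc_E1 H) (oc_a H) (oc_b H) (oc_Z1 H) (oc_Z2 H) Oy).
rewrite (derive_comb2 _ Oo (oc_E2 H) (oc_c H) (oc_d H) (oc_Z1 H) (oc_Z2 H) Oy).
rewrite [in der Z1 _ (A1 y)](oc_E1 H Oy) [in der Z2 _ (A1 y)](oc_E1 H Oy).
rewrite [in der Z1 _ (A2 y)](oc_E2 H Oy) [in der Z2 _ (A2 y)](oc_E2 H Oy).
rewrite !derive_lin2 //; apply/rowP => e; rewrite !mxE; ring.
Qed.

(** On the annihilator of the derived distribution the third order brackets
    transform by the matrix of the change of frame times its determinant, so
    the abnormal field keeps the same expression. *)
Lemma abnormal_frame_change O Z1 Z2 A1 A2 a b c d y q :
  orthogonal_change O Z1 Z2 A1 A2 a b c d -> O y ->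
  dotrow q (A1 y) = 0 -> dotrow q (A2 y) = 0 -> dotrow q (lbr A1 A2 y) = 0 ->
  forall h112 h212 k112 k212 : R,
  h112 = dotrow q (lbr A1 (lbr A1 A2) y) ->
  h212 = dotrow q (lbr A2 (lbr A1 A2) y) ->
  k112 = dotrow q (lbr Z1 (lbr Z1 Z2) y) ->
  k212 = dotrow q (lbr Z2 (lbr Z1 Z2) y) ->
  [/\ h212 ^+ 2 + h112 ^+ 2 = k112 ^+ 2 + k212 ^+ 2,
      - h212 *: A1 y + h112 *: A2 y = - k212 *: Z1 y + k112 *: Z2 y &
      - h212 *: cograd A1 y q + h112 *: cograd A2 y q =
      - k212 *: cograd Z1 y q + k112 *: cograd Z2 y q].
Proof.
move=> H Oy hA1 hA2 hA12 h112 h212 k112 k212 Eh1 Eh2 Ek1 Ek2; have Oo := oc_open H.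
have [h1 h2 h3] := oc_orth H Oy.
have [g1 g2 g3 g4] := orthogonal_transpose h1 h2 h3.
have k1 : dotrow q (Z1 y) = 0.
  have -> : Z1 y = a y *: A1 y + c y *: A2 y.
    rewrite (oc_E1 H Oy) (oc_E2 H Oy); apply/rowP => e; rewrite !mxE.
    set u := Z1 y _ _; set v := Z2 y _ _.
    have -> : a y * (a y * u + b y * v) + c y * (c y * u + d y * v) =
      (a y ^+ 2 + c y ^+ 2) * u + (a y * b y + c y * d y) * v by ring.
    by rewrite g1 g3; ring.
  by rewrite dotrowD !dotrowZ hA1 hA2 !mulr0 addr0.
have k2 : dotrow q (Z2 y) = 0.
  have -> : Z2 y = b y *: A1 y + d y *: A2 y.
    rewrite (oc_E1 H Oy) (oc_E2 H Oy); apply/rowP => e; rewrite !mxE.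
    set u := Z1 y _ _; set v := Z2 y _ _.
    have -> : b y * (a y * u + b y * v) + d y * (c y * u + d y * v) =
      (b y ^+ 2 + d y ^+ 2) * v + (a y * b y + c y * d y) * u by ring.
    by rewrite g2 g3; ring.
  by rewrite dotrowD !dotrowZ hA1 hA2 !mulr0 addr0.
set D := a y * d y - b y * c y in g4.
have k12 : dotrow q (lbr Z1 Z2 y) = 0.
  have := hA12; rewrite (lbr_comb H Oy) -/D; move: (lbr Z1 Z2 y) => w.
  rewrite !dotrowD !dotrowZ k1 k2 !mulr0 !addr0 => /eqP; rewrite mulf_eq0 => /orP[/eqP D0|/eqP k12].
    by move: g4; rewrite D0 expr0n /= => /eqP; rewrite eq_sym oner_eq0.
  exact: k12.
have sf : smooth_in O (fun z => a z * d z - b z * c z).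
  apply: smooth_inB => //; apply: smooth_inM => //.
  - exact: oc_a H.
  - exact: oc_d H.
  - exact: oc_b H.
  - exact: oc_c H.
have sg : smooth_in O (fun z => der c z (A1 z) - der a z (A2 z)).
  apply: smooth_inB => //; apply: smooth_in_derive => //.
  - exact: oc_c H.
  - exact: oc_A1 H.
  - exact: oc_a H.
  - exact: oc_A2 H.
have sh : smooth_in O (fun z => der d z (A1 z) - der b z (A2 z)).
  apply: smooth_inB => //; apply: smooth_in_derive => //.
  - exact: oc_d H.
  - exact: oc_A1 H.
  - exact: oc_b H.
  - exact: oc_A2 H.
have sW := smooth_vec_lbr Oo (oc_Z1 H) (oc_Z2 H).
have e1 : h112 = D * (a y * k112 + b y * k212).
  rewrite Ek1 Ek2; apply: etrans (dotrow_lbr_comb Oo sW (oc_Z1 H) (oc_Z2 H) (oc_a H) (oc_b H) sf sg sh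
    (oc_E1 H) (fun z Oz => lbr_comb H Oz) Oy k1 k2 k12 k12); exact: Eh1.
have e2 : h212 = D * (c y * k112 + d y * k212).
  rewrite Ek1 Ek2; apply: etrans (dotrow_lbr_comb Oo sW (oc_Z1 H) (oc_Z2 H) (oc_c H) (oc_d H) sf sg sh
    (oc_E2 H) (fun z Oz => lbr_comb H Oz) Oy k1 k2 k12 k12); exact: Eh2.
split.
- rewrite e1 e2.
  have -> : (D * (c y * k112 + d y * k212)) ^+ 2 +
     (D * (a y * k112 + b y * k212)) ^+ 2 =
     D ^+ 2 * ((a y ^+ 2 + c y ^+ 2) * k112 ^+ 2 +
     (b y ^+ 2 + d y ^+ 2) * k212 ^+ 2 +
     2 * (a y * b y + c y * d y) * (k112 * k212)) by ring.
  by rewrite g1 g2 g3 g4; ring.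
- rewrite e1 e2 (oc_E1 H Oy) (oc_E2 H Oy); apply/rowP => e; rewrite !mxE.
  set u := Z1 y _ _; set v := Z2 y _ _.
  have -> : - (D * (c y * k112 + d y * k212)) * (a y * u + b y * v) +
    D * (a y * k112 + b y * k212) * (c y * u + d y * v) =
    D ^+ 2 * (- k212 * u + k112 * v) by rewrite /D; ring.
  by rewrite g4; ring.
- rewrite e1 e2 !cograd_dotrow; last 4 first.
  + exact: smooth_vec_diff (oc_Z2 H) Oy.
  + exact: smooth_vec_diff (oc_Z1 H) Oy.
  + exact: smooth_vec_diff (oc_A2 H) Oy.
  + exact: smooth_vec_diff (oc_A1 H) Oy.
  apply/rowP => e; rewrite !mxE.
  rewrite (derive_comb2 _ Oo (oc_E1 H) (oc_a H) (oc_b H) (oc_Z1 H) (oc_Z2 H) Oy).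
  rewrite (derive_comb2 _ Oo (oc_E2 H) (oc_c H) (oc_d H) (oc_Z1 H) (oc_Z2 H) Oy).
  rewrite !dotrowD !dotrowZ k1 k2.
  set u := dotrow q (der Z1 _ _); set v := dotrow q (der Z2 _ _).
  have -> : forall x1 x2 x3 x4 : R,
    - (D * (c y * k112 + d y * k212)) *
      (a y * u + b y * v + (x1 * 0 + x2 * 0)) +
    D * (a y * k112 + b y * k212) *
      (c y * u + d y * v + (x3 * 0 + x4 * 0)) =
    D ^+ 2 * (- k212 * u + k112 * v) by move=> *; rewrite /D; ring.
  by rewrite g4; ring.
Qed.

(** Cramer's rule expresses the coefficients through the linear forms [L1] and
    [L2], hence they are as smooth as the fields. *)
Lemma coef_smooth O Z1 Z2 A a b (L1 L2 : 'rV[R]_n) : open O ->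
  smooth_vec O Z1 -> smooth_vec O Z2 -> smooth_vec O A ->
  (forall y, O y -> A y = a y *: Z1 y + b y *: Z2 y) ->
  (forall y, O y -> 0 < dotrow L1 (Z1 y) * dotrow L2 (Z2 y) -
                        dotrow L1 (Z2 y) * dotrow L2 (Z1 y)) ->
  smooth_in O a /\ smooth_in O b.
Proof.
move=> Oo s1 s2 sA E D0.
have l1 L := smooth_in_dotrow L Oo s1; have l2 L := smooth_in_dotrow L Oo s2.
have lA L := smooth_in_dotrow L Oo sA.
have sV := smooth_inV Oo (smooth_inB Oo (smooth_inM Oo (l1 L1) (l2 L2))
  (smooth_inM Oo (l2 L1) (l1 L2))) D0.
have EA y L : O y -> dotrow L (A y) =
    a y * dotrow L (Z1 y) + b y * dotrow L (Z2 y).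
  by move=> Oy; rewrite E // dotrowD !dotrowZ.
split.
  apply: (smooth_in_eq Oo _ (smooth_inM Oo (smooth_inB Oo
    (smooth_inM Oo (lA L1) (l2 L2)) (smooth_inM Oo (l2 L1) (lA L2))) sV)).
  move=> y Oy; rewrite !EA //; move: (D0 y Oy); set D := _ - _ => Dp.
  apply: (mulIf (lt0r_neq0 Dp)); rewrite divfK ?gt_eqF // /D; ring.
apply: (smooth_in_eq Oo _ (smooth_inM Oo (smooth_inB Oo
    (smooth_inM Oo (l1 L1) (lA L2)) (smooth_inM Oo (lA L1) (l1 L2))) sV)).
move=> y Oy; rewrite !EA //; move: (D0 y Oy); set D := _ - _ => Dp.
apply: (mulIf (lt0r_neq0 Dp)); rewrite divfK ?gt_eqF // /D; ring.
Qed.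

End FrameChange.

(** * Analytic orthonormal frames *)

Section EuclideanPlane.
Context {R : realType} {n : nat}.
Implicit Types (u v w e f : 'rV[R]_n) (D : {vspace 'rV[R]_n})
  (G : 'rV[R]_n -> 'rV[R]_n -> R).

Definition inner_product D G :=
  [/\ forall u v, u \in D -> v \in D -> G u v = G v u,
      forall (a : R) u v w, u \in D -> v \in D ->
        w \in D -> G (a *: u + v) w = a * G u w + G v w &
      forall v, v \in D -> v != 0 -> 0 < G v v].

Lemma inner_lin2 D G (a b : R) u v w : inner_product D G ->
  u \in D -> v \in D -> w \in D ->
  G (a *: u + b *: v) w = a * G u w + b * G v w.
Proof.
move=> [sG lG pG] uD vD wD; rewrite lG ?memvZ //; congr (_ + _).
have G0 : G 0 w = 0.
  have := lG (-1) u u w uD uD wD.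
  by rewrite scaleN1r addNr mulN1r addNr.
by have := lG b v 0 w vD (mem0v _) wD; rewrite addr0 G0 addr0.
Qed.

Lemma inner_comb2 D G (a b c d : R) u v : inner_product D G ->
  u \in D -> v \in D ->
  G (a *: u + b *: v) (c *: u + d *: v) =
  a * c * G u u + b * d * G v v + (a * d + b * c) * G u v.
Proof.
move=> iG uD vD; have [sG _ _] := iG.
have cD : c *: u + d *: v \in D by rewrite memvD ?memvZ.
rewrite (inner_lin2 a b iG uD vD cD) (sG u _ uD cD) (sG v _ vD cD).
rewrite (inner_lin2 c d iG uD vD uD) (inner_lin2 c d iG uD vD vD).
by rewrite (sG v u vD uD); ring.
Qed.

(** Here [w] is the squared norm of the component of [f] orthogonal to [e]. *)
Lemma gram_schmidt D G f e : inner_product D G ->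
  D = <<[:: f; e]>>%VS -> \dim D = 2 ->
  let r := rsqrt (G e e) in
  let z0 := r *: e in
  let w := G f f - G f e ^+ 2 * r ^+ 2 in
  let z1 := rsqrt w *: (f - (G f e * r ^+ 2) *: e) in
  [/\ 0 < G e e, 0 < w, z0 \in D /\ z1 \in D,
      [/\ G z0 z0 = 1, G z1 z1 = 1 & G z0 z1 = 0] &
      forall v, v \in D -> v = G v z0 *: z0 + G v z1 *: z1].
Proof.
move=> iG DE dD r z0 w z1; have [sG lG pG] := iG.
have fr : free [:: f; e] by rewrite /free -DE dD.
have [fe e0] : f \notin <[e]>%VS /\ e != 0.
  by move: fr; rewrite free_cons span_seq1 seq1_free => /andP[].
have eD : e \in D by rewrite DE memv_span // !inE eqxx orbT.
have fD : f \in D by rewrite DE memv_span // !inE eqxx.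
have G0 : 0 < G e e by exact: pG.
have r0 : 0 < r by exact: rsqrt_gt0.
have rG : r ^+ 2 * G e e = 1 by exact: rsqrt_sqr.
pose k := G f e * r ^+ 2.
pose W := f - k *: e.
have WE : W = 1 *: f + (- k) *: e by rewrite scale1r scaleNr.
have WD : W \in D by rewrite WE memvD ?memvZ.
have W0 : W != 0.
  by apply: contraNneq fe => /subr0_eq ->; exact: memvZ (memv_line _).
have wE : w = G W W.
  rewrite WE (inner_comb2 _ _ _ _ iG fD eD) /k /w.
  transitivity (G f f - G f e ^+ 2 * r ^+ 2 -
                G f e ^+ 2 * r ^+ 2 * (1 - r ^+ 2 * G e e)); last by ring.
  by rewrite rG; ring.
have w0 : 0 < w by rewrite wE; exact: pG.
have s0 : 0 < rsqrt w by exact: rsqrt_gt0.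
have z0D : z0 \in D by exact: memvZ.
have z1D : z1 \in D by exact: memvZ.
have z0E : z0 = 0 *: f + r *: e by rewrite scale0r add0r.
have z1E : z1 = rsqrt w *: f + (- rsqrt w * k) *: e.
  by rewrite /z1 -/k -/W WE scalerDr !scalerA mulr1 mulrN mulNr.
have g00 : G z0 z0 = 1.
  by rewrite z0E (inner_comb2 _ _ _ _ iG fD eD) !mul0r !mulr0 !add0r mul0r addr0 -expr2.
have g01 : G z0 z1 = 0.
  rewrite z0E z1E (inner_comb2 _ _ _ _ iG fD eD) /k.
  have -> : 0 * rsqrt w * G f f + r * (- rsqrt w * (G f e * r ^+ 2)) * G e e +
    (0 * (- rsqrt w * (G f e * r ^+ 2)) + r * rsqrt w) * G f e =
    r * rsqrt w * G f e * (1 - r ^+ 2 * G e e) by ring.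
  by rewrite rG subrr mulr0.
have g11 : G z1 z1 = 1.
  have -> : z1 = rsqrt w *: W + 0 *: W by rewrite scale0r addr0.
  rewrite (inner_comb2 _ _ _ _ iG WD WD) -wE !mulr0 !mul0r !addr0 -expr2.
  by rewrite mul0r addr0 rsqrt_sqr.
split=> // v vD.
have [s [t ->]] : exists s t : R, v = s *: z0 + t *: z1.
  move: vD; rewrite DE span_cons span_seq1.
  move=> /memv_addP [_ /vlineP [s ->] [_ /vlineP [t ->] ->]].
  exists (r^-1 * (t + s * k)), (s / rsqrt w).
  rewrite /z0 /z1 -/k !scalerA scalerBr scalerA.
  have -> : r^-1 * (t + s * k) * r = t + s * k.
    by rewrite mulrAC mulVf ?mul1r // gt_eqF.
  rewrite divfK ?gt_eqF //.
  by rewrite scalerDl addrACA subrr addr0 addrC.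
rewrite !(inner_lin2 s t iG) // g00 g11 (sG z1 z0) // g01.
by rewrite !mulr1 !mulr0 addr0 add0r.
Qed.

Lemma sum_sqr_eq0 (a b : R) : a ^+ 2 + b ^+ 2 = 0 -> a = 0 /\ b = 0.
Proof.
move=> /eqP; by rewrite paddr_eq0 ?sqr_ge0 // !sqrf_eq0 => /andP[/eqP -> /eqP ->].
Qed.

Lemma near1_gt0 (a : R) : `|1 - a| < 1 -> 0 < a.
Proof. by move=> /ltr_normlW; lra. Qed.

Lemma dual_forms u v : (forall a b : R, a *: u + b *: v = 0 -> a = 0 /\ b = 0) ->
  exists L1 L2 : 'rV[R]_n,
    dotrow L1 u * dotrow L2 v - dotrow L1 v * dotrow L2 u = 1.
Proof.
move=> H; pose A := col_mx u v.
have : row_free A.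
  apply: inj_row_free => x; rewrite -[x]hsubmxK mul_row_col => E.
  have sE (m : 'M[R]_1) (z : 'rV[R]_n) : m *m z = m ord0 ord0 *: z.
    by rewrite {1}[m]mx11_scalar mul_scalar_mx.
  rewrite !sE in E; have [a0 b0] := H _ _ E.
  apply/rowP => i; rewrite -(splitK i); case: (fintype.split i) => l /=.
    by rewrite row_mxEl (ord1 l) a0 mxE.
  by rewrite row_mxEr (ord1 l) b0 mxE.
move=> /row_freeP [B AB].
pose L (k : 'I_(1 + 1)) : 'rV[R]_n := (col k B)^T.
have LE k l (z : 'rV[R]_n) : row l A = z -> dotrow (L k) z = (l == k)%:R.
  move=> <-; have := congr1 (fun m : 'M[R]_(1 + 1) => m l k) AB.
  rewrite !mxE => <-; apply: eq_bigr => i _; by rewrite !mxE mulrC.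
have ru : row (lshift 1 ord0) A = u.
  by apply/rowP => i; rewrite mxE col_mxEu.
have rv : row (rshift 1 ord0) A = v.
  by apply/rowP => i; rewrite mxE col_mxEd.
exists (L (lshift 1 ord0)), (L (rshift 1 ord0)).
rewrite !(LE _ _ _ ru) !(LE _ _ _ rv) !eqxx.
by rewrite eq_lrshift mul0r subr0 mulr1.
Qed.

End EuclideanPlane.

Section AnalyticFrame.
Context {R : realType} {n : nat} (M : analyticManifold R n).
Implicit Types (x : M) (i j k : atlas M) (X Y : vfield M).

Lemma vf_loc_scale i (h : M -> R) X :
  vf_loc i (fun x => h x *: X x) = fun y => h (ichart i y) *: vf_loc i X y.
Proof. by apply/funext => y; rewrite /vf_loc /tan_change -scalemxAl. Qed.

Lemma vf_locB i X Y :
  vf_loc i (fun x => X x - Y x) = fun y => vf_loc i X y - vf_loc i Y y.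
Proof. by apply/funext => y; rewrite /vf_loc /tan_change mulmxBl. Qed.

Lemma ana_vec_scale (h : 'rV[R]_n -> R) (Z : 'rV[R]_n -> 'rV[R]_n) y :
  ana y h -> (forall b, ana y (co Z b)) ->
  forall b, ana y (co (fun z => h z *: Z z) b).
Proof.
move=> ah aZ b; apply: ana_ext (anaM ah (aZ b)) => z.
by rewrite /co mxE.
Qed.

Lemma ana_vec_near (Z : 'rV[R]_n -> 'rV[R]_n) y : (forall b, ana y (co Z b)) ->
  \forall z \near y, forall b, ana z (co Z b).
Proof.
move=> aZ; exact: (@filter_forall _ _ (fun b z => ana z (co Z b)) (nbhs y) _
  (fun b => ana_near (aZ b))).
Qed.

Lemma ana_dotrow L (Z : 'rV[R]_n -> 'rV[R]_n) y : (forall b, ana y (co Z b)) ->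
  ana y (fun z => dotrow L (Z z)).
Proof.
by move=> aZ; apply: ana_sum => b; apply: anaM; [exact: ana_cst|exact: aZ].
Qed.

Local Opaque transJ trans bracket.

(** Gram-Schmidt turns a local analytic frame of the distribution into an
    orthonormal one, which differs from the given smooth frame by a smooth
    orthogonal matrix. *)
Lemma analytic_frame (Delta : tdistribution M) (g : tmetric M) X1 X2 i x0 :
  analytic_subriemannian 2 Delta g -> orthonormal_frame2 Delta g X1 X2 ->
  dom i x0 ->
  exists (O : set 'rV[R]_n) (Z1 Z2 : 'rV[R]_n -> 'rV[R]_n)
    (a b c d : 'rV[R]_n -> R),
  [/\ O (chart i x0), forall e, ana (chart i x0) (co Z1 e),
      forall e, ana (chart i x0) (co Z2 e) &
      orthogonal_change O Z1 Z2 (vf_loc i X1) (vf_loc i X2) a b c d].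
Proof.
move=> [[dD fD] _ rG aG] [sX1 sX2 XD XO] ix0.
have [U [Y [Uo Ux aY DY]]] := fD x0.
pose E := Y ord_max; pose F := Y ord0.
have DE x : U x -> Delta x = <<[:: F x; E x]>>%VS.
  move=> Ux'; rewrite DY //; congr (<<_>>)%VS.
  rewrite /image_mem (_ : enum 'I_2 = [:: ord0; ord_max]) //.
  by apply: (inj_map val_inj); rewrite val_enum_ord.
have YD (k : 'I_2) x : U x -> Y k x \in Delta x.
  move=> Ux'; rewrite DY // memv_span //; apply: map_f; exact: mem_enum.
pose r x := rsqrt (g x (E x) (E x)).
pose w x := g x (F x) (F x) - g x (F x) (E x) ^+ 2 * r x ^+ 2.
pose ZZ1 : vfield M := fun x => r x *: E x.
pose W : vfield M := fun x => F x - (g x (F x) (E x) * r x ^+ 2) *: E x.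
pose ZZ2 : vfield M := fun x => rsqrt (w x) *: W x.
have GS x : U x -> [/\ 0 < g x (E x) (E x), 0 < w x,
    ZZ1 x \in Delta x /\ ZZ2 x \in Delta x,
    [/\ g x (ZZ1 x) (ZZ1 x) = 1, g x (ZZ2 x) (ZZ2 x) = 1 &
        g x (ZZ1 x) (ZZ2 x) = 0] &
    forall v, v \in Delta x ->
      v = g x v (ZZ1 x) *: ZZ1 x + g x v (ZZ2 x) *: ZZ2 x].
  move=> Ux'; exact: (gram_schmidt (rG x) (DE x Ux') (dD x)).
have img : (chart i @` (U `&` dom i)) (chart i x0) by exists x0.
have aYl (k : 'I_2) b : ana (chart i x0) (co (vf_loc i (Y k)) b).
  apply: analytic_ana; exact: (aY k i b _ img).
have aGl (k l : 'I_2) : ana (chart i x0) ((fun x => g x (Y k x) (Y l x)) \o ichart i).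
  apply: analytic_ana.
  apply: (aG U (Y k) (Y l) Uo (aY k) (aY l) _ i _ img).
  by move=> x Ux'; split; exact: YD.
have at0 h : (h \o ichart i) (chart i x0) = h x0 :> R by rewrite /= chartK.
have [p1 p2 _ _ _] := GS x0 Ux.
have ar : ana (chart i x0) (r \o ichart i).
  apply: (ana_rsqrt (aGl ord_max ord_max)).
  by rewrite (at0 (fun x => g x (E x) (E x))).
have ar2 : ana (chart i x0) (fun y => (r \o ichart i) y ^+ 2).
  by apply: ana_ext (anaM ar ar) => y; rewrite expr2.
have aw : ana (chart i x0) (w \o ichart i).
  apply: ana_ext (anaB (aGl ord0 ord0)
    (anaM (anaM (aGl ord0 ord_max) (aGl ord0 ord_max)) ar2)) => y.
  by rewrite /w /= -/F -/E -expr2.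
have arw : ana (chart i x0) (rsqrt \o (w \o ichart i)).
  by apply: ana_rsqrt => //; rewrite (at0 w).
pose Z1 := vf_loc i ZZ1; pose Z2 := vf_loc i ZZ2.
have aZ1 b : ana (chart i x0) (co Z1 b).
  rewrite /Z1 (vf_loc_scale i r E).
  exact: (ana_vec_scale ar (aYl ord_max) b).
have aW b : ana (chart i x0) (co (vf_loc i W) b).
  rewrite /W (vf_locB i F (fun x => (g x (F x) (E x) * r x ^+ 2) *: E x)).
  rewrite (vf_loc_scale i (fun x => g x (F x) (E x) * r x ^+ 2) E).
  have a1 := ana_vec_scale (anaM (aGl ord0 ord_max) ar2) (aYl ord_max) b.
  apply: ana_ext (anaB (aYl ord0 b) a1) => y.
  by rewrite /co !mxE.
have aZ2 b : ana (chart i x0) (co Z2 b).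
  rewrite /Z2 (vf_loc_scale i (rsqrt \o w) W).
  exact: (ana_vec_scale arw aW b).
have [L1 [L2 HL]] : exists L1 L2 : 'rV[R]_n,
   dotrow L1 (Z1 (chart i x0)) * dotrow L2 (Z2 (chart i x0)) -
   dotrow L1 (Z2 (chart i x0)) * dotrow L2 (Z1 (chart i x0)) = 1.
  apply: dual_forms => al be.
  have jx := dom_chart_at x0.
  have J : transJ (chart_at x0) i x0 *m transJ i (chart_at x0) x0 = 1%:M.
    rewrite -(transJ_id jx); apply: esym; exact: transJ_cocycle.
  have e1 : Z1 (chart i x0) = ZZ1 x0 *m transJ (chart_at x0) i x0.
    exact: vf_locE.
  have e2 : Z2 (chart i x0) = ZZ2 x0 *m transJ (chart_at x0) i x0.
    exact: vf_locE.
  move=> /(congr1 (mulmx^~ (transJ i (chart_at x0) x0))).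
  rewrite e1 e2 mul0mx mulmxDl -!scalemxAl -!mulmxA J !mulmx1 => Eq.
  have [_ _ [z1D z2D] [g11 g22 g12] _] := GS x0 Ux.
  have [sG _ _] := rG x0.
  have G0 : g x0 (al *: ZZ1 x0 + be *: ZZ2 x0)
                 (al *: ZZ1 x0 + be *: ZZ2 x0) = al ^+ 2 + be ^+ 2.
    rewrite (inner_comb2 _ _ _ _ (rG x0) z1D z2D) g11 g22 g12; ring.
  have G00 : g x0 0 0 = 0.
    have := inner_comb2 0 0 0 0 (rG x0) z1D z2D.
    by rewrite !scale0r !addr0 => ->; ring.
  apply: sum_sqr_eq0; apply: esym.
  by move: G0; rewrite Eq G00.
pose D y := dotrow L1 (Z1 y) * dotrow L2 (Z2 y) -
            dotrow L1 (Z2 y) * dotrow L2 (Z1 y).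
have aD : ana (chart i x0) D.
  by apply: anaB; apply: anaM; exact: ana_dotrow.
have nD : \forall y \near chart i x0, 0 < D y.
  have cD : {for chart i x0, continuous D} by exact/differentiable_continuous/ana_diff.
  have D1 : D (chart i x0) = 1 := HL.
  move/cvgrPdist_lt: cD => /(_ 1 ltr01); apply: filterS => y.
  by rewrite D1; exact: near1_gt0.
have nZ1 := ana_vec_near aZ1.
have nZ2 := ana_vec_near aZ2.
have nU := near_chart ix0 Uo Ux.
have [N [Oo Ox HO]] := near_open (filterI (filterI nD nU) (filterI nZ1 nZ2)).
have s1 : smooth_vec N Z1 by move=> b y /HO [_ [/(_ b) /ana_smooth]].
have s2 : smooth_vec N Z2 by move=> b y /HO [_ [_ /(_ b) /ana_smooth]].
have sA X : smooth_vf X -> smooth_vec N (vf_loc i X).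
  move=> sX b y /HO [[_ [x [ix _ ->]]] _].
  by apply: smooth_vf_field.
pose co1 X y := g (ichart i y) (X (ichart i y)) (ZZ1 (ichart i y)).
pose co2 X y := g (ichart i y) (X (ichart i y)) (ZZ2 (ichart i y)).
have EX X : (forall x, X x \in Delta x) -> forall y, N y ->
    vf_loc i X y = co1 X y *: Z1 y + co2 X y *: Z2 y.
  move=> XD' y /HO [[_ [x [ix Ux' ->]]] _].
  rewrite /co1 /co2 chartK //.
  have [_ _ _ _ /(_ (X x) (XD' x)) e] := GS x Ux'.
  rewrite /Z1 /Z2 (vf_locE X ix) (vf_locE ZZ1 ix) (vf_locE ZZ2 ix).
  by rewrite {1}e mulmxDl -!scalemxAl.
have X1D x : X1 x \in Delta x by case: (XD x).
have X2D x : X2 x \in Delta x by case: (XD x).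
have D0 y : N y -> 0 < D y by move=> /HO [[]].
have [sa sb] := coef_smooth Oo s1 s2 (sA _ sX1) (EX _ X1D) D0.
have [sc sd] := coef_smooth Oo s1 s2 (sA _ sX2) (EX _ X2D) D0.
exists N, Z1, Z2, (co1 X1), (co2 X1), (co1 X2), (co2 X2); split=> //.
split=> //.
- exact: sA.
- exact: sA.
- exact: EX.
- exact: EX.
- move=> y /HO [[_ [x [ix Ux' ->]]] _]; rewrite /co1 /co2 chartK //.
  have [_ _ [z1D z2D] [g11 g22 g12] dec] := GS x Ux'.
  have Q u v (a b c d : R) : u = a *: ZZ1 x + b *: ZZ2 x ->
      v = c *: ZZ1 x + d *: ZZ2 x -> g x u v = a * c + b * d.
    move=> -> ->; rewrite (inner_comb2 _ _ _ _ (rG x) z1D z2D) g11 g22 g12.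
    by rewrite !mulr1 mulr0 addr0.
  have [h11 h22 h12] := XO x.
  have d1 := dec _ (X1D x); have d2 := dec _ (X2D x).
  split; [rewrite -h11|rewrite -h22|rewrite -h12]; rewrite ?expr2; apply: esym.
  - exact: (Q _ _ _ _ _ _ d1 d1).
  - exact: (Q _ _ _ _ _ _ d2 d2).
  - exact: (Q _ _ _ _ _ _ d1 d2).
Qed.

End AnalyticFrame.

(** * The Hamiltonian fields on the space of coordinates and momenta *)

Section Pullback.
Context {R : realType} {n : nat}.
Implicit Types (f : 'rV[R]_n -> R) (z : 'rV[R]_(n + n)) (k : nat).

Local Notation base := (@lsubmx R 1 n n).

Lemma derive_lsubmx z v : 'D_v base z = base v.
Proof.
rewrite deriveE; last exact: differentiable_lsubmx.
rewrite diff_lin //; exact: continuous_lsubmx.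
Qed.

Lemma pd_lsubmx f z (I : 'I_(n + n)) : differentiable f (base z) ->
  pd I (f \o base) z =
  match fintype.split I with inl a => pd a f (base z) | inr _ => 0 end.
Proof.
move=> df; rewrite pdE derive_compE //; last exact: differentiable_lsubmx.
rewrite derive_lsubmx derive_pd //.
rewrite -{1}(splitK I); case: (fintype.split I) => a /=.
  rewrite (bigD1 a) //= big1 ?addr0; last first.
    move=> b ba; rewrite !mxE eq_lshift (negbTE ba) andbF mul0r.
    by [].
  by rewrite !mxE !eqxx mul1r.
by rewrite big1 // => b _; rewrite !mxE eq_lrshift andbF mul0r.
Qed.

Lemma open_lsubmx (O : set 'rV[R]_n) : open O ->
  open [set z : 'rV[R]_(n + n) | O (base z)].
Proof.
by move=> Oo; apply: open_comp => // z _; exact: continuous_lsubmx.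
Qed.

Lemma jet_lsubmx (O : set 'rV[R]_n) k f z : open O -> smooth_in O f ->
  O (base z) ->
  Ck k (f \o base) z /\ jet k (f \o base) z = jet k f (base z).
Proof.
move=> Oo; have Oo' := open_lsubmx Oo.
elim: k f z => [|k IH] f z sf Oz.
  split=> //; split=> //; apply: differentiable_comp.
    exact: differentiable_lsubmx.
  exact: (smooth_in_diff sf Oz).
have E (I : 'I_(n + n)) y : O (base y) ->
    match fintype.split I with inl a => pd a f \o base | inr _ => cst 0 end y =
    pd I (f \o base) y.
  move=> Oy; rewrite pd_lsubmx; last exact: (smooth_in_diff sf Oy).
  by case: (fintype.split I).
have H (a : 'I_n) := IH (pd a f) z (smooth_in_pd a sf) Oz.
split.
  split.
    apply: differentiable_comp; first exact: differentiable_lsubmx.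
    exact: (smooth_in_diff sf Oz).
  move=> I; apply: (Ck_eq Oo' (E I) Oz).
  case: (fintype.split I) => a; last exact: Ck_cst.
  exact: (H a).1.
rewrite /=; congr (_ * _); rewrite big_split_ord /= [X in _ + X]big1 ?addr0.
  apply: eq_bigr => a _; rewrite -(H a).2.
  apply: (jet_eq k Oo' _ Oz) => y Oy; rewrite -E //.
  by rewrite (unsplitK (inl a)).
move=> a _; rewrite -(jet_eq k Oo' (E (rshift n a)) Oz) (unsplitK (inr a)).
by case: k {IH H} => [|k]; [rewrite /= normr0|rewrite jet_cst].
Qed.

Lemma ana_lsubmx f z : ana (base z) f -> ana z (f \o base).
Proof.
move=> [W [s [B [Wo Wz s0 B0 H]]]].
exists [set z : 'rV[R]_(n + n) | W (base z)], s, B; split=> //.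
  exact: open_lsubmx.
have sf : smooth_in W f by move=> y /H [].
move=> y Wy; split=> [k|K]; first by have [] := jet_lsubmx k Wo sf Wy.
have [_ /(_ K)] := H _ Wy; apply: le_trans.
rewrite le_eqVlt; apply/orP; left; apply/eqP; apply: eq_bigr => k _.
by have [_ ->] := jet_lsubmx k Wo sf Wy.
Qed.

Lemma ana_lbr (A B : 'rV[R]_n -> 'rV[R]_n) y : (forall b, ana y (co A b)) ->
  (forall b, ana y (co B b)) -> forall b, ana y (co (lbr A B) b).
Proof.
move=> aA aB b.
have nA := ana_vec_near aA.
have nB := ana_vec_near aB.
have a : ana y (fun z : 'rV[R]_n => \sum_e (co A e z * pd e (co B b) z -
                                 co B e z * pd e (co A b) z)).
  by apply: ana_sum => e; apply: anaB; apply: anaM => //; exact: ana_pd.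
apply: ana_eq a; apply: filterS2 nA nB => z hA hB.
rewrite [RHS]lbrE //; apply: co_diff => e; apply: ana_diff; [exact: hA|exact: hB].
Qed.

Definition momentum (Z : 'rV[R]_n -> 'rV[R]_n) z : R :=
  dotrow (rsubmx z) (Z (base z)).

Lemma momentum_row Z (y q : 'rV[R]_n) : momentum Z (row_mx y q) = dotrow q (Z y).
Proof. by rewrite /momentum row_mxKl row_mxKr. Qed.

Lemma ana_momentum Z z : (forall b, ana (base z) (co Z b)) ->
  ana z (momentum Z).
Proof.
move=> aZ.
have a : ana z (fun y => \sum_c y ord0 (rshift n c) * (co Z c \o base) y).
  by apply: ana_sum => c; apply: anaM; [exact: ana_coord|exact: ana_lsubmx].
by apply: ana_ext a => y; apply: eq_bigr => c _; rewrite mxE.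
Qed.

(** The coordinates of the Hamiltonian vector field of the momentum of [Z]. *)
Definition momentum_field (Z : 'rV[R]_n -> 'rV[R]_n) (I : 'I_(n + n)) z : R :=
  match fintype.split I with
  | inl a => co Z a (base z)
  | inr a => - cograd Z (base z) (rsubmx z) ord0 a
  end.

Lemma ana_momentum_field Z I z : (forall b, ana (base z) (co Z b)) ->
  ana z (momentum_field Z I).
Proof.
move=> aZ; rewrite /momentum_field; case: (fintype.split I) => a.
  exact: ana_lsubmx.
have h : ana z (fun y => \sum_c y ord0 (rshift n c) * (pd a (co Z c) \o base) y).
  apply: ana_sum => c; apply: anaM; first exact: ana_coord.
  by apply: ana_lsubmx; exact: ana_pd.
apply: ana_ext (anaN h) => y; congr (- _); rewrite mxE.
by apply: eq_bigr => c _; rewrite mxE.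
Qed.

(** The field is the combination of the Hamiltonian fields of the momenta of
    [Z1] and [Z2] with multipliers [m1] and [m2] that are themselves analytic
    functions of position and momentum; it is analytic, hence so is the
    projection of its integral curves. *)
Lemma multiplier_curve_analytic (Z1 Z2 : 'rV[R]_n -> 'rV[R]_n)
    (m1 m2 : 'rV[R]_(n + n) -> R) (y q : R -> 'rV[R]_n) (tau : R) :
  (forall b, ana (y tau) (co Z1 b)) -> (forall b, ana (y tau) (co Z2 b)) ->
  ana (row_mx (y tau) (q tau)) m1 -> ana (row_mx (y tau) (q tau)) m2 ->
  (\forall t \near tau, let z := row_mx (y t) (q t) in
    is_derive (t : R) (1 : R) y (m1 z *: Z1 (y t) + m2 z *: Z2 (y t)) /\
    is_derive (t : R) (1 : R) q (- (m1 z *: cograd Z1 (y t) (q t) +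
                         m2 z *: cograd Z2 (y t) (q t)))) ->
  forall b, analytic_curve tau (co y b).
Proof.
move=> a1 a2 am1 am2 H b.
pose z t := row_mx (y t) (q t).
pose F I s := m1 s * momentum_field Z1 I s + m2 s * momentum_field Z2 I s.
have -> : co y b = (fun s : 'rV[R]_(n + n) => s ord0 (lshift n b)) \o z.
  by apply/funext => t; rewrite /co /= row_mxEl.
apply: (@integral_curve_analytic _ _ z F).
- apply: filterS H => t /= [/is_derive_co dy /is_derive_co dq].
  apply/is_derive_co => I; rewrite mxE /F /momentum_field.
  rewrite -{1}(splitK I); case: (fintype.split I) => a /=.
    rewrite !row_mxKl.
    have := dy a; rewrite !mxE.
    rewrite (_ : co z (lshift n a) = co y a) //.
    by apply/funext => s; rewrite /co /z row_mxEl.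
  rewrite row_mxKl row_mxKr.
  have := dq a; rewrite [X in is_derive _ _ _ X -> _]mxE.
  rewrite [X in is_derive _ _ _ (- X) -> _]mxE.
  rewrite [X in is_derive _ _ _ (- (X + _)) -> _]mxE.
  rewrite [X in is_derive _ _ _ (- (_ + X)) -> _]mxE.
  rewrite opprD -!mulrN.
  rewrite (_ : co z (rshift n a) = co q a) //.
  by apply/funext => s; rewrite /co /z row_mxEr.
- move=> I; apply: anaD; apply: anaM => //;
    by apply: ana_momentum_field; rewrite row_mxKl.
- exact: ana_coord.
Qed.

End Pullback.

Section HamiltonianCurves.
Context {R : realType} {n : nat} (M : analyticManifold R n).
Variables (Delta : tdistribution M) (g : tmetric M) (X1 X2 : vfield M).
Hypothesis sR : analytic_subriemannian 2 Delta g.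
Hypothesis oF : orthonormal_frame2 Delta g X1 X2.
Implicit Types (x : M) (i j k : atlas M).

Let s1 : smooth_field X1.
Proof. by have [h _ _ _] := oF; exact: smooth_vf_field. Qed.

Let s2 : smooth_field X2.
Proof. by have [_ h _ _] := oF; exact: smooth_vf_field. Qed.

Let s12 : smooth_field (bracket X1 X2) := smooth_bracket s1 s2.

Lemma bracket3_loc i x (X : vfield M) : smooth_field X -> dom i x ->
  vf_loc i (bracket X (bracket X1 X2)) (chart i x) =
  lbr (vf_loc i X) (lbr (vf_loc i X1) (vf_loc i X2)) (chart i x).
Proof.
move=> sX ix; apply: (etrans (bracket_loc sX s12 ix)).
have E : \forall y \near chart i x, vf_loc i (bracket X1 X2) y =
    lbr (vf_loc i X1) (vf_loc i X2) y.
  apply: filterS (near_chart ix openT I) => y [x' [ix' _ ->]].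
  exact: bracket_loc.
by rewrite /lbr (near_eq_derive _ E) (nbhs_singleton E).
Qed.

Lemma within_continuous_at (T : topologicalType) (a b t : R) (f : R -> T) :
  {within `[a, b], continuous f} -> a < t < b -> {for t, continuous f}.
Proof.
move=> cf tab.
have sub : `]a, b[%classic `<=` `[a, b]%classic.
  by move=> u /=; rewrite !in_itv /= => /andP[u1 u2]; rewrite !ltW.
have := continuous_subspaceW sub cf.
rewrite continuous_open_subspace; last exact: interval_open.
by apply; rewrite inE /= in_itv.
Qed.

Lemma near_interior (a b tau : R) : a < tau < b ->
  \forall t \near tau, a < t < b.
Proof.
move=> tab; have : \forall t \near tau, t \in `]a, b[.
  by apply: near_in_itvoo; rewrite in_itv.
by apply: filterS => t; rewrite in_itv.
Qed.

(** Close to [tau] the curve stays in the chart and in [O], at interior times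
    of its interval of definition, where one-sided derivatives are derivatives. *)
Lemma curve_state i (V : cotvf M) (T : R) (gam : R -> M) (p : R -> 'rV[R]_n)
    (O : set 'rV[R]_n) (tau : R) :
  integral_curve V T gam p -> 0 < tau < T -> dom i (gam tau) ->
  open O -> O (chart i (gam tau)) ->
  \forall t \near tau, [/\ dom i (gam t), O (chart i (gam t)),
    {for t, continuous gam}, 0 <= t <= T &
    forall m1 m2, V (gam t) (p t) =
      m1 *: ham_vf (hlin X1) (gam t) (p t) +
      m2 *: ham_vf (hlin X2) (gam t) (p t) ->
    is_derive t 1 (base_curve i gam)
      (m1 *: vf_loc i X1 (chart i (gam t)) +
       m2 *: vf_loc i X2 (chart i (gam t))) /\
    is_derive t 1 (cot_curve i gam p)
      (- (m1 *: cograd (vf_loc i X1) (chart i (gam t)) (cot_curve i gam p t) +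
          m2 *: cograd (vf_loc i X2) (chart i (gam t)) (cot_curve i gam p t)))].
Proof.
move=> [cg dV] tT ix Oo Ox.
have ct t : 0 < t < T -> {for t, continuous gam}.
  exact: within_continuous_at.
have nI := near_interior tT.
have nD : \forall t \near tau, dom i (gam t).
  by apply: (ct tau tT); apply: open_nbhs_nbhs; split=> //; exact: dom_open.
have nO : \forall t \near tau, O (chart i (gam t)).
  have : \forall x \near gam tau, O (chart i x).
    apply: (@chart_continuous _ _ M i _ ix).
    by apply: open_nbhs_nbhs.
  by move/(ct tau tT).
apply: filterS2 (filterI nI nD) nO => t [tI ixt] Ot.
have tc := ct t tI.
have tT' : 0 <= t <= T by case/andP: tI => *; rewrite !ltW.
split=> // m1 m2 E.
have := dV t tT'; cbv zeta; rewrite E => D.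
exact: (frame_curve_in_chart s1 s2 ixt tc (deriv_within_is_derive tI D)).
Qed.

Lemma normal_curve_analytic (T : R) (gam : R -> M) (p : R -> 'rV[R]_n) tau i b :
  integral_curve (ham_vf (H_normal X1 X2)) T gam p -> 0 < tau < T ->
  dom i (gam tau) -> analytic_curve tau (co (base_curve i gam) b).
Proof.
move=> ic tT ix.
have [N [Z1 [Z2 [a [a' [c [d [Ox aZ1 aZ2 oc]]]]]]]] := analytic_frame sR oF ix.
apply: (@multiplier_curve_analytic _ _ Z1 Z2 (momentum Z1) (momentum Z2)
  (base_curve i gam) (cot_curve i gam p)).
- exact: aZ1.
- exact: aZ2.
- by apply: ana_momentum; rewrite row_mxKl; exact: aZ1.
- by apply: ana_momentum; rewrite row_mxKl; exact: aZ2.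
apply: filterS (curve_state ic tT ix (oc_open oc) Ox) => t [ixt Ot tc tT' H].
have [dy dq] := H _ _ (ham_vf_normal _ _ s1 s2).
have [e1 e2] := normal_frame_change (cot_curve i gam p t) oc Ot.
rewrite /= /momentum row_mxKl row_mxKr.
rewrite (hlin_loc X1 _ ixt) (hlin_loc X2 _ ixt) in dy dq.
rewrite -[base_curve i gam t]/(chart i (gam t)) -e1 -e2.
by split.
Qed.

Lemma scale_comb (V : lmodType R) (r a b c d : R) (u v u' v' : V) :
  a *: u + b *: v = c *: u' + d *: v' ->
  (r * a) *: u + (r * b) *: v = (r * c) *: u' + (r * d) *: v'.
Proof. by rewrite -!scalerA -!scalerDr => ->. Qed.

Lemma normalized_comb (V : lmodType R) (r h1 h2 N2 : R) (u v : V) :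
  h1 ^+ 2 + h2 ^+ 2 = N2 ->
  r *: ((- h1 / Num.sqrt (h1 ^+ 2 + h2 ^+ 2)) *: u +
        (h2 / Num.sqrt (h1 ^+ 2 + h2 ^+ 2)) *: v) =
  (r * rsqrt N2 * - h1) *: u + (r * rsqrt N2 * h2) *: v.
Proof.
move=> ->; rewrite scalerDr !scalerA; congr (_ *: _ + _ *: _).
  by rewrite -mulrA [rsqrt _ * _]mulrC.
by rewrite -mulrA [rsqrt _ * _]mulrC.
Qed.

Lemma G_vf_scale (eps : R) x (p : 'rV[R]_n) (N2 : R) :
  hlin (X212 X1 X2) x p ^+ 2 + hlin (X112 X1 X2) x p ^+ 2 = N2 ->
  eps *: G_vf X1 X2 x p =
  (eps * rsqrt N2 * - hlin (X212 X1 X2) x p) *: ham_vf (hlin X1) x p +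
  (eps * rsqrt N2 * hlin (X112 X1 X2) x p) *: ham_vf (hlin X2) x p.
Proof.
by move=> E; exact: normalized_comb E.
Qed.

(** The factor [eps] covers both orientations of the abnormal field. *)
Lemma abnormal_curve_analytic (eps : R) (T : R) (gam : R -> M)
    (p : R -> 'rV[R]_n) tau i b :
  (forall t, 0 <= t <= T -> Rset X1 X2 (gam t, p t)) ->
  integral_curve (fun x q => eps *: G_vf X1 X2 x q) T gam p -> 0 < tau < T ->
  dom i (gam tau) -> analytic_curve tau (co (base_curve i gam) b).
Proof.
move=> hR ic tT ix.
have [N [Z1 [Z2 [a [a' [c [d [Ox aZ1 aZ2 oc]]]]]]]] := analytic_frame sR oF ix.
pose K112 := lbr Z1 (lbr Z1 Z2); pose K212 := lbr Z2 (lbr Z1 Z2).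
pose Q z := momentum K112 z * momentum K112 z +
            momentum K212 z * momentum K212 z.
have QQ s : momentum K112 s ^+ 2 + momentum K212 s ^+ 2 = Q s.
  by congr (_ + _); exact: expr2.
pose y0 := chart i (gam tau).
have aK1 : forall b, ana y0 (co K112 b) := ana_lbr aZ1 (ana_lbr aZ1 aZ2).
have aK2 : forall b, ana y0 (co K212 b) := ana_lbr aZ2 (ana_lbr aZ1 aZ2).
pose z0 := row_mx (base_curve i gam tau) (cot_curve i gam p tau).
have am1 : ana z0 (momentum K112) by apply: ana_momentum; rewrite row_mxKl; exact: aK1.
have am2 : ana z0 (momentum K212) by apply: ana_momentum; rewrite row_mxKl; exact: aK2.
have aQ : ana z0 Q := anaD (anaM am1 am1) (anaM am2 am2).
(* Along the curve the abnormal field, up to normalization, is expressed by the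
   same formula in both frames, and the normalization does not vanish. *)
have key t : 0 <= t <= T -> dom i (gam t) -> N (chart i (gam t)) ->
    let q := cot_curve i gam p t in let y := chart i (gam t) in
    let z := row_mx y q in
    let h112 := hlin (X112 X1 X2) (gam t) (p t) in
    let h212 := hlin (X212 X1 X2) (gam t) (p t) in
    [/\ h212 ^+ 2 + h112 ^+ 2 = Q z, 0 < Q z,
      - h212 *: vf_loc i X1 y + h112 *: vf_loc i X2 y =
      - momentum K212 z *: Z1 y + momentum K112 z *: Z2 y &
      - h212 *: cograd (vf_loc i X1) y q + h112 *: cograd (vf_loc i X2) y q =
      - momentum K212 z *: cograd Z1 y q + momentum K112 z *: cograd Z2 y q].
  move=> tT' ixt Ot q y z h112 h212.
  have [[k1 k2 k12] nD3] := hR t tT'.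
  have h1 : dotrow q (vf_loc i X1 y) = 0.
    by rewrite -k1; apply: esym; exact: hlin_loc.
  have h2 : dotrow q (vf_loc i X2 y) = 0.
    by rewrite -k2; apply: esym; exact: hlin_loc.
  have h12 : dotrow q (lbr (vf_loc i X1) (vf_loc i X2) y) = 0.
    rewrite -(bracket_loc s1 s2 ixt) -k12; apply: esym; exact: hlin_loc.
  have e112 : h112 = dotrow q (lbr (vf_loc i X1)
      (lbr (vf_loc i X1) (vf_loc i X2)) y).
    rewrite -(bracket3_loc s1 ixt); exact: hlin_loc.
  have e212 : h212 = dotrow q (lbr (vf_loc i X2)
      (lbr (vf_loc i X1) (vf_loc i X2)) y).
    rewrite -(bracket3_loc s2 ixt); exact: hlin_loc.
  have m1 := momentum_row K112 y q; have m2 := momentum_row K212 y q.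
  have [g1 g2 g3] := abnormal_frame_change oc Ot h1 h2 h12 e112 e212 m1 m2.
  have QE : h212 ^+ 2 + h112 ^+ 2 = Q z := etrans g1 (QQ _).
  split; [exact: QE| |exact: g2|exact: g3].
  rewrite -QE lt_neqAle; apply/andP; split; last first.
    by apply: addr_ge0; exact: sqr_ge0.
  rewrite eq_sym; apply/eqP => /sum_sqr_eq0 [n2 n1].
  exact: (nD3 (conj (And3 k1 k2 k12) (conj n1 n2))).
have tT0 : 0 <= tau <= T by case/andP: tT => *; rewrite !ltW.
have [_ Q0 _ _] := key tau tT0 ix Ox.
have ar : ana z0 (rsqrt \o Q) by exact: ana_rsqrt.
apply: (@multiplier_curve_analytic _ _ Z1 Z2
  (fun z => eps * (rsqrt \o Q) z * - momentum K212 z)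
  (fun z => eps * (rsqrt \o Q) z * momentum K112 z)
  (base_curve i gam) (cot_curve i gam p)).
- exact: aZ1.
- exact: aZ2.
- exact: (anaM (anaM (ana_cst _ _) ar) (anaN am2)).
- exact: (anaM (anaM (ana_cst _ _) ar) am1).
apply: filterS (curve_state ic tT ix (oc_open oc) Ox) => t [ixt Ot tc tT' H].
have [QE Qt e1 e2] := key t tT' ixt Ot.
have [dy dq] := H _ _ (G_vf_scale eps QE).
split; [apply: (is_derive_eq dy)|apply: (is_derive_eq dq)].
  exact: scale_comb e1.
by congr (- _); exact: scale_comb e2.
Qed.

Lemma regular_abnormal_analytic (T : R) (gam : R -> M) tau i b :
  regular_abnormal_geodesic X1 X2 T gam -> 0 < tau < T ->
  dom i (gam tau) -> analytic_curve tau (co (base_curve i gam) b).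
Proof.
move=> [_ [p [hR [ic|ic]]]] tT ix.
  apply: (@abnormal_curve_analytic 1 T gam p) => //.
  by have [h1 h2] := ic; split=> // t tT'; rewrite scale1r; exact: h2.
apply: (@abnormal_curve_analytic (-1) T gam p) => //.
by have [h1 h2] := ic; split=> // t tT'; rewrite scaleN1r; exact: h2.
Qed.

End HamiltonianCurves.

Section Branching.
Context {R : realType} {n : nat} (M : analyticManifold R n).

(** The identity theorem, for the coordinates in the chart at [gam tau]: the
    set of times of agreement extends beyond [tau]. *)
Lemma analytic_no_branching (P : R -> (R -> M) -> Prop) (T : R) (gam : R -> M)
    (tau : R) :
  (forall (S : R) (c : R -> M), P S c -> {within `[0, S], continuous c}) ->
  (forall (S : R) (c : R -> M), P S c -> 0 < tau < S ->
    forall i b, dom i (c tau) -> analytic_curve tau (co (base_curve i c) b)) ->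
  P T gam -> ~ branching P T gam tau.
Proof.
move=> cP aP Pg [tT [e0 [gam' [e00 Pg' ag ne]]]].
have /andP[t0 tT'] := tT.
have tE : 0 < tau < tau + e0 by rewrite t0 ltrDl.
pose i := chart_at (gam tau).
have ix : dom i (gam tau) by exact: dom_chart_at.
have E0 : gam' tau = gam tau by apply: ag; rewrite lexx ltW.
have ix' : dom i (gam' tau) by rewrite E0.
have nD (c : R -> M) S : P S c -> 0 < tau < S -> dom i (c tau) ->
    \forall t \near tau, dom i (c t).
  move=> Pc tS ic; apply: (within_continuous_at (cP _ _ Pc) tS).
  by apply: open_nbhs_nbhs; split=> //; exact: dom_open.
have nb b : \forall t \near tau,
    co (base_curve i gam) b t = co (base_curve i gam') b t.
  have [|d d0 H] := analytic_curve_unique (aP _ _ Pg tT i b ix)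
     (aP _ _ Pg' tE i b ix').
    exists tau => // t; rewrite subrr => /andP[u1 u2].
    by rewrite /co /base_curve /= ag // !ltW.
  apply/nbhs_ballP; exists d => // t; rewrite -ball_normE /= distrC.
  exact: H.
have nE : \forall t \near tau, forall b, co (base_curve i gam) b t =
    co (base_curve i gam') b t := @filter_forall _ _ (fun b t => co (base_curve i gam) b t =
  co (base_curve i gam') b t) (nbhs tau) _ nb.
have : \forall t \near tau, gam t = gam' t.
  have n1 := nD _ _ Pg tT ix; have n2 := nD _ _ Pg' tE ix'.
  near=> t.
  have d1 : dom i (gam t) by near: t.
  have d2 : dom i (gam' t) by near: t.
  have H : forall b, co (base_curve i gam) b t = co (base_curve i gam') b t.
    near: t. exact: nE.
  rewrite -(chartK d1) -(chartK d2); congr (ichart i _).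
  by apply/rowP => b; exact: H.
move=> /nbhs_ballP [d /= d0 H].
pose e := Num.min e0 (d / 2).
have ee : 0 < e <= e0 by rewrite lt_min e00 divr_gt0 //= ge_min lexx.
have [t [/andP[u1 u2] nt]] := ne e ee.
apply: nt; have [tt|tt] := leP t tau; first by apply: ag; rewrite u1.
apply: esym; apply: H; rewrite -ball_normE /= distrC ger0_norm ?subr_ge0 ?ltW //.
have : e <= d / 2 by rewrite ge_min lexx orbT.
lra.
Unshelve. all: by end_near. Qed.

End Branching.

Theorem proposition3p12 (R : realType) (n : nat) (M : analyticManifold R n)
    (Delta : tdistribution M) (g : tmetric M) (X1 X2 : vfield M) :
  analytic_subriemannian 2 Delta g ->
  orthonormal_frame2 Delta g X1 X2 ->
  (forall (T : R) (gam : R -> M), regular_abnormal_geodesic X1 X2 T gam ->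
     forall tau : R,
       ~ branching (regular_abnormal_geodesic X1 X2) T gam tau) /\
  (forall (T : R) (gam : R -> M), regular_abnormal_geodesic X1 X2 T gam ->
     normal_geodesic X1 X2 T gam ->
     forall tau : R,
       ~ branching (normal_geodesic X1 X2) T gam tau).
Proof.
move=> sR oF; split=> T gam Ra.
  move=> tau; apply: analytic_no_branching => // S c.
    by move=> [_ [p [_ [[]|[]]]]].
  by move=> Pc tS i b ic; exact: (regular_abnormal_analytic sR oF b Pc tS ic).
move=> Ng tau; apply: analytic_no_branching => // S c.
  by move=> [_ [p []]].
move=> [_ [p ic]] tS i b ix.
exact: (normal_curve_analytic sR oF b ic tS ix).
Qed.
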